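(* Let $Q=[-1,1]^2$, $Q_1=[0,1]\times[0,1]$, $Q_2=[-1,0]\times[0,1]$, $Q_3=[-1,0]\times[-1,0]$, $Q_4=[0,1]\times[-1,0]$. Let $$f=\sigma\chi_{Q_2}-(\tau+\sigma)\chi_{Q_1}+(\tau-\sigma)\chi_{Q_3}+\sigma\chi_{Q_4},$$ where $(\sigma,\tau)$ belongs to the branch $\mathcal{B}$ described in the context. Let $u\in H^1(Q;\mathbb{R}^2)$ be a solution of $$\int_Q 2\nabla u\cdot\nabla\varphi+f(x)\,\mathrm{cof}\,\nabla u\cdot\nabla\varphi\,dx=0\qquad\text{for all }\varphi\in C_c^\infty(Q;\mathbb{R}^2)$$ belonging to the explicit family (S) described in the context, and define the function $g:=\det\nabla u$ and $$\mathcal{A}_g=\{v\in H^1_{u_0}(Q;\mathbb{R}^2):\ \det\nabla v=g\ \text{a.e. in }Q\},\qquad u_0:=u .$$ Then $u$ is a global minimizer of the Dirichlet energy $\mathbb{D}(v)=\int_Q|\nabla v|^2\,dx$ in $\mathcal{A}_g$.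
   Context: The branch $\mathcal{B}$: let $h(\sigma,\tau)=\tau^4-8\tau^2\sigma^2+32\tau\sigma+16\sigma^4$ and $y(\sigma,\tau)=\frac{|\sigma|}{2}+\frac{|\tau|}{\sqrt8}$. Let $\tau_0=2$ and let $\sigma_0\simeq-0.2253$ be the larger of the two real roots of $1+4\sigma-2\sigma^2+\sigma^4$, so that $h(\sigma_0,\tau_0)=0$ and $\partial_\sigma h(\sigma_0,\tau_0)\neq0$. Then $\mathcal{B}=\{(\sigma(\tau),\tau):\tau\in(2-\epsilon,2+\epsilon)\}$, where $\tau\mapsto\sigma(\tau)$ is the smooth function given by the Implicit Function Theorem with $\sigma(2)=\sigma_0$ and $h(\sigma(\tau),\tau)=0$, and $\epsilon>0$ is small enough that $y(\sigma,\tau)<1$ for all $(\sigma,\tau)\in\mathcal{B}$. The family (S): identify $(x_1,x_2)$ with $z=x_1+ix_2$ and $u=(u_1,u_2)$ with $u_1+iu_2$. Let $f_i$ be the value of $f$ on $Q_i$, and put $\alpha=f_2-f_1=2\sigma+\tau$, $\beta=f_3-f_2=\tau-2\sigma$, $\gamma=f_4-f_3=-\beta$, $\delta=f_1-f_4=-\alpha$, $p=\beta\gamma\delta+4\beta-4\delta$. (The equation $h(\sigma,\tau)=0$ is the condition $\alpha\beta\gamma\delta+4(\beta-\delta)(\alpha+\gamma)=0$.) The members of (S) are the functions $$u(z)=\sum_{n\ \mathrm{even}}a_n(z^n-\bar z^n)+\sum_{j=1}^4u^{(j)}(z)\chi_{Q_j}(z),$$ where $$u^{(1)}(z)=\sum_{n\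 \mathrm{odd}}\lambda^{(1)}_n\big(2\beta\gamma(z^n+\bar z^n)-p(z^n-\bar z^n)\big),$$ $$u^{(2)}(z)=\sum_{n\ \mathrm{odd}}\lambda^{(2)}_n\big(2\gamma\delta(z^n+\bar z^n)-p(z^n-\bar z^n)\big),$$ $$u^{(3)}(z)=\sum_{n\ \mathrm{odd}}\lambda^{(3)}_n\big(2\gamma\delta(z^n+\bar z^n)-(4\beta-4\delta)(z^n-\bar z^n)\big),$$ $$u^{(4)}(z)=\sum_{n\ \mathrm{odd}}\lambda^{(4)}_n\big(2\beta\gamma(z^n+\bar z^n)-(4\beta-4\delta)(z^n-\bar z^n)\big),$$ the sums being over even, respectively odd, natural numbers $n$, the constants $a_n$ possibly complex, and the coefficients $a_n$, $\lambda_n^{(j)}$ chosen so that the series converge. Notation: $H^1_{u_0}(Q;\mathbb{R}^2)$ is the set of $v\in H^1(Q;\mathbb{R}^2)$ with $v=u_0$ on $\partial Q$ in the sense of traces; $C_c^\infty(Q;\mathbb{R}^2)$ denotes smooth maps compactly supported in the interior of $Q$; $\chi_S$ is the characteristic function of $S$. For matrices $A\cdot B=\mathrm{tr}(A^TB)$, $|A|^2=A\cdot A$; for $A\in\mathbb{R}^{2\times2}$ with rows $(a,b)$, $(c,d)$, $\mathrm{cof}\,A$ has rows $(d,-c)$, $(-b,a)$. *)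

(* Defs.v *)
From HB Require Import structures.
From mathcomp Require Import all_boot all_order all_algebra.
From mathcomp Require Import all_classical all_reals all_analysis.
From mathcomp Require Import complex.
Set Implicit Arguments.
Unset Strict Implicit.
Unset Printing Implicit Defensive.
Import Order.TTheory GRing.Theory Num.Theory.
Import numFieldNormedType.Exports.
Local Open Scope classical_set_scope.
Local Open Scope ring_scope.

Notation leb2 := (@lebesgue_measure _ \x @lebesgue_measure _)%E.

Section Square.
Context {R : realType}.

Definition sq_of (a b c d : R) : set (R * R) := `[a, b] `*` `[c, d].

Definition Q : set (R * R) := sq_of (-1) 1 (-1) 1.
Definition Q1 : set (R * R) := sq_of 0 1 0 1.
Definition Q2 : set (R * R) := sq_of (-1) 0 0 1.
Definition Q3 : set (R * R) := sq_of (-1) 0 (-1) 0.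
Definition Q4 : set (R * R) := sq_of 0 1 (-1) 0.

(* The closed quadrants overlap, but only on the coordinate axes, a null set. *)
Definition f_coef (sigma tau : R) (x : R * R) : R :=
  sigma * \1_Q2 x - (tau + sigma) * \1_Q1 x
  + (tau - sigma) * \1_Q3 x + sigma * \1_Q4 x.

End Square.

Section MatrixAlgebra.
Context {R : realType}.

Definition mdot (A B : 'M[R]_2) : R := \tr (A^T *m B).

Definition normsq (A : 'M[R]_2) : R := mdot A A.

(* Rows (d, -c) and (-b, a) when [A] has rows (a, b) and (c, d). *)
Definition cof (A : 'M[R]_2) : 'M[R]_2 :=
  \matrix_(i, j) (if (i == 0) && (j == 0) then A 1 1
                  else if (i == 0) && (j == 1) then - A 1 0
                  else if (i == 1) && (j == 0) then - A 0 1
                  else A 0 0).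

End MatrixAlgebra.

Section Smooth.
Context {R : realType}.

Definition dir (j : 'I_2) : R * R := if j == 0 then (1, 0) else (0, 1).

Definition pd (j : 'I_2) (phi : R * R -> R) (x : R * R) : R :=
  'D_(dir j) phi x.

Fixpoint Ck (n : nat) (phi : R * R -> R) : Prop :=
  match n with
  | 0 => continuous phi
  | m.+1 => continuous phi /\
      forall j : 'I_2, (forall x, derivable phi x (dir j)) /\ Ck m (pd j phi)
  end.

Definition smooth (phi : R * R -> R) : Prop := forall n, Ck n phi.

Definition supp (phi : R * R -> R) : set (R * R) :=
  closure [set x | phi x != 0].

Definition test_fun (phi : R * R -> R) : Prop :=
  [/\ smooth phi, compact (supp phi) & supp phi `<=` interior Q].

End Smooth.

(* Functions on Q are total functions on the plane; only their values on Q
   matter, and elements of L^2(Q) are given by Borel representatives. *)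
Section Sobolev.
Context {R : realType}.

Definition L2 (w : R * R -> R) : Prop :=
  measurable_fun (Q : set (measurableTypeR R * measurableTypeR R)) w /\
  (\int[leb2]_(x in Q) (w x ^+ 2)%:E < +oo)%E.

Definition is_weak_pd (j : 'I_2) (w d : R * R -> R) : Prop :=
  L2 d /\
  forall phi, test_fun phi ->
    \int[leb2]_(x in Q) (w x * pd j phi x)
    = - \int[leb2]_(x in Q) (d x * phi x).

(* The weak partial derivative, unique a.e. in Q; junk if there is none. *)
Definition wpd (j : 'I_2) (w : R * R -> R) : R * R -> R :=
  get [set d | is_weak_pd j w d].

Definition H1 (w : R * R -> R) : Prop :=
  L2 w /\ forall j : 'I_2, exists d, is_weak_pd j w d.

Definition cvg_H1 (wn : nat -> R * R -> R) (w : R * R -> R) : Prop :=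
  (fun n => \int[leb2]_(x in Q) ((wn n x - w x) ^+ 2)%:E)%E @ \oo --> 0%E /\
  forall j : 'I_2,
    (fun n => \int[leb2]_(x in Q) ((pd j (wn n) x - wpd j w x) ^+ 2)%:E)%E
      @ \oo --> 0%E.

Definition side (k : 'I_4) (s : R) : R * R :=
  nth (s, 1) [:: (s, 1); (s, -1); (1, s); (-1, s)] k.

Definition bnd_sqnorm (t : R * R -> R) : \bar R :=
  (\sum_(k < 4) \int[lebesgue_measure]_(s in `[(-1)%R, 1%R])
     (t (side k s) ^+ 2)%:E)%E.

Definition L2_bnd (t : R * R -> R) : Prop :=
  (forall k : 'I_4, measurable_fun `[-1 : R, 1] (t \o side k)) /\
  (bnd_sqnorm t < +oo)%E.

(* The graph of the trace operator H^1(Q) -> L^2(bd Q), the continuous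
   extension of restriction to the boundary on C^oo(Q closed), whose elements
   are the restrictions to Q of smooth functions on the plane. *)
Definition is_trace (w t : R * R -> R) : Prop :=
  L2_bnd t /\
  exists wn : nat -> R * R -> R,
    [/\ forall n, smooth (wn n), cvg_H1 wn w
      & (fun n => bnd_sqnorm (fun x => wn n x - t x)) @ \oo --> 0%E].

End Sobolev.

Section VectorValued.
Context {R : realType}.

Definition cpt (u : R * R -> 'cV[R]_2) (i : 'I_2) : R * R -> R :=
  fun x => u x i 0.

Definition H1v (u : R * R -> 'cV[R]_2) : Prop := forall i, H1 (cpt u i).

Definition grad (u : R * R -> 'cV[R]_2) (x : R * R) : 'M[R]_2 :=
  \matrix_(i, j) wpd j (cpt u i) x.

Definition test_funv (phi : R * R -> 'cV[R]_2) : Prop :=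
  forall i, test_fun (cpt phi i).

Definition cgrad (phi : R * R -> 'cV[R]_2) (x : R * R) : 'M[R]_2 :=
  \matrix_(i, j) pd j (cpt phi i) x.

Definition weak_solution (f : R * R -> R) (u : R * R -> 'cV[R]_2) : Prop :=
  forall phi, test_funv phi ->
    \int[leb2]_(x in Q) (2 * mdot (grad u x) (cgrad phi x)
                         + f x * mdot (cof (grad u x)) (cgrad phi x)) = 0.

(* Equality of traces, by linearity of the trace operator. *)
Definition H1v_bnd (u0 v : R * R -> 'cV[R]_2) : Prop :=
  H1v v /\ forall i, is_trace (cpt (fun x => v x - u0 x) i) (cst 0).

Definition A_set (u0 : R * R -> 'cV[R]_2) (g : R * R -> R) :
    set (R * R -> 'cV[R]_2) :=
  [set v | H1v_bnd u0 v /\ {ae leb2, forall x, Q x -> \det (grad v x) = g x}].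

Definition dirichlet (v : R * R -> 'cV[R]_2) : \bar R :=
  (\int[leb2]_(x in Q) (normsq (grad v x))%:E)%E.

Definition global_minimizer (F : (R * R -> 'cV[R]_2) -> \bar R)
    (A : set (R * R -> 'cV[R]_2)) (u : R * R -> 'cV[R]_2) : Prop :=
  A u /\ forall v, A v -> (F u <= F v)%E.

End VectorValued.

Section Branch.
Context {R : realType}.

Definition h_fun (sigma tau : R) : R :=
  tau ^+ 4 - 8 * tau ^+ 2 * sigma ^+ 2 + 32 * tau * sigma + 16 * sigma ^+ 4.

Definition y_fun (sigma tau : R) : R := `|sigma| / 2 + `|tau| / Num.sqrt 8.

Definition quartic (sigma : R) : R := 1 + 4 * sigma - 2 * sigma ^+ 2 + sigma ^+ 4.

Definition is_sigma0 (s0 : R) : Prop :=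
  quartic s0 = 0 /\ forall r, quartic r = 0 -> r <= s0.

(* [s] is a smooth solution of h(s t, t) = 0 with s 2 = sigma0, hence near 2 the
   implicit function; [eps] is any radius on which y < 1 holds along it. *)
Definition branch_fun (eps : R) (s : R -> R) : Prop :=
  [/\ 0 < eps,
      is_sigma0 (s 2),
      forall (n : nat) (t : R), t \in `]2 - eps, 2 + eps[ ->
        derivable (derive1n n s) t 1,
      forall t : R, t \in `]2 - eps, 2 + eps[ -> h_fun (s t) t = 0
    & forall t : R, t \in `]2 - eps, 2 + eps[ -> y_fun (s t) t < 1].

Definition branch (eps : R) (s : R -> R) : set (R * R) :=
  [set st | exists2 t : R, t \in `]2 - eps, 2 + eps[ & st = (s t, t)].

End Branch.

Section FamilyS.
Context {R : realType}.
Local Open Scope complex_scope.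

(* [R[i]] as the carrier of its numFieldType, on which the library puts the
   topology of the norm. *)
Definition Cplx : numFieldType := R[i].

Definition zof (x : R * R) : R[i] := x.1 +i* x.2.
Definition cplx (u : 'cV[R]_2) : R[i] := u 0 0 +i* u 1 0.

Definition even_psum (a : nat -> R[i]) (z : R[i]) (N : nat) : Cplx :=
  \sum_(0 <= n < N | ~~ odd n) a n * (z ^+ n - z^* ^+ n).

Definition odd_psum (lam : nat -> R[i]) (A B : R) (z : R[i]) (N : nat) : Cplx :=
  \sum_(0 <= n < N | odd n)
    lam n * (A%:C * (z ^+ n + z^* ^+ n) - B%:C * (z ^+ n - z^* ^+ n)).

Definition al (sigma tau : R) : R := 2 * sigma + tau.
Definition be (sigma tau : R) : R := tau - 2 * sigma.
Definition ga (sigma tau : R) : R := - be sigma tau.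
Definition de (sigma tau : R) : R := - al sigma tau.
Definition pp (sigma tau : R) : R :=
  let b := be sigma tau in let c := ga sigma tau in let d := de sigma tau in
  b * c * d + 4 * b - 4 * d.

(* Index j stands for the quadrant Q_(j+1). *)
Definition quad (j : 'I_4) : set (R * R) := nth set0 [:: Q1; Q2; Q3; Q4] j.

Definition fam_re (sigma tau : R) (j : 'I_4) : R :=
  let b := be sigma tau in let c := ga sigma tau in let d := de sigma tau in
  nth 0 [:: 2 * b * c; 2 * c * d; 2 * c * d; 2 * b * c] j.

Definition fam_im (sigma tau : R) (j : 'I_4) : R :=
  let b := be sigma tau in let d := de sigma tau in let p := pp sigma tau in
  nth 0 [:: p; p; 4 * b - 4 * d; 4 * b - 4 * d] j.

Definition u_piece (sigma tau : R) (lam : 'I_4 -> nat -> R[i]) (j : 'I_4)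
    (x : R * R) : nat -> Cplx :=
  odd_psum (lam j) (fam_re sigma tau j) (fam_im sigma tau j) (zof x).

(* Equality is a.e. in Q, as [u] is an element of H^1 (and the closed
   quadrants overlap on the coordinate axes). *)
Definition in_family_S (sigma tau : R) (u : R * R -> 'cV[R]_2) : Prop :=
  exists (a : nat -> R[i]) (lam : 'I_4 -> nat -> R[i]),
    {ae leb2, forall x, Q x ->
      [/\ cvgn (even_psum a (zof x)),
          forall j, quad j x -> cvgn (u_piece sigma tau lam j x)
        & cplx (u x) =
            limn (even_psum a (zof x))
            + \sum_(j < 4) limn (u_piece sigma tau lam j x)
                           * (\1_(quad j) x)%:C]}.

End FamilyS.

(* Main.v *)
Require Import Defs.
From HB Require Import structures.
From mathcomp Require Import all_boot all_order all_algebra.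
From mathcomp Require Import all_classical all_reals all_analysis.
From mathcomp Require Import measurable_realfun.
From mathcomp Require Import ring lra.

(** Let v be a competitor, w = v - u and N = grad w.  Then
      |grad v|^2 - |grad u|^2 = 2 grad u . N + |N|^2,
    and the constraint det (grad v) = det (grad u) says that
    cof (grad u) . N + det N = 0 almost everywhere.  Adding f times this null
    quantity, the energy difference becomes
      int (2 grad u . N + f cof (grad u) . N) + int (|N|^2 + f det N),
    where the sum of the two integrands is called [excess] below.  The first
    integral is the weak equation tested with w, so it vanishes; the second is
    nonnegative by Hadamard's inequality in the mean, which holds because
    y(sigma, tau) < 1.
    The function f plays the part of a Lagrange multiplier (a pressure) for the
    determinant constraint.

    Both facts are available for test maps, while w is only an H^1 map of zero
    trace.  [trace_zero_density] approximates the gradient of w in L^2 by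
    gradients of test maps, and the excess is continuous along such an
    approximation ([excess_perturb], [Rintegral_excess_ge0]).

    Hadamard's inequality in the mean ([hadamard_mean]) comes from
      f = - tau (chi_Q1 - chi_Q3) - sigma (chi_Q1 + chi_Q3 - chi_Q2 - chi_Q4).
    The checkerboard in the second term has modulus at most 1 and
    |det A| <= |A|^2 / 2, which costs |sigma| / 2 of the Dirichlet energy.  The
    first term would cost |tau| / 2 by the same bound; it costs only
    |tau| / sqrt 8, because of
      sqrt 8 (int_Q1 det (grad psi) - int_Q3 det (grad psi))
        <= int_Q |grad psi|^2
    for psi vanishing on the boundary of Q ([quadrant_jac_le]).

    For this last inequality, fold the square onto the triangle
    0 <= y <= x <= 1 by the eight symmetries of the square.  On the triangle,
    split psi into its parts e and o, even and odd under the reflection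
    (x, y) -> (y, x).  The sum of det (grad psi) over a point and its mirror
    image is a Jacobian pairing of e with o.  There e may be replaced by the
    mean of e and of its reflection across y = 0: the two agree on y = 0 and
    vanish on x = 1, while o vanishes on the diagonal, so that the pairing of
    their difference with o is a null Lagrangian without boundary terms
    ([triangle_null_lagrangian]).  The energy of the mean is controlled by the
    energy of psi in four of the eight triangles, and
    sqrt 8 (X0 Y1 - X1 Y0) <= |X|^2 + 2 |Y|^2 concludes.

    The density theorem multiplies a smooth approximation of w by a cutoff.
    The gradient of the cutoff is of size 1/l on strips of width 2 l along the
    boundary; a Poincare inequality in these strips ([strip_poincare]) trades
    the values of the function there for l times its gradient and for its
    boundary values, both of which are small. *)

Set Implicit Arguments.
Unset Strict Implicit.
Unset Printing Implicit Defensive.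
Import Order.TTheory GRing.Theory Num.Theory.
Import numFieldNormedType.Exports.
Local Open Scope classical_set_scope.
Local Open Scope ring_scope.

(** * Smooth functions of one real variable *)
Section SmoothLine.
Context {R : realType}.
Implicit Types (f g : R -> R) (n : nat).

Fixpoint Ck1 n f : Prop :=
  match n with
  | 0 => continuous f
  | m.+1 => exists f', (forall x, is_derive x (1:R) f (f' x)) /\ Ck1 m f'
  end.

Definition smooth1 f := forall n, Ck1 n f.

Lemma is_derive1_continuous f f' :
  (forall x, is_derive x (1:R) f (f' x)) -> continuous f.
Proof.
move=> df x; apply: differentiable_continuous; apply/derivable1_diffP.
by have [] := df x.
Qed.

Lemma Ck1_continuous n f : Ck1 n f -> continuous f.
Proof. by case: n => [//|n] [f' [df _]]; exact: is_derive1_continuous df. Qed.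

Lemma Ck1S n f : Ck1 n.+1 f -> Ck1 n f.
Proof.
elim: n f => [|n IH] f; first by case=> f' [df _]; exact: is_derive1_continuous df.
by case=> f' [df cf']; exists f'; split=> //; exact: IH.
Qed.

Lemma Ck1_cst n c : Ck1 n (fun=> c : R).
Proof.
elim: n c => [|n IH] c /=; first by move=> x; exact: cvg_cst.
by exists (fun=> 0); split=> // x; exact: is_derive_cst.
Qed.

Lemma Ck1D n f g : Ck1 n f -> Ck1 n g -> Ck1 n (fun x => f x + g x).
Proof.
elim: n f g => [|n IH] f g /=.
  by move=> cf cg x; apply: cvgD; [exact: cf|exact: cg].
move=> [f' [df cf]] [g' [dg cg]]; exists (fun x => f' x + g' x).
by split=> [x|]; [exact: is_deriveD|exact: IH].
Qed.

Lemma Ck1M n f g : Ck1 n f -> Ck1 n g -> Ck1 n (fun x => f x * g x).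
Proof.
elim: n f g => [|n IH] f g.
  by move=> cf cg x; apply: cvgM; [exact: cf|exact: cg].
move=> Cf Cg; have [f' [df cf]] := Cf; have [g' [dg cg]] := Cg.
exists (fun x => f x * g' x + g x * f' x).
split=> [x|]; first exact: is_deriveM.
by apply: Ck1D; apply: IH => //; exact: Ck1S.
Qed.

Lemma Ck1_comp n f g : Ck1 n f -> Ck1 n g -> Ck1 n (f \o g).
Proof.
elim: n f g => [|n IH] f g.
  by move=> cf cg x; apply: continuous_comp; [exact: cg|exact: cf].
move=> [f' [df cf]] Cg; have [g' [dg cg]] := Cg.
exists (fun x => (f' \o g) x * g' x); split=> [x|].
  exact: is_derive1_comp.
by apply: Ck1M => //; apply: IH => //; exact: Ck1S.
Qed.

Lemma Ck1_affine n (a b : R) : Ck1 n (fun x => a * x + b).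
Proof.
case: n => [|n] /=.
  move=> x; apply: cvgD; last exact: cvg_cst.
  by apply: cvgM; [exact: cvg_cst|exact: cvg_id].
exists (fun=> a); split; last exact: Ck1_cst.
move=> x; have H := is_deriveD (is_deriveM (is_derive_cst a x 1)
  (is_derive_id x 1)) (is_derive_cst b x 1).
by apply: (is_derive_eq H); rewrite /GRing.scale/= mulr1 mulr0 !addr0.
Qed.

(** The family x^(-n) exp(-1/x), extended by 0 to x <= 0, is closed under
    differentiation up to linear combinations, so that smoothness of all its
    members follows from one derivative formula. *)
Definition flat n (x : R) : R :=
  if 0 < x then x^-1 ^+ n * expR (- x^-1) else 0.

Lemma flat_le0 n x : x <= 0 -> flat n x = 0.
Proof. by rewrite /flat ltNge => ->. Qed.

Lemma flat_ge0 n x : 0 <= flat n x.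
Proof.
rewrite /flat; case: ifP => // x0.
by rewrite mulr_ge0 ?expR_ge0// exprn_ge0// invr_ge0 ltW.
Qed.

(** The exponential series gives exp(1/x) >= (1/x)^(n+2) / (n+2)!.  The quadratic
    decay is what makes [flat n] differentiable at 0. *)
Lemma flat_bound n x : flat n x <= (n.+2)`!%:R * x ^+ 2.
Proof.
have [x0|x0] := leP x 0.
  by rewrite flat_le0// mulr_ge0 ?sqr_ge0 ?ler0n.
rewrite /flat x0 expRN.
have y0 : 0 < x^-1 by rewrite invr_gt0.
rewrite ler_pdivrMr ?expR_gt0//.
have /= := expR_ge1Dxn n.+1 (ltW y0).
have F0 : (0:R) < (n.+2)`!%:R by rewrite ltr0n fact_gt0.
set F := _%:R in F0 *; move: (expR _) => e H.
have {}H : x^-1 ^+ n.+2 / F <= e by apply: le_trans H; rewrite lerDr ler01.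
have -> : x^-1 ^+ n = F * x ^+ 2 * (x^-1 ^+ n.+2 / F).
  have xn0 : x != 0 by rewrite gt_eqF.
  have Fn0 : F != 0 by rewrite gt_eqF.
  have -> : x^-1 ^+ n.+2 = x^-1 ^+ n * (x ^+ 2)^-1 by rewrite -exprVn -exprD addn2.
  move: (x^-1 ^+ n) => p; field; exact/andP.
by apply: ler_wpM2l => //; rewrite mulr_ge0 ?sqr_ge0 ?ltW.
Qed.

Lemma is_derive_flat n (x : R) :
  is_derive x (1:R) (flat n) (flat n.+2 x - n%:R * flat n.+1 x).
Proof.
have [x0|x0|->] := ltgtP x 0.
- rewrite !flat_le0 ?ltW// mulr0 subr0.
  apply: (@near_eq_is_derive _ _ _ (cst 0)).
  near=> y; rewrite flat_le0//; apply: ltW.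
  by near: y; exact: lt_nbhsl.
- apply: (@near_eq_is_derive _ _ _
    ((fun y : R => y^-1) ^+ n * (fun y : R => expR (- y^-1)))).
    near=> y; rewrite mulrfctE exprfctE /flat ifT//; near: y; exact: lt_nbhsr.
  have xn0 : x != 0 by rewrite gt_eqF.
  have dV : is_derive x (1:R) (fun y : R => y^-1) (- x^-1 ^+ 2).
    have H := @is_deriveV R id x 1 1 xn0 (is_derive_id x 1).
    by apply: (is_derive_eq H); rewrite /GRing.scale/= mulr1 exprVn.
  have dE : is_derive x (1:R) (fun y : R => expR (- y^-1))
      (expR (- x^-1) * x^-1 ^+ 2).
    have H := @is_derive1_comp R expR (fun y : R => - y^-1) x _ _
      (is_derive_expR _) (is_deriveN dV).
    by apply: (is_derive_eq H); rewrite opprK.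
  apply: (is_derive_eq (is_deriveM (is_deriveX n dV) dE)).
  rewrite exprfctE /flat x0 /GRing.scale /=.
  case: n => [|n] /=.
    by rewrite !mul0r mulr0 addr0 subr0 expr0 mul1r mulrC.
  move: (x^-1) (expR _) => t e; rewrite !exprS; ring.
- rewrite !flat_le0// mulr0 subr0.
  suff H : (fun h => h^-1 *: (flat n (h *: (1:R) + 0) - flat n 0)) @ 0^' --> (0:R).
    apply: DeriveDef; first by apply/cvg_ex; exists 0.
    exact: cvg_lim.
  rewrite flat_le0//; apply/cvgr0Pnorm_lt => e e0.
  have F0 : (0:R) < (n.+2)`!%:R by rewrite ltr0n fact_gt0.
  near=> h.
  have hn0 : h != 0 by near: h; exact: nbhs_dnbhs_neq.
  rewrite subr0 addr0 [h *: 1]mulr1 normrM normfV (ger0_norm (flat_ge0 _ _)).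
  have nh0 : 0 < `|h| by rewrite normr_gt0.
  rewrite ltr_pdivrMl//.
  apply: le_lt_trans (flat_bound _ _) _.
  rewrite -real_normK ?num_real// expr2 mulrA [ltRHS]mulrC ltr_pM2r//.
  rewrite mulrC -ltr_pdivlMr//.
  near: h; apply: dnbhs0_lt; exact: divr_gt0.
Unshelve. all: by end_near. Qed.

End SmoothLine.

(** * Cutoff functions of one real variable *)
Section Plateau.
Context {R : realType}.
Implicit Types (f g : R -> R) (n : nat).

Lemma smooth1_flat n : smooth1 (@flat R n).
Proof.
move=> m; elim: m n => [|m IH] n.
  exact: is_derive1_continuous (is_derive_flat n).
exists (fun x => flat n.+2 x - n%:R * flat n.+1 x).
split; first exact: is_derive_flat.
have -> : (fun x : R => flat n.+2 x - n%:R * flat n.+1 x) =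
          (fun x => flat n.+2 x + (- n%:R) * flat n.+1 x).
  by apply/funext => x; rewrite mulNr.
by apply: Ck1D => //; apply: Ck1M => //; exact: Ck1_cst.
Qed.

Lemma flat0_homo (x y : R) : x <= y -> flat 0 x <= flat 0 y.
Proof.
move=> xy; have [x0|x0] := leP x 0; first by rewrite flat_le0// flat_ge0.
have y0 : 0 < y by exact: lt_le_trans xy.
rewrite /flat x0 y0 !expr0 !mul1r ler_expR lerN2 lef_pV2// posrE//.
Qed.

Lemma flat_gt0 n (x : R) : 0 < x -> 0 < flat n x.
Proof. by move=> x0; rewrite /flat x0 mulr_gt0 ?expR_gt0// exprn_gt0// invr_gt0. Qed.

(** The argument flat 0 1 - flat 0 x of the outer [flat 0] is constant for x <= 0
    and nonpositive for x >= 1, so that the composite is frozen on both sides;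
    neither an integral nor a quotient of two functions of x is needed. *)
Definition step (x : R) : R :=
  1 - flat 0 (flat 0 1 - flat 0 x) / flat 0 (flat 0 1).

Let c_gt0 : 0 < flat 0 (flat 0 1) :> R.
Proof. by do 2 apply: flat_gt0. Qed.

Lemma step_le0 x : x <= 0 -> step x = 0.
Proof.
by move=> x0; rewrite /step (@flat_le0 _ _ x)// subr0 divff ?subrr// gt_eqF.
Qed.

Lemma step_ge1 x : 1 <= x -> step x = 1.
Proof.
move=> x1; rewrite /step (@flat_le0 _ _ (_ - _)) ?mul0r ?subr0//.
by rewrite subr_le0; exact: flat0_homo.
Qed.

Lemma step_ge0 x : 0 <= step x.
Proof.
rewrite /step subr_ge0 ler_pdivrMr// mul1r; apply: flat0_homo.
by rewrite gerBl flat_ge0.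
Qed.

Lemma step_le1 x : step x <= 1.
Proof.
by rewrite /step gerBl divr_ge0 ?flat_ge0// ltW.
Qed.

Lemma smooth1_step : smooth1 step.
Proof.
move=> n.
have -> : step = (fun t => - (flat 0 (flat 0 1))^-1 * t + 1) \o
  (flat 0 \o ((fun t => -1 * t + flat 0 1) \o flat 0)).
  by apply/funext => x; rewrite /step /= mulN1r [- flat 0 x + _]addrC; ring.
apply: Ck1_comp; first exact: Ck1_affine.
apply: Ck1_comp; first exact: smooth1_flat.
by apply: Ck1_comp; [exact: Ck1_affine|exact: smooth1_flat].
Qed.

Lemma Ck1_is_derive n f : Ck1 n.+1 f -> forall x : R, is_derive x (1:R) f (derive1 f x).
Proof.
by case=> f' [df _] x; have [d _] := df x; rewrite derive1E; exact: derivableP.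
Qed.

Lemma Ck1_derive1 n f : Ck1 n.+1 f -> Ck1 n (derive1 f).
Proof.
case=> f' [df cf]; suff -> : (derive1 f) = f' by [].
by apply/funext => x; rewrite derive1E; have [_ <-] := df x.
Qed.

Lemma derive1_locally_cst f (c x : R) :
  (\forall y \near x, f y = c) -> derive1 f x = 0.
Proof.
move=> H.
have E : \forall y \near x, cst c y = f y by near do apply/esym.
by rewrite derive1E; have [_ ->] := near_eq_is_derive E (is_derive_cst c x (1:R)).
Unshelve. all: by end_near. Qed.

(** Outside [0, 1] the step is locally constant; on [0, 1] its derivative is
    continuous. *)
Lemma step_derive_bounded : exists2 C : R, 0 <= C & forall x, `|(derive1 step) x| <= C.
Proof.
have cs : continuous (derive1 step) by apply: (@Ck1_continuous _ 0);
  apply: Ck1_derive1; exact: smooth1_step.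
have [c _ Hc] := @EVT_max R (fun x => `|(derive1 step) x|) 0 1 ler01
  (continuous_subspaceT (fun x => cvg_norm (cs x))).
exists (`|derive1 step c|); first exact: normr_ge0.
move=> x.
have [x0|x0] := ltP x 0.
  rewrite (@derive1_locally_cst step 0) ?normr0//.
  by near=> y; rewrite step_le0// ltW//; near: y; exact: lt_nbhsl.
have [x1|x1] := ltP 1 x; last by apply: Hc; rewrite in_itv/= x0.
rewrite (@derive1_locally_cst step 1) ?normr0//.
by near=> y; rewrite step_ge1// ltW//; near: y; exact: lt_nbhsr.
Unshelve. all: by end_near. Qed.

(** A bump in [a, b] that vanishes within distance l of the endpoints, so that its
    support is compact in the open interval, and equals 1 beyond distance 2 l. *)
Definition plateau (a b l x : R) : R :=
  step (l^-1 * x + (- a / l - 1)) * step (- l^-1 * x + (b / l - 1)).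

Lemma smooth1_plateau a b l : smooth1 (plateau a b l).
Proof.
move=> n; apply: Ck1M.
  exact: (Ck1_comp (smooth1_step n) (Ck1_affine n _ _)).
exact: (Ck1_comp (smooth1_step n) (Ck1_affine n _ _)).
Qed.

Lemma plateau_ge0 a b l x : 0 <= plateau a b l x.
Proof. by rewrite mulr_ge0 ?step_ge0. Qed.

Lemma plateau_le1 a b l x : plateau a b l x <= 1.
Proof. by rewrite mulr_ile1 ?step_ge0 ?step_le1. Qed.

Lemma plateau_eq0 a b l x : 0 < l -> x <= a + l \/ b - l <= x -> plateau a b l x = 0.
Proof.
move=> l0 [xa|xb]; rewrite /plateau.
  rewrite step_le0 ?mul0r//.
  have -> : l^-1 * x + (- a / l - 1) = (x - (a + l)) / l.
    by field; rewrite gt_eqF.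
  by rewrite pmulr_lle0 ?invr_gt0// subr_le0.
rewrite [X in _ * X]step_le0 ?mulr0//.
have -> : - l^-1 * x + (b / l - 1) = (b - l - x) / l.
  by field; rewrite gt_eqF.
by rewrite pmulr_lle0 ?invr_gt0// subr_le0.
Qed.

Lemma plateau_eq1 a b l x : 0 < l -> a + 2 * l <= x <= b - 2 * l -> plateau a b l x = 1.
Proof.
move=> l0 /andP[ax xb]; rewrite /plateau !step_ge1 ?mul1r//.
  have -> : - l^-1 * x + (b / l - 1) = (b - l - x) / l.
    by field; rewrite gt_eqF.
  by rewrite ler_pdivlMr// mul1r; lra.
have -> : l^-1 * x + (- a / l - 1) = (x - (a + l)) / l.
  by field; rewrite gt_eqF.
by rewrite ler_pdivlMr// mul1r; lra.
Qed.

Lemma plateau_derive_eq0 a b l x : 0 < l -> a + 2 * l < x < b - 2 * l ->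
  derive1 (plateau a b l) x = 0.
Proof.
move=> l0 /andP[ax xb].
apply: (@derive1_locally_cst _ 1).
near=> y; rewrite plateau_eq1//; apply/andP; split; apply: ltW; near: y;
  [exact: lt_nbhsr|exact: lt_nbhsl].
Unshelve. all: by end_near. Qed.

(** By scaling, one constant serves every interval and every width. *)
Lemma plateau_derive_bounded : exists2 C : R, 0 <= C &
  forall a b l x, 0 < l -> `|derive1 (plateau a b l) x| <= C / l.
Proof.
have [C C0 HC] := step_derive_bounded.
exists (2 * C) => [|a b l x l0]; first by rewrite mulr_ge0.
have ds := Ck1_is_derive (smooth1_step 1).
have d1 := @is_derive1_comp _ step (fun x =>
  l^-1 * x + (- a / l - 1)) _ _ _ (ds (l^-1 * x + (- a / l - 1)))
  (Ck1_is_derive (Ck1_affine 1 l^-1 (- a / l - 1)) x).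
have d2 := @is_derive1_comp _ step (fun x =>
  - l^-1 * x + (b / l - 1)) _ _ _ (ds (- l^-1 * x + (b / l - 1)))
  (Ck1_is_derive (Ck1_affine 1 (- l^-1) (b / l - 1)) x).
have aff (p q : R) : derive1 (fun x => p * x + q) x = p.
  rewrite derive1E; have H := is_deriveD (is_deriveM (is_derive_cst p x 1)
    (is_derive_id x 1)) (is_derive_cst q x 1).
  by have [_ ->] := H; rewrite /GRing.scale/= mulr1 mulr0 !addr0.
have [_ H] := is_deriveM d1 d2.
rewrite derive1E [X in `|X|](_ : _ = 'D_1 ((step \o (fun x => l^-1 * x + (- a / l - 1)))
  * (step \o (fun x => - l^-1 * x + (b / l - 1)))) x)// H !aff.
rewrite /GRing.scale/=; set s1 := step _; set s2 := step _.
set t1 := (derive1 step) _; set t2 := (derive1 step) _.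
have s10 : 0 <= s1 by exact: step_ge0.
have s20 : 0 <= s2 by exact: step_ge0.
have s11 : s1 <= 1 by exact: step_le1.
have s21 : s2 <= 1 by exact: step_le1.
have t1C : `|t1| <= C by exact: HC.
have t2C : `|t2| <= C by exact: HC.
have li0 : 0 <= l^-1 by rewrite invr_ge0 ltW.
clear -s10 s20 s11 s21 t1C t2C li0; clearbody s1 s2 t1 t2.
have aux (p t : R) : 0 <= p -> p <= 1 -> `|t| <= C -> `|p * (t * l^-1)| <= C * l^-1.
  move=> p0 p1 tC; rewrite !normrM (ger0_norm p0) (ger0_norm li0) -[leRHS]mul1r.
  by apply: ler_pM => //; [rewrite mulr_ge0|rewrite ler_wpM2r].
have h1 := aux s1 t1 s10 s11 t1C; have h2 := aux s2 t2 s20 s21 t2C.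
rewrite !mulrN (le_trans (ler_normD _ _))// normrN -mulrA.
by move: h1 h2; set p := `|_|; set q := `|_|; lra.
Qed.

End Plateau.

(** * Smooth functions and cutoff functions on the plane *)
Section SmoothPlane.
Context {R : realType}.
Implicit Types (phi psi : R * R -> R) (n : nat) (j : 'I_2).

Lemma dirP (P : 'I_2 -> Prop) : P 0 -> P 1 -> forall j, P j.
Proof.
move=> P0 P1 [[|[|//]] i].
- by rewrite (_ : Ordinal i = 0)//; exact: val_inj.
- by rewrite (_ : Ordinal i = 1)//; exact: val_inj.
Qed.

Lemma Ck_continuous n phi : Ck n phi -> continuous phi.
Proof. by case: n => [|n] //= []. Qed.

Lemma CkS n phi : Ck n.+1 phi -> Ck n phi.
Proof.
elim: n phi => [|n IH] phi; first by case.
by case=> cp H; split=> // j; have [d c] := H j; split=> //; exact: IH.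
Qed.

Lemma Ck_pd n phi j : Ck n.+1 phi -> Ck n (pd j phi).
Proof. by case=> _ /(_ j)[]. Qed.

Lemma Ck_derivable n phi j x : Ck n.+1 phi -> derivable phi x (dir j).
Proof. by case=> _ /(_ j)[]. Qed.

Lemma pdD phi psi j : (forall x, derivable phi x (dir j)) ->
  (forall x, derivable psi x (dir j)) ->
  pd j (fun x => phi x + psi x) = (fun x => pd j phi x + pd j psi x).
Proof. by move=> d1 d2; apply/funext => x; rewrite /pd -deriveD. Qed.

Lemma CkD n phi psi : Ck n phi -> Ck n psi -> Ck n (fun x => phi x + psi x).
Proof.
elim: n phi psi => [|n IH] phi psi.
  by move=> cf cg x; apply: cvgD; [exact: cf|exact: cg].
move=> Cf Cg; split.
  by move=> x; apply: cvgD; apply: Ck_continuous; eassumption.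
move=> j; split; first by move=> x; apply: derivableD; apply: Ck_derivable; eassumption.
by rewrite pdD; [apply: IH; exact: Ck_pd|..] => x; apply: Ck_derivable; eassumption.
Qed.

Lemma pdM phi psi j : (forall x, derivable phi x (dir j)) ->
  (forall x, derivable psi x (dir j)) ->
  pd j (fun x => phi x * psi x) = (fun x => phi x * pd j psi x + psi x * pd j phi x).
Proof.
move=> d1 d2; apply/funext => x; rewrite /pd.
by have := @deriveM _ _ phi psi x (dir j) (d1 x) (d2 x).
Qed.

Lemma CkM n phi psi : Ck n phi -> Ck n psi -> Ck n (fun x => phi x * psi x).
Proof.
elim: n phi psi => [|n IH] phi psi.
  by move=> cf cg x; apply: cvgM; [exact: cf|exact: cg].
move=> Cf Cg; split.
  by move=> x; apply: cvgM; apply: Ck_continuous; eassumption.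
move=> j; split; first by move=> x; apply: derivableM; apply: Ck_derivable; eassumption.
rewrite pdM; [|by move=> x; apply: Ck_derivable; eassumption..].
by apply: CkD; apply: IH; by [exact: CkS|exact: Ck_pd].
Qed.

Lemma pd_cst (c : R) j : pd j (fun=> c) = (fun=> 0).
Proof. by apply/funext => x; rewrite /pd derive_cst. Qed.

Lemma Ck_cst n (c : R) : Ck n (fun=> c : R).
Proof.
elim: n c => [|n IH] c; first by move=> x; exact: cvg_cst.
split; first by move=> x; exact: cvg_cst.
by move=> j; split; [move=> x; exact: derivable_cst|rewrite pd_cst].
Qed.

Lemma pd0_fst (f : R -> R) : pd 0 (f \o fst) = (derive1 f) \o fst.
Proof. by apply/funext => x; rewrite /= derive1E. Qed.

Lemma pd1_snd (f : R -> R) : pd 1 (f \o snd) = (derive1 f) \o snd.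
Proof. by apply/funext => x; rewrite /= derive1E. Qed.

Lemma is_derive_fst1 (f : R -> R) x : is_derive x (dir 1) (f \o fst) 0.
Proof.
have H : (fun h => h^-1 *: (((f \o fst) \o shift x) (h *: dir 1) - (f \o fst) x)) =
         (fun=> 0) :> (R -> R).
  apply/funext => h /=; rewrite [h *: 0]mulr0 add0r subrr [_ *: _]mulr0//.
by split; rewrite /derivable /derive H; [exact: is_cvg_cst|exact: lim_cst].
Qed.

Lemma is_derive_snd0 (f : R -> R) x : is_derive x (dir 0) (f \o snd) 0.
Proof.
have H : (fun h => h^-1 *: (((f \o snd) \o shift x) (h *: dir 0) - (f \o snd) x)) =
         (fun=> 0) :> (R -> R).
  apply/funext => h /=; rewrite [h *: 0]mulr0 add0r subrr [_ *: _]mulr0//.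
by split; rewrite /derivable /derive H; [exact: is_cvg_cst|exact: lim_cst].
Qed.

Lemma Ck_fst n (f : R -> R) : Ck1 n f -> Ck n (f \o fst).
Proof.
elim: n f => [|n IH] f Cf.
  by move=> x; apply: continuous_comp; [exact: cvg_fst|exact: Cf].
split; first by move=> x; apply: continuous_comp;
  [exact: cvg_fst|exact: Ck1_continuous Cf _].
apply: dirP; split.
- by move=> x; have [] := Ck1_is_derive Cf x.1.
- by rewrite pd0_fst; apply: IH; exact: Ck1_derive1.
- by move=> x; have [] := is_derive_fst1 f x.
- have -> : pd 1 (f \o fst) = (fun=> 0).
    by apply/funext => x; have [_] := is_derive_fst1 f x.
  exact: Ck_cst.
Qed.

Lemma Ck_snd n (f : R -> R) : Ck1 n f -> Ck n (f \o snd).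
Proof.
elim: n f => [|n IH] f Cf.
  by move=> x; apply: continuous_comp; [exact: cvg_snd|exact: Cf].
split; first by move=> x; apply: continuous_comp;
  [exact: cvg_snd|exact: Ck1_continuous Cf _].
apply: dirP; split.
- by move=> x; have [] := is_derive_snd0 f x.
- have -> : pd 0 (f \o snd) = (fun=> 0).
    by apply/funext => x; have [_] := is_derive_snd0 f x.
  exact: Ck_cst.
- by move=> x; have [] := Ck1_is_derive Cf x.2.
- by rewrite pd1_snd; apply: IH; exact: Ck1_derive1.
Qed.

Definition plateau2 (a b c d l : R)
  (x : R * R) : R := plateau a b l x.1 * plateau c d l x.2.

Lemma smooth_plateau2 a b c d l : smooth (plateau2 a b c d l).
Proof.
move=> n; apply: CkM; [apply: (@Ck_fst n (plateau a b l))|apply: (@Ck_snd n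
  (plateau c d l))];
  exact: smooth1_plateau.
Qed.

Lemma pd1_fst (f : R -> R) x : pd 1 (f \o fst) x = 0.
Proof. by have [_] := is_derive_fst1 f x. Qed.

Lemma pd0_snd (f : R -> R) x : pd 0 (f \o snd) x = 0.
Proof. by have [_] := is_derive_snd0 f x. Qed.

Lemma pd_prod (f g : R -> R) j : smooth1 f -> smooth1 g ->
  pd j (fun x => f x.1 * g x.2) =
  (fun x => f x.1 * pd j (g \o snd) x + g x.2 * pd j (f \o fst) x).
Proof.
move=> sf sg; apply: (@pdM (f \o fst) (g \o snd)) => x; apply: (@Ck_derivable 0).
  exact: (Ck_fst (sf _)).
exact: (Ck_snd (sg _)).
Qed.

Lemma pd0_prod (f g : R -> R) x : smooth1 f -> smooth1 g ->
  pd 0 (fun x => f x.1 * g x.2) x = derive1 f x.1 * g x.2.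
Proof.
by move=> sf sg; rewrite pd_prod// pd0_snd pd0_fst mulr0 add0r mulrC.
Qed.

Lemma pd1_prod (f g : R -> R) x : smooth1 f -> smooth1 g ->
  pd 1 (fun x => f x.1 * g x.2) x = f x.1 * derive1 g x.2.
Proof.
by move=> sf sg; rewrite pd_prod// pd1_fst pd1_snd mulr0 addr0.
Qed.

Lemma open_rect (A B : set R) : open A -> open B -> open (A `*` B : set (R * R)).
Proof.
move=> oA oB; rewrite (_ : A `*` B = fst @^-1` A `&` snd @^-1` B)//.
by apply: openI; apply: open_comp => // x _; [exact: cvg_fst|exact: cvg_snd].
Qed.

Lemma closed_rect (A B : set R) :
  closed A -> closed B -> closed (A `*` B : set (R * R)).
Proof.
move=> oA oB; rewrite (_ : A `*` B = fst @^-1` A `&` snd @^-1` B)//.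
by apply: closedI; apply: preimage_closed => // x _; [exact: cvg_fst|exact: cvg_snd].
Qed.

Lemma interior_Q : interior (@Q R) = `]-1, 1[ `*` `]-1, 1[.
Proof.
apply/seteqP; split=> [[x y]|].
  rewrite /interior /= => -[[A B] /= [[e e0 /= HA] [d d0 HB]] H].
  have Bx : A x by apply: HA; exact: ballxx.
  have By : B y by apply: HB; exact: ballxx.
  have cov (s : R) (S : set R) k : 0 < k -> ball s k `<=` S ->
     S `<=` `[-1, 1] -> -1 < s < 1.
    move=> k0 Hk SI.
    have h1 : `[-1, 1]%classic (s + k / 2).
      apply: SI; apply: Hk; rewrite /ball /= opprD addNKr normrN gtr0_norm; lra.
    have h2 : `[-1, 1]%classic (s - k / 2).
      apply: SI; apply: Hk; rewrite /ball /= opprD opprK addNKr gtr0_norm; lra.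
    by move: h1 h2; rewrite /= !in_itv/= => /andP[? ?] /andP[? ?]; lra.
  split; rewrite /= in_itv/=.
    by apply: (cov x A e) => // z Az; have := H (z, y) (conj Az By); case.
  by apply: (cov y B d) => // z Bz; have := H (x, z) (conj Bx Bz); case.
rewrite -open_subsetE; last first.
  by apply: open_rect; exact: interval_open.
by apply: setSX => x; rewrite /= !in_itv/= => /andP[/ltW -> /ltW ->].
Qed.

Lemma test_fun_plateau2 a b c d l w : -1 <= a -> b <= 1 -> -1 <= c -> d <= 1 ->
  0 < l -> smooth w -> test_fun (fun x => plateau2 a b c d l x * w x).
Proof.
move=> a1 b1 c1 d1 l0 sw.
set phi := fun x => _.
have sK : supp phi `<=` `[a + l, b - l] `*` `[c + l, d - l].
  rewrite /supp; have /closure_id -> : closed (`[a + l, b - l] `*` `[c + l,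
    d - l] : set (R * R)).
    by apply: closed_rect; exact: interval_closed.
  apply: closureS => -[x y] /=; rewrite /phi /plateau2 /= !in_itv/=.
  apply: contra_neqP => /not_andP H.
  suff [->|->] : plateau a b l x = 0 \/ plateau c d l y = 0 by rewrite ?mul0r ?mulr0
    ?mul0r.
  have sep (p q z : R) : ~ (p + l <= z <= q - l) -> plateau p q l z = 0.
    move=> /negP; rewrite negb_and -!ltNge => /orP[?|?]; apply: plateau_eq0 => //;
      [left|right]; exact: ltW.
  by case: H => [/sep|/sep]; [left|right].
split.
- by move=> n; apply: CkM => //; exact: smooth_plateau2.
- apply: (@subclosed_compact _ _ (`[a + l, b - l] `*` `[c + l, d - l])) => //.
    exact: closed_closure.
  by apply: compact_setX; exact: segment_compact.
- apply: (subset_trans sK); rewrite interior_Q => -[x y] /=.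
  rewrite !in_itv/= => -[/andP[? ?] /andP[? ?]]; split; apply/andP; split; lra.
Qed.

End SmoothPlane.

Local Notation leb := lebesgue_measure.

(** * Measurability and integrability on the square *)
Section PlaneMeasure.
Context {R : realType}.
Local Notation P := (measurableTypeR R * measurableTypeR R)%type.
Local Notation mu := (leb2 : {measure set P -> \bar R}).
Implicit Types (D : set P) (f g : R * R -> R).

(** The sigma-algebra of the plane is the product one; an open set is a countable
    union of boxes with rational centres. *)
Lemma measurable_open_plane (O : set (R * R)) : open O -> measurable (O : set P).
Proof.
move=> oO.
pose box (q r : rat) (n : nat) : set P :=
  ball (ratr q : R) (n.+1%:R^-1 : R) `*` ball (ratr r : R) (n.+1%:R^-1 : R).
pose F (q r : rat) (n : nat) : set P :=
  if `[< box q r n `<=` O >] then box q r n else set0.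
have -> : O = \bigcup_q \bigcup_r \bigcup_n F q r n.
  apply/seteqP; split => [[x y] Oxy|[x y] [q _ [r _ [n _]]]]; last first.
    by rewrite /F; case: asboolP => // H Hb; exact: H.
  have /nbhs_ballP [e /= e0 He] : nbhs (x, y) O by apply: open_nbhs_nbhs.
  have [n Hn] : exists n : nat, n.+1%:R^-1 < e / 2.
    exists (Num.truncn ((e / 2)^-1)).
    rewrite invf_plt ?posrE ?divr_gt0//; exact: truncnS_gt.
  have n0 : 0 < n.+1%:R^-1 :> R by rewrite invr_gt0.
  have dense (z : R) : exists q : rat, ball (ratr q : R) (n.+1%:R^-1 : R) z.
    have [q] := @rat_in_itvoo R (z - n.+1%:R^-1) z ltac:(by rewrite gtrBl).
    rewrite in_itv/= => /andP[h1 h2]; exists q; rewrite /ball /= ltr_norml.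
    move: n0 h1 h2; set w := _^-1; move: (ratr q : R) w => t w n0 h1 h2.
    by apply/andP; split; lra.
  have [q Hq] := dense x; have [r Hr] := dense y.
  exists q => //; exists r => //; exists n => //.
  rewrite /F; case: asboolP => // -[] [x' y'] [/= Hx Hy]; apply: He; split => /=.
    have B := ball_triangle (ball_sym Hq) Hx.
    by apply: le_ball B; rewrite [leRHS]splitr lerD // ltW.
  have B := ball_triangle (ball_sym Hr) Hy.
  by apply: le_ball B; rewrite [leRHS]splitr lerD // ltW.
apply: bigcupT_measurable_rat => q; apply: bigcupT_measurable_rat => r.
apply: bigcupT_measurable => n; rewrite /F; case: ifP => // _.
by apply: measurableX; rewrite ball_itv; exact: measurable_itv.
Qed.

Lemma continuous_measurable_plane f : continuous f -> measurable_fun (setT : set P) f.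
Proof.
move=> /continuousP cf; apply: (measurability _ (RGenOpens.measurableE R)).
move=> _ [_ [a [b ->] <-]]; rewrite setTI; apply: measurable_open_plane.
by apply: cf; exact: interval_open.
Qed.

Lemma measurable_closed_plane (C : set (R * R)) : closed C -> measurable (C : set P).
Proof.
move=> cC; rewrite -(setCK C); apply: measurableC; apply: measurable_open_plane.
exact: closed_openC.
Qed.

Lemma measurable_Q : measurable (@Q R : set P).
Proof. by apply: measurableX. Qed.

Lemma mu_Q_fin : (mu (@Q R) < +oo)%E.
Proof.
rewrite /= product_measure1E//= lebesgue_measure_itv/= lte_fin.
by case: ifP => _; rewrite -?EFinB -?EFinM ?ltry// mul0e ltry.
Qed.

Lemma compact_Q : compact (@Q R).
Proof. by apply: compact_setX; exact: segment_compact. Qed.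

Lemma bounded_measurable_integrable D f : measurable D -> D `<=` Q ->
  measurable_fun D f -> (exists M, forall x, D x -> `|f x| <= M) ->
  mu.-integrable D (EFin \o f).
Proof.
move=> mD DQ mf [M HM]; apply: measurable_bounded_integrable => //.
  apply: le_lt_trans mu_Q_fin; apply: le_measure; rewrite ?inE//; exact: measurable_Q.
by exists M; split; rewrite ?num_real// => M' MM' x Dx; apply: le_trans (HM _ Dx) _;
  exact: ltW.
Qed.

Lemma continuous_bounded_Q f : continuous f ->
  exists M, forall x, Q x -> `|f x| <= M.
Proof.
move=> cf; have := @continuous_compact _ _ f Q (continuous_subspaceT cf) compact_Q.
move=> /compact_bounded[M [_ HM]]; exists (M + 1) => x Qx.
by apply: HM; [rewrite ltrDl|exists x].
Qed.

Lemma continuous_integrable D f : measurable D -> D `<=` Q -> continuous f ->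
  mu.-integrable D (EFin \o f).
Proof.
move=> mD DQ cf; apply: bounded_measurable_integrable => //.
  by apply: measurable_funTS; exact: continuous_measurable_plane.
by have [M HM] := continuous_bounded_Q cf; exists M => x /DQ; exact: HM.
Qed.

End PlaneMeasure.

(** * Square-integrable functions on the square *)
Section L2.
Context {R : realType}.
Local Notation P := (measurableTypeR R * measurableTypeR R)%type.
Local Notation mu := (leb2 : {measure set P -> \bar R}).
Implicit Types (D : set P) (a b w : R * R -> R).
Local Notation itg f := (mu.-integrable Q (EFin \o (f : R * R -> R))).

Let mQ : measurable (Q : set P) := measurable_Q.

Lemma itgD a b : itg a -> itg b -> itg (fun x => a x + b x).
Proof. by move=> ia ib; apply: eq_integrable (integrableD mQ ia ib). Qed.

Lemma itgZ (k : R) a : itg a -> itg (fun x => k * a x).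
Proof. by move=> ia; apply: eq_integrable (integrableZl mQ k ia). Qed.

Lemma itgN a : itg a -> itg (fun x => - a x).
Proof.
move=> ia; have -> : (fun x => - a x) = (fun x => -1 * a x).
  by apply/funext => x; rewrite mulN1r.
exact: itgZ.
Qed.

Lemma itgB a b : itg a -> itg b -> itg (fun x => a x - b x).
Proof. by move=> ia ib; apply: itgD => //; exact: itgN. Qed.

Lemma L2_itg_sqr w : L2 w -> itg (fun x => w x ^+ 2).
Proof.
move=> [mw fw]; apply/integrableP; split.
  by apply/measurable_EFinP; exact: measurable_funX.
apply: le_lt_trans fw; rewrite le_eqVlt; apply/orP; left; apply/eqP.
by apply: eq_integral => x _ /=; rewrite ger0_norm ?sqr_ge0.
Qed.

Lemma itg_sqr_L2 w : measurable_fun (Q : set P) w -> itg (fun x => w x ^+ 2) -> L2 w.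
Proof.
move=> mw /integrableP[_ fw]; split=> //; apply: le_lt_trans fw.
rewrite le_eqVlt; apply/orP; left; apply/eqP.
by apply: eq_integral => x _ /=; rewrite ger0_norm ?sqr_ge0.
Qed.

Lemma L2_itgM a b : L2 a -> L2 b -> itg (fun x => a x * b x).
Proof.
move=> La Lb; have [ma _] := La; have [mb _] := Lb.
apply: (@le_integrable _ _ _ mu Q mQ _ (EFin \o (fun x => a x ^+ 2 + b x ^+ 2))).
- by apply/measurable_EFinP; exact: measurable_funM.
- move=> x _; rewrite /= lee_fin [leRHS]ger0_norm ?addr_ge0 ?sqr_ge0//.
  rewrite ler_norml; apply/andP; split.
    by have := sqr_ge0 (a x + b x); have := sqr_ge0 (a x); have := sqr_ge0 (b x); nra.
  by have := sqr_ge0 (a x - b x); have := sqr_ge0 (a x); have := sqr_ge0 (b x); nra.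
- by apply: itgD; exact: L2_itg_sqr.
Qed.

Lemma L2D a b : L2 a -> L2 b -> L2 (fun x => a x + b x).
Proof.
move=> La Lb; have [ma _] := La; have [mb _] := Lb.
apply: itg_sqr_L2; first exact: measurable_funD.
have -> : (fun x => (a x + b x) ^+ 2) =
  (fun x => a x * a x + (a x * b x + a x * b x) + b x * b x).
  by apply/funext => x; ring.
by apply: itgD; [apply: itgD; [|apply: itgD]|]; exact: L2_itgM.
Qed.

Lemma L2_bounded_mul (h w : R * R -> R) (M : R) : measurable_fun (Q : set P) h ->
  (forall x, Q x -> `|h x| <= M) -> L2 w -> L2 (fun x => h x * w x).
Proof.
move=> mh hM Lw; have [mw _] := Lw.
apply: itg_sqr_L2; first exact: measurable_funM.
apply: (@le_integrable _ _ _ mu Q mQ _ (EFin \o (fun x => M ^+ 2 * w x ^+ 2))).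
- by apply/measurable_EFinP; apply: measurable_funX; exact: measurable_funM.
- move=> x Qx; rewrite /= lee_fin ger0_norm ?sqr_ge0//.
  rewrite [leRHS]ger0_norm; last by rewrite mulr_ge0 ?sqr_ge0.
  rewrite exprMn ler_wpM2r ?sqr_ge0// -(real_normK (num_real (h x))).
  have M0 : 0 <= M by apply: le_trans (hM _ Qx).
  by rewrite lerXn2r ?nnegrE// hM.
- exact: (@itgZ (M ^+ 2) (fun x => w x ^+ 2) (L2_itg_sqr Lw)).
Qed.

Lemma L2_continuous w : continuous w -> L2 w.
Proof.
move=> cw; apply: itg_sqr_L2.
  by apply: measurable_funTS; exact: continuous_measurable_plane.
apply: continuous_integrable => //.
by move=> x; apply: cvgM; exact: cw.
Qed.

Lemma L2Z k w : L2 w -> L2 (fun x => k * w x).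
Proof.
by move=> Lw; apply: (@L2_bounded_mul (fun=> k) w `|k|) => //.
Qed.

Lemma L2B a b : L2 a -> L2 b -> L2 (fun x => a x - b x).
Proof.
move=> La Lb; have -> : (fun x => a x - b x) = (fun x => a x + (-1) * b x).
  by apply/funext => x; rewrite mulN1r.
by apply: L2D => //; exact: L2Z.
Qed.

Lemma L2_itg w : L2 w -> itg w.
Proof.
move=> Lw; have -> : w = (fun x => 1 * w x) by apply/funext => x; rewrite mul1r.
by apply: L2_itgM => //; apply: L2_continuous => x; exact: cvg_cst.
Qed.

Lemma itg_EFin_integral f : itg f ->
  (\int[mu]_(x in Q) (f x)%:E)%E = (\int[mu]_(x in Q) f x)%:E.
Proof. by move=> fi; rewrite fineK// integrable_fin_num. Qed.

Lemma itg_bounded_mul (h f : R * R -> R) (M : R) : measurable_fun (Q : set P) h ->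
  (forall x, Q x -> `|h x| <= M) -> mu.-integrable Q (EFin \o f) ->
  mu.-integrable Q (EFin \o (fun z => h z * f z)).
Proof.
move=> mh hM fi.
have mf : measurable_fun (Q : set P) f by apply/measurable_EFinP;
  exact: measurable_int fi.
apply: (@le_integrable _ _ _ mu Q mQ _ (EFin \o (fun z => M * f z))).
- by apply/measurable_EFinP; exact: measurable_funM.
- move=> z Qz; rewrite /= lee_fin !normrM ler_wpM2r//.
  by rewrite (le_trans (hM _ Qz))// ler_norm.
- exact: itgZ.
Qed.

Lemma indic01 (A : set (R * R)) z : 0 <= (\1_A z : R) <= 1.
Proof. by rewrite indicE; case: (_ \in _); rewrite ?ler01 ?lexx. Qed.

Lemma Rintegral_indic (A : set P) (f : R * R -> R) : A `<=` Q ->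
  \int[mu]_(z in Q) (\1_A z * f z) = \int[mu]_(z in A) f z.
Proof.
move=> AQ; rewrite -[in RHS](setIidr AQ) [RHS]Rintegral_mkcondr.
apply: eq_Rintegral => z _; rewrite patchE indicE.
by case: (_ \in _); rewrite ?mul1r ?mul0r.
Qed.

Lemma itg_indic (A : set P) (f : R * R -> R) : measurable A ->
  mu.-integrable Q (EFin \o f) -> mu.-integrable Q (EFin \o (fun z => \1_A z * f z)).
Proof.
move=> mA fi; apply: (@itg_bounded_mul _ _ 1 _ _ fi); first exact: measurable_indic.
by move=> z _; have /andP[i0 i1] := indic01 A z; rewrite (ger0_norm i0).
Qed.

End L2.

(** * The fundamental lemma and uniqueness of weak derivatives *)
Section WeakDerivatives.
Context {R : realType}.
Local Notation P := (measurableTypeR R * measurableTypeR R)%type.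
Local Notation mu := (leb2 : {measure set P -> \bar R}).
Local Open Scope ereal_scope.

(** The sets X for which g integrates to 0 over the preimage of X form a lambda
    system, even though g changes sign; the map h allows the sigma-algebra of a
    single coordinate to be treated like that of the plane. *)
Lemma integral_zero_dynkin d (T : measurableType d) (m : {measure set T -> \bar R})
  d' (T' : measurableType d') (h : T -> T') (D : set T) (g : T -> \bar R)
    (G : set (set T')) :
  measurable_fun setT h -> measurable D -> m.-integrable D g ->
    \int[m]_(x in D) g x = 0 ->
  setI_closed G -> G `<=` measurable -> (forall X,
    G X -> \int[m]_(x in D `&` h @^-1` X) g x = 0) ->
  forall X, <<s G >> X -> \int[m]_(x in D `&` h @^-1` X) g x = 0.
Proof.
move=> mh mD ig D0 GI Gm GH.
have mhX X : measurable X -> measurable (D `&` h @^-1` X).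
  by move=> mX; apply: measurableI => //; rewrite -[X in measurable X]setTI; exact: mh.
pose H := [set X | measurable X /\ \int[m]_(x in D `&` h @^-1` X) g x = 0].
suff LH : lambda_system setT H.
  have := @lambda_system_subset _ G GI setT H LH.
  move=> /(_ (fun X GX => conj (Gm X GX) (GH X GX)) (fun _ _ _ _ => I)) sub X /sub[].
  by [].
apply/dynkin_lambda_system; split.
- by split; [exact: measurableT|rewrite preimage_setT setIT].
- move=> X [mX X0]; split; first exact: measurableC.
  have E : D = (D `&` h @^-1` X) `|` (D `&` h @^-1` (~` X)).
    by rewrite -setIUr preimage_setC setUv setIT.
  have mu' := mhX _ mX; have mv' := mhX _ (measurableC mX).
  have := D0; rewrite {1}E integral_setU //; last 2 first.
  + by rewrite -E; exact: measurable_int ig.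
  + by apply/disj_set2P; rewrite setIACA preimage_setC setICr setI0.
  by rewrite X0 add0e.
- move=> F tF HF; split; first by apply: bigcupT_measurable => n; have [] := HF n.
  rewrite preimage_bigcup setI_bigcupr integral_bigcup.
  + by apply: eseries0 => n _ _; have [] := HF n.
  + apply/trivIsetP => i j _ _ ij; have FF : F i `&` F j = set0.
      by move/trivIsetP : tF => /(_ i j I I ij).
    apply/seteqP; split=> // x [[_ Fi] [_ Fj]].
    by rewrite -[set0]/(h @^-1` set0) -FF.
  + by move=> n; apply: mhX; have [] := HF n.
  + rewrite -setI_bigcupr; apply: integrableS ig => //.
    by rewrite -preimage_bigcup; apply: mhX; apply: bigcupT_measurable => n;
      have [] := HF n.
Qed.

(** The plateaus of width 1/(n+1) exhaust the open interval, and only it. *)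
Lemma plateau_cvg (a b x : R) :
  (plateau a b (n.+1%:R^-1) x)%R @[n --> \oo] --> (\1_(`]a, b[%classic) x : R)%R.
Proof.
have [xab|xab] := boolP (x \in `]a, b[).
  rewrite indicE mem_set//; apply: cvg_near_cst.
  move: xab; rewrite in_itv/= => /andP[ax xb].
  have e0 : (0 < Num.min (x - a) (b - x) / 2)%R.
    by rewrite divr_gt0// lt_min !subr_gt0 ax.
  near=> n; have Hn : (n.+1%:R^-1 < Num.min (x - a) (b - x) / 2)%R.
    by near: n; exact: near_infty_natSinv_lt (PosNum e0).
  apply: plateau_eq1; first by rewrite invr_gt0.
  move: Hn; rewrite ltr_pdivlMr// lt_min; set l := _^-1%R => /andP[h1 h2].
  by apply/andP; split; lra.
rewrite indicE memNset; last by move=> /=; exact/negP.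
apply: cvg_near_cst; near=> n; apply: plateau_eq0; first by rewrite invr_gt0.
have l0 : (0 < n.+1%:R^-1 :> R)%R by rewrite invr_gt0.
move: xab l0; rewrite in_itv/= negb_and -!leNgt; set l := _^-1%R => /orP[h|h] l0;
  [left|right]; lra.
Unshelve. all: by end_near. Qed.

(** The products of plateaus are test functions converging boundedly to the
    indicator of the open rectangle. *)
Lemma orthogonal_test_rect (g : R * R -> R) (a b c d : R) :
  mu.-integrable Q (EFin \o g) ->
  (forall phi, test_fun phi -> (\int[mu]_(x in Q) (g x * phi x) = 0)%R) ->
  (-1 <= a)%R -> (b <= 1)%R -> (-1 <= c)%R -> (d <= 1)%R ->
  \int[mu]_(x in `]a, b[ `*` `]c, d[) (g x)%:E = 0.
Proof.
move=> ig Hg a1 b1 c1 d1.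
have mQ : measurable (Q : set P) := measurable_Q.
set rect := (X in \int[_]_(x in X) _).
have mrect : measurable (rect : set P) by apply: measurableX.
have rQ : rect `<=` Q.
  move=> [x y] [/=]; rewrite !in_itv/= => /andP[? ?] /andP[? ?].
  by split; rewrite /= in_itv/=; apply/andP; split; lra.
pose l (n : nat) : R := (n.+1%:R^-1)%R.
have mg : measurable_fun (Q : set P) g by apply/measurable_EFinP;
  exact: measurable_int ig.
have mb n : measurable_fun (setT : set P) (plateau2 a b c d (l n)).
  by apply: continuous_measurable_plane;
    exact: (Ck_continuous (smooth_plateau2 a b c d (l n) 0%N)).
have [] := @dominated_convergence _ _ _ mu Q mQ
  (fun n x => (g x * plateau2 a b c d (l n) x)%:E)
  (fun x => (g x * \1_rect x)%:E) (fun x => `|(g x)%:E|).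
- by move=> n; apply/measurable_EFinP; apply: measurable_funM => //;
    exact: measurable_funTS.
- by apply/measurable_EFinP; apply: measurable_funM.
- apply: aeW => -[x y] _; apply: cvg_EFin; first by near=> n.
  apply: cvgM; first exact: cvg_cst.
  have -> : (\1_rect (x, y) = \1_(`]a, b[%classic) x * \1_(`]c, d[%classic) y :> R)%R.
    by rewrite /rect !indicE in_setX; case: (_ \in _); rewrite ?mul0r ?mul1r.
  by apply: cvgM; exact: plateau_cvg.
- exact: integrable_abse ig.
- apply: aeW => x n _; rewrite /= lee_fin normrM ler_piMr//.
  have := plateau_ge0 a b (l n) x.1; have := plateau_ge0 c d (l n) x.2.
  have := plateau_le1 a b (l n) x.1; have := plateau_le1 c d (l n) x.2.
  rewrite /plateau2; move: (plateau _ _ _ _) (plateau _ _ _ _) => p q *.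
  by rewrite ger0_norm ?mulr_ge0// mulr_ile1.
move=> _ _; rewrite [X in X @ _](_ : _ = fun=> 0) => [H|]; last first.
  apply/funext => n /=.
  rewrite itg_EFin_integral; last first.
    apply: (@le_integrable _ _ _ mu Q mQ _ (EFin \o g)) => //.
      by apply/measurable_EFinP; apply: measurable_funM => //; exact: measurable_funTS.
    move=> x _; rewrite /= lee_fin normrM ler_piMr//.
    have := plateau_ge0 a b (l n) x.1; have := plateau_ge0 c d (l n) x.2.
    have := plateau_le1 a b (l n) x.1; have := plateau_le1 c d (l n) x.2.
    rewrite /plateau2; move: (plateau _ _ _ _) (plateau _ _ _ _) => p q *.
    by rewrite ger0_norm ?mulr_ge0// mulr_ile1.
  congr EFin; rewrite -[RHS](Hg (fun x => plateau2 a b c d (l n) x * 1)%R).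
    by apply: eq_Rintegral => x _; rewrite mulr1.
  apply: test_fun_plateau2 => //; last by move=> m; exact: Ck_cst.
  by rewrite invr_gt0.
have E := cvg_lim (@ereal_hausdorff R) H.
rewrite -(setIidr rQ) integral_mkcondr; rewrite lim_cst// in E; rewrite E.
apply: eq_integral => x _; rewrite patchE indicE.
by case: ifP => xr; rewrite ?mulr1 ?mulr0.
Unshelve. all: by end_near. Qed.

Lemma negligible_boundary_Q : mu.-negligible ((Q : set P) `\` interior Q).
Proof.
rewrite interior_Q; set B := (X in _ `\` X).
have mQ : measurable (Q : set P) := measurable_Q.
have mB : measurable (B : set P) by apply: measurableX.
have BQ : B `<=` Q by rewrite /B -interior_Q; exact: interior_subset.
have QB : mu (Q `\` B) = 0.
  rewrite measureD//; last exact: mu_Q_fin.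
  rewrite (setIidr BQ) /= /Q /sq_of /B !product_measure1E//= !lebesgue_measure_itv/=.
  by rewrite subee//; case: ifP.
have nQB : mu.-negligible (Q `\` B) by apply/negligibleP => //; exact: measurableD.
exact: nQB.
Qed.

(** The fundamental lemma of the calculus of variations: integrals over open
    rectangles vanish by the previous lemma, hence those over all Borel sets by
    the pi-lambda theorem. *)
Lemma orthogonal_test_ae0 (g : R * R -> R) :
  mu.-integrable Q (EFin \o g) ->
  (forall phi, test_fun phi -> (\int[mu]_(x in Q) (g x * phi x) = 0)%R) ->
  {ae mu, forall x, Q x -> g x = 0%R}.
Proof.
move=> ig Hg.
have mQ : measurable (Q : set P) := measurable_Q.
pose B : set P := `](-1)%R, 1%R[%classic `*` `](-1)%R, 1%R[%classic.
have mB : measurable B by apply: measurableX.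
have BQ : B `<=` Q by rewrite /B -interior_Q; exact: interior_subset.
have igB : mu.-integrable B (EFin \o g) by apply: integrableS ig.
pose G := [set A | exists x y, A = `]x, y[%classic] : set (set R).
have GI : setI_closed G.
  move=> _ _ [x [y ->]] [z [t ->]]; exists (Num.max x z), (Num.min y t).
  apply/seteqP; split=> r /=; rewrite !in_itv/= gt_max lt_min.
    by move=> [/andP[-> ->] /andP[-> ->]].
  by move=> /andP[/andP[-> ->] /andP[-> ->]].
have Gm : G `<=` (@measurable _ (measurableTypeR R)).
  by move=> _ [x [y ->]]; exact: measurable_itv.
have mG : @measurable _ (measurableTypeR R) = <<s G >> := RGenOpens.measurableE R.
have rect a b c d : \int[mu]_(x in B `&` (`]a, b[ `*` `]c, d[)) (g x)%:E = 0.
  have -> : B `&` (`]a, b[ `*` `]c, d[) = `](Num.max (-1) a)%R,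
    (Num.min 1 b)%R[ `*` `](Num.max (-1) c)%R, (Num.min 1 d)%R[.
    apply/seteqP; split=> -[x y]; rewrite /B /= !in_itv/= !gt_max !lt_min.
      by move=> [[/andP[-> ->] /andP[-> ->]] [/andP[-> ->] /andP[-> ->]]].
    by move=> [/andP[/andP[-> ->] /andP[-> ->]] /andP[/andP[-> ->] /andP[-> ->]]].
  by apply: orthogonal_test_rect => //; rewrite ?le_max ?ge_min lexx.
have mIB (X Y : set R) : @measurable _ (measurableTypeR R) X ->
    @measurable _ (measurableTypeR R) Y -> measurable (B `&` (X `*` Y) : set P).
  by move=> mX mY; apply: measurableI => //; exact: measurableX.
have BX (X Y : set R) : B `&` (X `*` Y) = B `&` ((X `&` `](-1)%R, 1%R[) `*` Y).
  by apply/seteqP; split=> -[x y]; rewrite /B /=; tauto.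
have BY (X Y : set R) : B `&` (X `*` Y) = B `&` (X `*` (Y `&` `](-1)%R, 1%R[)).
  by apply/seteqP; split=> -[x y]; rewrite /B /=; tauto.
have itv_itg (X Y : set R) : @measurable _ (measurableTypeR R) X ->
    @measurable _ (measurableTypeR R) Y ->
    mu.-integrable (B `&` (X `*` Y)) (EFin \o g).
  by move=> mX mY; apply: integrableS igB => //; exact: mIB.
(* From open intervals to Borel sets in the first factor, then in the second,
   then from Borel rectangles to the product sigma-algebra. *)
have stepA X c d : @measurable _ (measurableTypeR R) X ->
    \int[mu]_(x in B `&` (X `*` `]c, d[)) (g x)%:E = 0.
  rewrite mG => mX.
  have := @integral_zero_dynkin _ _ mu _ (measurableTypeR R) fst
    (B `&` (setT `*` `]c, d[)) (EFin \o g) G measurable_fst (mIB _ _ measurableT _)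
    (itv_itg _ _ measurableT _) _ GI Gm.
  move=> /(_ _ _ _ _ X mX) <- //.
  - by congr (integral _ _ _); apply/seteqP; split=> -[x y] /=; tauto.
  - by rewrite BX setTI.
  - move=> _ [a [b ->]]; rewrite -[RHS](rect a b c d).
    by congr (integral _ _ _); apply/seteqP; split=> -[x y] /=; tauto.
have stepB X Y : @measurable _ (measurableTypeR R) X ->
    @measurable _ (measurableTypeR R) Y ->
    \int[mu]_(x in B `&` (X `*` Y)) (g x)%:E = 0.
  move=> mX; rewrite mG => mY.
  have := @integral_zero_dynkin _ _ mu _ (measurableTypeR R) snd
    (B `&` (X `*` setT)) (EFin \o g) G measurable_snd (mIB _ _ mX measurableT)
    (itv_itg _ _ mX measurableT) _ GI Gm.
  move=> /(_ _ _ Y mY) <- //.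
  - by congr (integral _ _ _); apply/seteqP; split=> -[x y] /=; tauto.
  - by rewrite BY setTI; exact: stepA.
  - move=> _ [a [b ->]]; rewrite -[RHS](stepA X a b mX).
    by congr (integral _ _ _); apply/seteqP; split=> -[x y] /=; tauto.
have stepC (Z : set P) : measurable Z -> \int[mu]_(x in B `&` Z) (g x)%:E = 0.
  rewrite measurable_prod_measurableType => mZ.
  have := @integral_zero_dynkin _ _ mu _ P id B (EFin \o g) _
    (@measurable_id _ _ _) mB igB _ _ _ _ _ mZ.
  apply.
  - by have := stepB _ _ (@measurableT _ (measurableTypeR R))
      (@measurableT _ (measurableTypeR R)); rewrite setXTT setIT.
  - move=> _ _ [A mA [C mC <-]] [A' mA' [C' mC' <-]]; rewrite -setXI.
    by exists (A `&` A'); [exact: measurableI|exists (C `&` C') => //;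
      exact: measurableI].
  - by move=> _ [A mA [C mC <-]]; exact: measurableX.
  - by move=> _ [A mA [C mC <-]]; exact: stepB.
have aeB : ae_eq mu B (EFin \o g) (cst 0).
  apply: integral_ae_eq => // E EB mE.
  by rewrite integral0 -(setIidr EB); exact: stepC.
have nQB : mu.-negligible (Q `\` B) by rewrite /B -interior_Q;
  exact: negligible_boundary_Q.
apply: filterS2 aeB (_ : {ae mu, forall x, ~ (Q `\` B) x}) => [x /= H1 H2 Qx|].
  have Bx : B x by apply: contrapT => nB; exact: H2.
  by have [] := H1 Bx.
by apply: negligibleS nQB => x /= /contrapT.
Qed.

Local Close Scope ereal_scope.

Lemma test_fun_L2 (phi : R * R -> R) : test_fun phi -> L2 phi.
Proof. by move=> [sp _ _]; apply: L2_continuous; exact: (sp 0%N). Qed.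

Lemma smooth_pd (phi : R * R -> R) j : smooth phi -> smooth (pd j phi).
Proof. by move=> sp n; apply: Ck_pd; exact: sp. Qed.

Lemma smooth_L2_pd (phi : R * R -> R) j : smooth phi -> L2 (pd j phi).
Proof. by move=> sp; apply: L2_continuous; exact: (smooth_pd j sp 0%N). Qed.

Lemma aeS (A B : R * R -> Prop) : (forall x, A x -> B x) ->
  {ae mu, forall x, A x} -> {ae mu, forall x, B x}.
Proof. by move=> AB; apply: negligibleS => x /= nB Ax; apply: nB; exact: AB. Qed.

Lemma aeI (A B : R * R -> Prop) : {ae mu, forall x, A x} -> {ae mu, forall x, B x} ->
  {ae mu, forall x, A x /\ B x}.
Proof.
move=> aA aB; have := negligibleU aA aB.
by apply: negligibleS => x /= /not_andP.
Qed.

Lemma weak_pd_unique j (w d1 d2 : R * R -> R) :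
  is_weak_pd j w d1 -> is_weak_pd j w d2 ->
  {ae mu, forall x, Q x -> d1 x = d2 x}.
Proof.
move=> [L1 H1] [L2' H2].
have := @orthogonal_test_ae0 (fun x => d1 x - d2 x) (L2_itg (L2B L1 L2')) _.
have H : forall phi, test_fun phi ->
    \int[mu]_(x in Q) ((d1 x - d2 x) * phi x) = 0.
  move=> phi tphi; have Lp := test_fun_L2 tphi.
  under eq_Rintegral do rewrite mulrBl.
  rewrite RintegralB; [|exact: measurable_Q|exact: L2_itgM|exact: L2_itgM].
  by apply/eqP; rewrite subr_eq0 -eqr_opp -H1// -H2.
move=> /(_ H); apply: aeS => x Hx /Hx /eqP.
by rewrite subr_eq0 => /eqP.
Qed.

Lemma is_weak_pdB j (w1 w2 d1 d2 : R * R -> R) : L2 w1 -> L2 w2 ->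
  is_weak_pd j w1 d1 -> is_weak_pd j w2 d2 ->
  is_weak_pd j (fun x => w1 x - w2 x) (fun x => d1 x - d2 x).
Proof.
move=> Lw1 Lw2 [L1 H1] [L2' H2]; split; first exact: L2B.
move=> phi tphi; have Lp := test_fun_L2 tphi.
have Ld : L2 (pd j phi) by case: tphi => sp _ _; exact: smooth_L2_pd.
under eq_Rintegral do rewrite mulrBl.
under [in RHS]eq_Rintegral do rewrite mulrBl.
have mQ : measurable (Q : set P) := measurable_Q.
by rewrite !RintegralB//; try exact: L2_itgM; rewrite H1// H2// opprB opprK addrC.
Qed.

Lemma wpdP j (w : R * R -> R) : H1 w -> is_weak_pd j w (wpd j w).
Proof. by move=> [_ /(_ j) ex]; exact: (getPex ex). Qed.

(** [wpd] is a chosen representative of the weak derivative, so it is linear only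
    almost everywhere. *)
Lemma wpdB j (w1 w2 : R * R -> R) : H1 w1 -> H1 w2 ->
  {ae mu, forall x, Q x ->
    wpd j (fun x => w1 x - w2 x) x = wpd j w1 x - wpd j w2 x}.
Proof.
move=> Hw1 Hw2; have := is_weak_pdB (proj1 Hw1) (proj1 Hw2) (wpdP j Hw1) (wpdP j Hw2).
move=> H; apply: weak_pd_unique H; apply: wpdP; split.
  exact: L2B (proj1 Hw1) (proj1 Hw2).
move=> i; exists (fun x => wpd i w1 x - wpd i w2 x).
exact: is_weak_pdB (proj1 Hw1) (proj1 Hw2) (wpdP i Hw1) (wpdP i Hw2).
Qed.

Lemma H1B (w1 w2 : R * R -> R) : H1 w1 -> H1 w2 -> H1 (fun x => w1 x - w2 x).
Proof.
move=> Hw1 Hw2; split; first exact: L2B (proj1 Hw1) (proj1 Hw2).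
move=> i; exists (fun x => wpd i w1 x - wpd i w2 x).
exact: is_weak_pdB (proj1 Hw1) (proj1 Hw2) (wpdP i Hw1) (wpdP i Hw2).
Qed.

End WeakDerivatives.

(** * Reflections of the plane and symmetry of second derivatives *)
Section PlaneSymmetries.
Context {R : realType}.
Implicit Types (f g : R * R -> R) (z : R * R).

(** Together with [ref], it generates the symmetry group of the square. *)
Definition sw z : R * R := (z.2, z.1).
Definition ref z : R * R := (z.1, - z.2).

Lemma swK : involutive sw. Proof. by case. Qed.
Lemma refK : involutive ref. Proof. by case=> x y; rewrite /ref /= opprK. Qed.

Lemma is_derive_slice0 f (x y : R) : derivable f (x, y) (dir 0) ->
  is_derive x (1:R) (fun t => f (t, y)) (pd 0 f (x, y)).
Proof.
have H : (fun h : R => h^-1 *: ((f \o shift (x, y)) (h *: dir 0) - f (x, y))) =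
  (fun h : R => h^-1 *: (((fun t => f (t, y)) \o shift x) (h *: (1 : R)) - f (x, y))).
  apply/funext => h /=; congr (_ *: (f _ - _)).
  by congr (_, _); rewrite /= [h *: 0]mulr0 add0r.
by rewrite /derivable H => df; split=> //; rewrite /pd /derive H.
Qed.

Lemma is_derive_slice1 f (x y : R) : derivable f (x, y) (dir 1) ->
  is_derive y (1:R) (fun t => f (x, t)) (pd 1 f (x, y)).
Proof.
have H : (fun h : R => h^-1 *: ((f \o shift (x, y)) (h *: dir 1) - f (x, y))) =
  (fun h : R => h^-1 *: (((fun t => f (x, t)) \o shift y) (h *: (1 : R)) - f (x, y))).
  apply/funext => h /=; congr (_ *: (f _ - _)).
  by congr (_, _); rewrite /= [h *: 0]mulr0 add0r.
by rewrite /derivable H => df; split=> //; rewrite /pd /derive H.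
Qed.

Lemma slice1_is_derive f (x y d : R) : is_derive y (1:R) (fun t => f (x, t)) d ->
  is_derive (x, y) (dir 1) f d.
Proof.
have H : (fun h : R => h^-1 *: ((f \o shift (x, y)) (h *: dir 1) - f (x, y))) =
  (fun h : R => h^-1 *: (((fun t => f (x, t)) \o shift y) (h *: (1 : R)) - f (x, y))).
  apply/funext => h /=; congr (_ *: (f _ - _)).
  by congr (_, _); rewrite /= [h *: 0]mulr0 add0r.
by case=> d1 d2; split; rewrite ?/derivable ?/derive H.
Qed.

Lemma continuous_coords (f g : R * R -> R) : continuous f -> continuous g ->
  continuous (fun z => (f z, g z)).
Proof. by move=> cf cg z; exact: (cvg_pair (cf z) (cg z)). Qed.

Lemma continuous_sw : continuous sw.
Proof. by apply: continuous_coords => z; [exact: cvg_snd|exact: cvg_fst]. Qed.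

Lemma continuous_ref : continuous ref.
Proof.
by apply: continuous_coords => z; [exact: cvg_fst|apply: cvgN; exact: cvg_snd].
Qed.

Lemma is_derive_sw0 f z : derivable f (sw z) (dir 1) ->
  is_derive z (dir 0) (f \o sw) (pd 1 f (sw z)).
Proof. by move=> d. Qed.

Lemma is_derive_sw1 f z : derivable f (sw z) (dir 0) ->
  is_derive z (dir 1) (f \o sw) (pd 0 f (sw z)).
Proof. by move=> d. Qed.

Lemma is_derive_ref0 f z : derivable f (ref z) (dir 0) ->
  is_derive z (dir 0) (f \o ref) (pd 0 f (ref z)).
Proof.
move=> d; have H : (fun h : R => h^-1 *: (((f \o ref) \o shift z)
  (h *: dir 0) - (f \o ref) z)) =
  (fun h : R => h^-1 *: ((f \o shift (ref z)) (h *: dir 0) - f (ref z))).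
  apply/funext => h /=; congr (_ *: (f _ - _)); congr (_, _) => /=.
  by rewrite [h *: 0]mulr0 !add0r.
by split; rewrite /derivable /derive H.
Qed.

Lemma is_derive_ref1 f z : derivable f (ref z) (dir 1) ->
  is_derive z (dir 1) (f \o ref) (- pd 1 f (ref z)).
Proof.
case: z => x y d; apply: slice1_is_derive.
have H := @is_derive1_comp R (fun t => f (x, t)) (fun t : R => - t) y _ _
  (is_derive_slice1 d) (is_deriveN (is_derive_id y (1:R))).
by apply: (is_derive_eq H); rewrite mulrN1.
Qed.

Lemma pd_sw0 n f z : Ck n.+1 f -> pd 0 (f \o sw) z = pd 1 f (sw z).
Proof. by move=> Cf; have [_ <-] := is_derive_sw0 (@Ck_derivable _ _ _ 1 (sw z) Cf). Qed.

Lemma pd_sw1 n f z : Ck n.+1 f -> pd 1 (f \o sw) z = pd 0 f (sw z).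
Proof. by move=> Cf; have [_ <-] := is_derive_sw1 (@Ck_derivable _ _ _ 0 (sw z) Cf). Qed.

Lemma pd_ref0 n f z : Ck n.+1 f -> pd 0 (f \o ref) z = pd 0 f (ref z).
Proof. by move=> Cf; have [_ <-] :=
  is_derive_ref0 (@Ck_derivable _ _ _ 0 (ref z) Cf). Qed.

Lemma pd_ref1 n f z : Ck n.+1 f -> pd 1 (f \o ref) z = - pd 1 f (ref z).
Proof. by move=> Cf; have [_ <-] :=
  is_derive_ref1 (@Ck_derivable _ _ _ 1 (ref z) Cf). Qed.

Lemma Ck_sw n f : Ck n f -> Ck n (f \o sw).
Proof.
elim: n f => [|n IH] f Cf.
  by move=> z; apply: continuous_comp; [exact: continuous_sw|exact: Cf].
split.
  by move=> z; apply: continuous_comp; [exact: continuous_sw|exact: Ck_continuous Cf _].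
apply: dirP; split.
- by move=> z; have [] := is_derive_sw0 (@Ck_derivable _ _ _ 1 (sw z) Cf).
- by have -> : pd 0 (f \o sw) = pd 1 f \o sw by []; apply: IH; exact: Ck_pd.
- by move=> z; have [] := is_derive_sw1 (@Ck_derivable _ _ _ 0 (sw z) Cf).
- by have -> : pd 1 (f \o sw) = pd 0 f \o sw by []; apply: IH; exact: Ck_pd.
Qed.

Lemma Ck_ref n f : Ck n f -> Ck n (f \o ref).
Proof.
elim: n f => [|n IH] f Cf.
  by move=> z; apply: continuous_comp; [exact: continuous_ref|exact: Cf].
split.
  by move=> z; apply: continuous_comp; [exact: continuous_ref|exact: Ck_continuous Cf _].
apply: dirP; split.
- by move=> z; have [] := is_derive_ref0 (@Ck_derivable _ _ _ 0 (ref z) Cf).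
- have -> : pd 0 (f \o ref) = pd 0 f \o ref.
    by apply/funext => z; rewrite (pd_ref0 _ Cf).
  by apply: IH; exact: Ck_pd.
- by move=> z; have [] := is_derive_ref1 (@Ck_derivable _ _ _ 1 (ref z) Cf).
- have -> : pd 1 (f \o ref) = (fun z => -1 * (pd 1 f \o ref) z).
    by apply/funext => z; rewrite (pd_ref1 _ Cf) mulN1r.
  by apply: CkM; [exact: Ck_cst|apply: IH; exact: Ck_pd].
Qed.

Lemma CkN n f : Ck n f -> Ck n (fun z => - f z).
Proof.
move=> Cf; have -> : (fun z => - f z) = (fun z => -1 * f z).
  by apply/funext => z; rewrite mulN1r.
by apply: CkM => //; exact: Ck_cst.
Qed.

Lemma CkB n f g : Ck n f -> Ck n g -> Ck n (fun z => f z - g z).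
Proof. by move=> Cf Cg; apply: CkD => //; exact: CkN. Qed.

Lemma pdB n f g j : Ck n.+1 f -> Ck n.+1 g ->
  pd j (fun z => f z - g z) = (fun z => pd j f z - pd j g z).
Proof.
move=> Cf Cg; apply/funext => z; rewrite /pd.
by have := @deriveB _ _ _ f g z (dir j) (@Ck_derivable _ _ _ j z Cf)
  (@Ck_derivable _ _ _ j z Cg).
Qed.

(** The mean value theorem in each variable in turn. *)
Lemma second_difference f (x y h : R) : Ck 2 f -> 0 < h ->
  exists z : R * R, [/\ x < z.1 < x + h, y < z.2 < y + h &
    f (x + h, y + h) - f (x, y + h) - (f (x + h, y) - f (x, y)) =
      pd 1 (pd 0 f) z * h ^+ 2].
Proof.
move=> C2 h0; have C1 := Ck_pd 0 C2.
have d0 s t : is_derive s (1:R) (fun s => f (s, t)) (pd 0 f (s, t)).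
  exact: is_derive_slice0 (@Ck_derivable _ _ _ 0 (s, t) C2).
have d1 s t : is_derive t (1:R) (fun t => pd 0 f (s, t)) (pd 1 (pd 0 f) (s, t)).
  exact: is_derive_slice1 (@Ck_derivable _ _ _ 1 (s, t) C1).
have dd s : is_derive s (1:R) ((fun s => f (s, y + h)) - (fun s => f (s, y)))
    (pd 0 f (s, y + h) - pd 0 f (s, y)) by exact: is_deriveB.
have xh : x < x + h by rewrite ltrDl.
have yh : y < y + h by rewrite ltrDl.
have [|xi Hxi E1] := @MVT _ _ (fun s =>
  pd 0 f (s, y + h) - pd 0 f (s, y)) _ _ xh (fun s _ => dd s).
  by apply: continuous_subspaceT; exact: (is_derive1_continuous dd).
have [|et Het E2] := @MVT _ _ (fun t => pd 1 (pd 0 f) (xi, t)) _ _ yh (fun t _ =>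
  d1 xi t).
  by apply: continuous_subspaceT; exact: (is_derive1_continuous (d1 xi)).
exists (xi, et); rewrite !in_itv/= in Hxi Het; split=> //.
have hh (z : R) : z + h - z = h by rewrite addrC addKr.
rewrite E2 !hh in E1.
have {}E1 : f (x + h, y + h) - f (x + h, y) - (f (x, y + h) - f (x, y)) =
  pd 1 (pd 0 f) (xi, et) * h * h := E1.
rewrite expr2 mulrA -E1; ring.
Qed.

(** The second difference of f is unchanged when the two coordinates are exchanged.
    Evaluated on a small square, it is therefore the same multiple of each mixed
    derivative at some point of that square; continuity does the rest. *)
Lemma pdC f : Ck 2 f -> pd 1 (pd 0 f) = pd 0 (pd 1 f).
Proof.
have fin (e t u v : R) : `|u - t| < e / 2 -> `|v - t| < e / 2 -> `|u - v| <= e.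
  rewrite !ltr_norml ler_norml => /andP[? ?] /andP[? ?].
  by apply/andP; split; lra.
have near (h s t d : R) : 0 < d -> h <= d -> s < t < s + h -> `|s - t| < d.
  by move=> d0 hd /andP[st th]; rewrite ltr_norml; apply/andP; split; lra.
move=> C2; apply/funext => -[x y].
have c1 : continuous (pd 1 (pd 0 f)) by apply: (@Ck_continuous _ 0); do 2 apply: Ck_pd.
have c2 : continuous (pd 0 (pd 1 f)) by apply: (@Ck_continuous _ 0); do 2 apply: Ck_pd.
apply/eqP; rewrite -subr_eq0 -normr_le0; apply/ler_addgt0Pr => e e0.
rewrite add0r.
have e20 : 0 < e / 2 by rewrite divr_gt0.
have [d1 /= d10 H1] : nbhs_ball (x, y) [set z | `|pd 1 (pd 0 f) (x,
  y) - pd 1 (pd 0 f) z| < e / 2].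
  by apply/nbhs_ballP; move/cvgrPdist_lt : (c1 (x, y)); exact.
have [d2 /= d20 H2] : nbhs_ball (x, y) [set z | `|pd 0 (pd 1 f) (x,
  y) - pd 0 (pd 1 f) z| < e / 2].
  by apply/nbhs_ballP; move/cvgrPdist_lt : (c2 (x, y)); exact.
have [h h0 [hd1 hd2]] : exists2 h : R, 0 < h & h <= d1 /\ h <= d2.
  by exists (Num.min d1 d2); rewrite ?lt_min ?ge_min ?lexx ?orbT ?d10.
have [[x1 y1] [/= /andP[a1 a2] /andP[b1 b2] E]] := second_difference x y C2 h0.
have [[y2 x2] [/= /andP[a3 a4] /andP[b3 b4] E']] := second_difference y x (Ck_sw C2) h0.
have Esw : pd 1 (pd 0 (f \o sw)) (y2, x2) = pd 0 (pd 1 f) (x2, y2).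
  have -> : pd 0 (f \o sw) = pd 1 f \o sw by apply/funext => z; rewrite (pd_sw0 _ C2).
  by rewrite (pd_sw1 _ (Ck_pd 1 C2)).
have EE : pd 1 (pd 0 f) (x1, y1) = pd 0 (pd 1 f) (x2, y2).
  have hn0 : h ^+ 2 != 0 by rewrite expf_neq0 ?gt_eqF.
  have {}E' : f (x + h, y + h) - f (x + h, y) - (f (x, y + h) - f (x, y)) =
    pd 0 (pd 1 f) (x2, y2) * h ^+ 2 := etrans E' (congr1 (fun t => t * h ^+ 2) Esw).
  have H : pd 1 (pd 0 f) (x1, y1) * h ^+ 2 = pd 0 (pd 1 f) (x2, y2) * h ^+ 2.
    apply: etrans (esym E) (etrans _ E').
    move: (f _) (f (x, y + h)) (f (x + h, y)) (f (x, y)) => f1 f2 f3 f4.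
    by clear; ring.
  exact: (mulIf hn0 H).
have B1 : `|pd 1 (pd 0 f) (x, y) - pd 1 (pd 0 f) (x1, y1)| < e / 2.
  apply: H1; split.
    exact: (near _ _ _ _ d10 hd1 (introT andP (conj a1 a2))).
  exact: (near _ _ _ _ d10 hd1 (introT andP (conj b1 b2))).
have B2 : `|pd 0 (pd 1 f) (x, y) - pd 0 (pd 1 f) (x2, y2)| < e / 2.
  apply: H2; split.
    exact: (near _ _ _ _ d20 hd2 (introT andP (conj b3 b4))).
  exact: (near _ _ _ _ d20 hd2 (introT andP (conj a3 a4))).
by rewrite EE in B1; exact: (fin _ _ _ _ B1 B2).
Qed.

End PlaneSymmetries.

(** * A null Lagrangian on the triangle *)
Section Triangle.
Context {R : realType}.
Local Notation P := (measurableTypeR R * measurableTypeR R)%type.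
Local Notation mu := (leb2 : {measure set P -> \bar R}).
Implicit Types (D : set P) (f g : R * R -> R) (z : R * R).

Lemma FTC (g g' : R -> R) (a b : R) : a <= b ->
  (forall x, is_derive x (1:R) g (g' x)) -> continuous g' ->
  (\int[leb]_(x in `[a, b]) (g' x)%:E = (g b - g a)%:E)%E.
Proof.
move=> ab dg cg'; have cg := is_derive1_continuous dg.
move: ab; rewrite le_eqVlt => /predU1P[<-|ab].
  by rewrite set_itv1 integral_set1 subrr.
rewrite (@continuous_FTC2 _ g' g)//.
- exact: continuous_subspaceT.
- split.
  + by move=> x _; have [] := dg x.
  + exact: cvg_at_right_filter (cg a).
  + exact: cvg_at_left_filter (cg b).
- by move=> x _; rewrite derive1E; have [_ ->] := dg x.
Qed.

Lemma Rfubini1 D f (I : R -> R) : measurable D ->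
  mu.-integrable D (EFin \o f) ->
  (forall x, (\int[leb]_(y in [set y | D (x, y)]) (f (x, y))%:E = (I x)%:E)%E) ->
  \int[mu]_(x in D) f x = \int[leb]_x I x.
Proof.
move=> mD fi HI; rewrite /Rintegral integral_mkcond.
have fi' : mu.-integrable setT ((EFin \o f) \_ D).
  by apply/integrable_restrict => //; rewrite setTI.
rewrite -(integral12_prod_meas1 fi'); congr fine.
apply: eq_integral => x _; rewrite -HI [RHS]integral_mkcond.
apply: eq_integral => y _; rewrite !patchE /=.
by have -> : ((x, y) \in D) = (y \in [set y | D (x, y)]) by apply/idP/idP;
  rewrite !in_setE.
Qed.

Lemma Rfubini2 D f (I : R -> R) : measurable D ->
  mu.-integrable D (EFin \o f) ->
  (forall y, (\int[leb]_(x in [set x | D (x, y)]) (f (x, y))%:E = (I y)%:E)%E) ->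
  \int[mu]_(x in D) f x = \int[leb]_x I x.
Proof.
move=> mD fi HI; rewrite /Rintegral integral_mkcond.
have fi' : mu.-integrable setT ((EFin \o f) \_ D).
  by apply/integrable_restrict => //; rewrite setTI.
rewrite -(integral21_prod_meas1 fi'); congr fine.
apply: eq_integral => y _; rewrite -HI [RHS]integral_mkcond.
apply: eq_integral => x _; rewrite !patchE /=.
by have -> : ((x, y) \in D) = (x \in [set x | D (x, y)]) by apply/idP/idP;
  rewrite !in_setE.
Qed.

Definition triangle : set (R * R) := [set z | [/\ 0 <= z.2, z.2 <= z.1 & z.1 <= 1]].

Lemma triangle_Q : triangle `<=` Q.
Proof.
by move=> [x y] [/= ? ? ?]; split; rewrite /= in_itv/=; apply/andP; split; lra.
Qed.

Lemma measurable_triangle : measurable (triangle : set P).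
Proof.
apply: measurable_closed_plane.
have -> : triangle = [set z : R * R | 0 <= z.2] `&` [set z | 0 <= z.1 - z.2]
   `&` [set z | 0 <= 1 - z.1].
  apply/seteqP; split=> -[x y] /=; rewrite !subr_ge0; first by move=> [].
  by move=> [[]].
have cl (f : R * R -> R) : continuous f -> closed [set z | 0 <= f z].
  move=> cf; rewrite (_ : [set z | _] = f @^-1` [set x | 0 <= x])//.
  by apply: preimage_closed => //; exact: closed_ge.
apply: closedI; first (apply: closedI); apply: cl => z.
- exact: cvg_snd.
- by apply: cvgB; [exact: cvg_fst|exact: cvg_snd].
- by apply: cvgB; [exact: cvg_cst|exact: cvg_fst].
Qed.

Lemma continuous_slice0 f (y : R) : continuous f -> continuous (fun x => f (x, y)).
Proof.
move=> cf x; apply: (@continuous_comp _ _ _ (fun x => (x, y)) f); last exact: cf.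
exact: (cvg_pair (@cvg_id _ (nbhs x)) (@cvg_cst _ y _ (nbhs x) _)).
Qed.

Lemma continuous_slice1 f (x : R) : continuous f -> continuous (fun y => f (x, y)).
Proof.
move=> cf y; apply: (@continuous_comp _ _ _ (fun y => (x, y)) f); last exact: cf.
exact: (cvg_pair (@cvg_cst _ x _ (nbhs y) _) (@cvg_id _ (nbhs y))).
Qed.

Lemma triangle_pd1 f : Ck 1 f ->
  \int[mu]_(z in triangle) pd 1 f z =
  \int[leb]_(x in `[0, 1]) (f (x, x) - f (x, 0)).
Proof.
move=> C1; have cf := Ck_pd 1 C1.
rewrite [RHS]Rintegral_mkcond.
apply: Rfubini1; first exact: measurable_triangle.
  by apply: continuous_integrable;
    [exact: measurable_triangle|exact: triangle_Q|exact: cf].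
move=> x; rewrite patchE; case: ifPn => [|] xI.
  move: xI; rewrite inE /= in_itv/= => /andP[x0 x1].
  have -> : [set y | triangle (x, y)] = `[0, x]%classic.
    apply/seteqP; split=> y /=; rewrite in_itv/=; first by move=> [/= -> ->].
    by move=> /andP[? ?].
  apply: (@FTC (fun y => f (x, y)) (fun y => pd 1 f (x, y)) _ _ x0).
    by move=> y; exact: is_derive_slice1 (@Ck_derivable _ _ _ 1 (x, y) C1).
  exact: continuous_slice1.
have -> : [set y | triangle (x, y)] = set0.
  apply/seteqP; split=> // y [/= y0 yx x1]; move: xI; rewrite notin_setE /= in_itv/=.
  by apply; apply/andP; split => //; exact: le_trans yx.
by rewrite integral_set0.
Qed.

Lemma triangle_pd0 f : Ck 1 f ->
  \int[mu]_(z in triangle) pd 0 f z =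
  \int[leb]_(y in `[0, 1]) (f (1, y) - f (y, y)).
Proof.
move=> C1; have cf := Ck_pd 0 C1.
rewrite [RHS]Rintegral_mkcond.
apply: Rfubini2; first exact: measurable_triangle.
  by apply: continuous_integrable;
    [exact: measurable_triangle|exact: triangle_Q|exact: cf].
move=> y; rewrite patchE; case: ifPn => [|] yI.
  move: yI; rewrite inE /= in_itv/= => /andP[y0 y1].
  have -> : [set x | triangle (x, y)] = `[y, 1]%classic.
    apply/seteqP; split=> x /=; rewrite in_itv/=; first by move=> [/= _ -> ->].
    by move=> /andP[? ?].
  apply: (@FTC (fun x => f (x, y)) (fun x => pd 0 f (x, y)) _ _ y1).
    by move=> x; exact: is_derive_slice0 (@Ck_derivable _ _ _ 0 (x, y) C1).
  exact: continuous_slice0.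
have -> : [set x | triangle (x, y)] = set0.
  apply/seteqP; split=> // x [/= y0 yx x1]; move: yI; rewrite notin_setE /= in_itv/=.
  by apply; apply/andP; split => //; exact: le_trans x1.
by rewrite integral_set0.
Qed.

(** The Jacobian is the divergence of (a d_y b, - a d_x b) since the mixed
    derivatives of b agree.  By Gauss's theorem only the boundary matters: a
    vanishes on the legs, and the derivative of b along the hypotenuse is zero. *)
Lemma triangle_null_lagrangian (a b : R * R -> R) : Ck 1 a -> Ck 2 b ->
  (forall x, a (x, 0) = 0) -> (forall y, a (1, y) = 0) ->
  (forall x, pd 0 b (x, x) + pd 1 b (x, x) = 0) ->
  \int[mu]_(z in triangle) (pd 0 a z * pd 1 b z - pd 1 a z * pd 0 b z) = 0.
Proof.
move=> Ca Cb a0 a1 bd.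
have C1 : Ck 1 (fun z => a z * pd 1 b z) := CkM Ca (Ck_pd 1 Cb).
have C0 : Ck 1 (fun z => a z * pd 0 b z) := CkM Ca (Ck_pd 0 Cb).
have E z : pd 0 a z * pd 1 b z - pd 1 a z * pd 0 b z =
   pd 0 (fun z => a z * pd 1 b z) z - pd 1 (fun z => a z * pd 0 b z) z.
  rewrite !pdM; first by rewrite (pdC Cb); ring.
  - by move=> x; exact: Ck_derivable Ca.
  - by move=> x; exact: (@Ck_derivable _ _ _ _ _ (Ck_pd 0 Cb)).
  - by move=> x; exact: Ck_derivable Ca.
  - by move=> x; exact: (@Ck_derivable _ _ _ _ _ (Ck_pd 1 Cb)).
under eq_Rintegral do rewrite E.
rewrite RintegralB.
- apply: etrans (congr2 (fun s t => s - t) (triangle_pd0 C1) (triangle_pd1 C0)) _.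
  apply/eqP; rewrite subr_eq0; apply/eqP.
  apply: eq_Rintegral => x _; rewrite a0 a1 !mul0r sub0r subr0.
  by have /eqP := bd x; rewrite addr_eq0 => /eqP ->; rewrite mulrN.
- exact: measurable_triangle.
- by apply: continuous_integrable;
    [exact: measurable_triangle|exact: triangle_Q|exact: Ck_pd 0 C1].
- by apply: continuous_integrable;
    [exact: measurable_triangle|exact: triangle_Q|exact: Ck_pd 1 C0].
Qed.

End Triangle.

(** * Folding the square onto the triangle *)
Section Folding.
Context {R : realType}.
Local Notation P := (measurableTypeR R * measurableTypeR R)%type.
Local Notation mu := (leb2 : {measure set P -> \bar R}).
Implicit Types (D S : set P) (f g : R * R -> R) (z : R * R) (T : R * R -> R * R).

(** The measure-preserving maps that do not move points into the square from
    outside: integrals over a subset of Q are carried to a subset of Q, where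
    continuous functions are integrable. *)
Definition Qsym T : Prop :=
  [/\ continuous T, measurable_fun (setT : set P) (T : P -> P),
      forall A : set P, measurable A -> mu (T @^-1` A) = mu A & T @^-1` Q `<=` Q].

Lemma Qsym_comp T1 T2 : Qsym T1 -> Qsym T2 -> Qsym (T1 \o T2).
Proof.
move=> [c1 m1 p1 q1] [c2 m2 p2 q2]; split.
- by move=> z; apply: continuous_comp; [exact: c2|exact: c1].
- exact: measurableT_comp.
- move=> A mA; rewrite comp_preimage p2 ?p1//.
  by rewrite -[X in measurable X]setTI; exact: m1.
- by move=> z Qz; apply: q2; exact: q1.
Qed.

(** Measure preservation follows from uniqueness of the product measure on
    rectangles. *)
Lemma Qsym_sw : Qsym sw.
Proof.
split; first exact: continuous_sw.
- apply/measurable_fun_pairP; split; [exact: measurable_snd|exact: measurable_fst].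
- have msw : measurable_fun (setT : set P) (sw : P -> P).
    by apply/measurable_fun_pairP; split; [exact: measurable_snd|exact: measurable_fst].
  move=> A mA; apply/esym.
  apply: (@product_measure_unique _ _ _ _ _ leb leb (pushforward mu (sw : P -> P))) => //.
  move=> X Y mX mY; rewrite /= /pushforward.
  have -> : (sw : P -> P) @^-1` (X `*` Y) = Y `*` X by apply/seteqP; split=> -[x y] [].
  by rewrite product_measure1E// muleC.
- by move=> [x y] [].
Qed.

Lemma Qsym_ref : Qsym ref.
Proof.
have mref : measurable_fun (setT : set P) (ref : P -> P).
  apply/measurable_fun_pairP; split; first exact: measurable_fst.
  by apply: measurable_funN; exact: measurable_snd.
split; [exact: continuous_ref|exact: mref| |].
- move=> A mA; apply/esym.
  apply: (@product_measure_unique _ _ _ _ _ leb leb (pushforward mu (ref : P -> P))) =>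
    //.
  move=> X Y mX mY; rewrite /= /pushforward.
  have -> : (ref : P -> P) @^-1` (X `*` Y) = X `*` ((-%R : R ->
    measurableTypeR R) @^-1` Y).
    by apply/seteqP; split=> -[x y] [].
  have mN : measurable ((-%R : R -> measurableTypeR R) @^-1` Y).
    by rewrite -[X in measurable X]setTI; exact: oppr_measurable.
  by rewrite product_measure1E// -[in RHS](lebesgue_measureN mY).
- move=> [x y] [/= Qx Qy]; split=> //; move: Qy; rewrite /= !in_itv/=.
  by move=> /andP[? ?]; apply/andP; split; lra.
Qed.

Lemma Rintegral_Qsym T f D : Qsym T -> measurable D -> D `<=` Q -> continuous f ->
  \int[mu]_(z in D) f z = \int[mu]_(z in T @^-1` D) f (T z).
Proof.
move=> [cT mT pT qT] mD DQ cf.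
have mTD : measurable (T @^-1` D : set P) by rewrite -[X in measurable X]setTI; exact: mT.
have cfT : continuous (f \o T) by move=> z; apply: continuous_comp; [exact: cT|exact: cf].
have mf : measurable_fun (setT : set P) (EFin \o f).
  by apply/measurable_EFinP; exact: continuous_measurable_plane.
have TDQ : T @^-1` D `<=` Q by move=> z /DQ /qT.
have H := @integral_pushforward _ _ P P R T mT mu D (EFin \o f) mf
  (continuous_integrable mTD TDQ cfT) mD.
congr fine; apply: etrans H; apply: eq_measure_integral => A mA _.
by apply/esym; exact: pT.
Qed.

Lemma Rintegral_null_overlap (A B : set P) f : measurable A -> measurable B ->
  A `<=` Q -> B `<=` Q -> mu (A `&` B) = 0 -> continuous f ->
  \int[mu]_(z in A `|` B) f z = \int[mu]_(z in A) f z + \int[mu]_(z in B) f z.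
Proof.
move=> mA mB AQ BQ AB0 cf.
have mBA : measurable (B `\` A) by exact: measurableD.
have BAQ : B `\` A `<=` Q by move=> z [/BQ].
have -> : A `|` B = A `|` (B `\` A).
  apply/seteqP; split=> z; last by move=> [|[]]; [left|right].
  by move=> [Az|Bz]; [left|have [Az|nAz] := pselect (A z); [left|right]].
rewrite Rintegral_setU//; last first.
- by apply/disj_set2P/seteqP; split=> // z [Az [_ nAz]].
- apply: continuous_integrable => //; first exact: measurableU.
  by rewrite subUset.
congr (_ + _).
have {2}-> : B = (B `\` A) `|` (A `&` B).
  apply/seteqP; split=> z; last by move=> [[]|[]].
  by move=> Bz; have [Az|nAz] := pselect (A z); [right|left].
rewrite [RHS]Rintegral_setU//; first last.
- by apply/disj_set2P/seteqP; split=> // z [[_ nAz] [Az _]].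
- apply: continuous_integrable => //; first by apply: measurableU => //;
    exact: measurableI.
  by rewrite subUset; split => // z [/AQ].
- exact: measurableI.
suff -> : \int[mu]_(x in A `&` B) f x = 0 by rewrite addr0.
rewrite /Rintegral null_set_integral//.
- exact: measurableI.
- by apply/measurable_EFinP; apply: measurable_funTS; exact: continuous_measurable_plane.
Qed.

(** S and its image under the involution T tile the plane up to a null set, so that
    an integral over a T-invariant set is an integral over half of it. *)
Lemma fold_half T D S f : Qsym T -> involutive T -> measurable D -> D `<=` Q ->
  T @^-1` D = D ->
  measurable S -> S `|` T @^-1` S = setT -> mu (S `&` T @^-1` S) = 0 ->
  continuous f ->
  \int[mu]_(z in D) f z = \int[mu]_(z in D `&` S) (f z + f (T z)).
Proof.
move=> symT TK mD DQ TD mS ST S0 cf; have [cT mT pT qT] := symT.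
have mTS : measurable (T @^-1` S : set P) by rewrite -[X in measurable X]setTI; exact: mT.
have mDS : measurable (D `&` S) by exact: measurableI.
have mDTS : measurable (D `&` T @^-1` S) by exact: measurableI.
have DSQ : D `&` S `<=` Q by move=> z [/DQ].
have E : D = (D `&` S) `|` (D `&` T @^-1` S) by rewrite -setIUr ST setIT.
rewrite [in LHS]E Rintegral_null_overlap//; last 2 first.
- by move=> z [/DQ].
- apply/eqP; rewrite -measure_le0 -S0; apply: le_measure; rewrite ?inE//.
  + exact: measurableI.
  + exact: measurableI.
  + by move=> z [[_ Sz] [_ TSz]].
have cfT : continuous (f \o T) by move=> z; apply: continuous_comp; [exact: cT|exact: cf].
rewrite [RHS]RintegralD//; [|exact: continuous_integrable|exact:
  (continuous_integrable mDS DSQ cfT)].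
congr (_ + _).
rewrite (Rintegral_Qsym symT mDTS)//; last by move=> z [/DQ].
rewrite preimage_setI TD; congr (Rintegral _ (D `&` _) _).
by apply/seteqP; split=> z /=; rewrite TK.
Qed.

Definition rfx z : R * R := (- z.1, z.2).
Definition opp2 z : R * R := (- z.1, - z.2).

Lemma Qsym_rfx : Qsym rfx.
Proof. exact: Qsym_comp Qsym_sw (Qsym_comp Qsym_ref Qsym_sw). Qed.

Lemma Qsym_opp2 : Qsym opp2.
Proof. exact: Qsym_comp Qsym_rfx Qsym_ref. Qed.

Lemma rfxK : involutive rfx.
Proof. by case=> x y; rewrite /rfx /= opprK. Qed.

Lemma measurable_ge0_set f : continuous f -> measurable ([set z | 0 <= f z] : set P).
Proof.
move=> cf; apply: measurable_closed_plane.
rewrite (_ : [set z | _] = f @^-1` [set x | 0 <= x])//.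
by apply: preimage_closed => //; exact: closed_ge.
Qed.

Lemma mu_diagonal : mu [set z | z.1 = z.2] = 0.
Proof.
rewrite /= /product_measure1 /=; apply: integral0_eq => x _ /=.
rewrite (_ : xsection _ x = [set x]) ?lebesgue_measure_set1//.
by apply/seteqP; split=> y; rewrite /xsection /= inE /= => ->.
Qed.

Lemma mu_axis2 : mu ([set (0%R : R)] `*` setT) = 0%E.
Proof.
have H : (mu ([set (0%R : R)] `*` setT) = leb [set (0%R : R)] * leb (setT : set R))%E.
  exact: product_measure1E.
by rewrite H lebesgue_measure_set1 mul0e.
Qed.

Lemma mu_axis1 : mu (setT `*` [set (0%R : R)]) = 0%E.
Proof.
have H : (mu (setT `*` [set (0%R : R)]) = leb (setT : set R) * leb [set (0%R : R)])%E.
  exact: product_measure1E.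
by rewrite H lebesgue_measure_set1 mule0.
Qed.

Lemma measurable_sq (a b c d : R) : measurable (sq_of a b c d : set P).
Proof. by rewrite /sq_of; apply: measurableX. Qed.

Lemma fold_quadrant f : continuous f ->
  \int[mu]_(z in Q1) f z = \int[mu]_(z in triangle) (f z + f (sw z)).
Proof.
move=> cf.
have -> : triangle = Q1 `&` [set z : R * R | 0 <= z.1 - z.2].
  apply/seteqP; split=> -[x y] /=; rewrite /triangle /Q1 /sq_of /= ?subr_ge0 !in_itv/=.
    by move=> [? ? ?]; do 2?split=> //; apply/andP; split; lra.
  by move=> [[/andP[? ?] /andP[? ?]] ?].
apply: fold_half => //.
- exact: Qsym_sw.
- exact: swK.
- exact: measurable_sq.
- by move=> [x y] [/=]; rewrite !in_itv/= => /andP[? ?] /andP[? ?]; split;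
    rewrite /= in_itv/=;
    apply/andP; split; lra.
- by apply/seteqP; split=> -[x y] [].
- by apply: measurable_ge0_set => z; apply: cvgB; [exact: cvg_fst|exact: cvg_snd].
- by apply/seteqP; split=> // -[x y] _ /=; rewrite !subr_ge0; apply/orP; exact: le_total.
- rewrite -[RHS]mu_diagonal; congr (mu _); apply/seteqP; split=> -[x y] /=;
    rewrite !subr_ge0.
    by move=> [? ?]; apply/eqP; rewrite eq_le; apply/andP.
  by move=> ->.
Qed.

Lemma fold_square f : continuous f ->
  \int[mu]_(z in Q) f z = \int[mu]_(z in Q1)
    (f z + f (rfx z) + (f (ref z) + f (opp2 z))).
Proof.
move=> cf.
pose H : set P := [set z | 0 <= z.1].
pose V : set P := [set z | 0 <= z.2].
have mH : measurable H by apply: measurable_ge0_set => z; exact: cvg_fst.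
have mV : measurable V by apply: measurable_ge0_set => z; exact: cvg_snd.
have mQ : measurable (Q : set P) := measurable_Q.
have cfr : continuous (fun z => f z + f (rfx z)).
  move=> z; apply: cvgD; first exact: cf.
  have [crfx _ _ _] := Qsym_rfx.
  by apply: (@continuous_comp _ _ _ rfx f); [exact: crfx|exact: cf].
rewrite (fold_half (S := H) Qsym_rfx rfxK) //; first last.
- rewrite (_ : _ `&` _ = [set 0] `*` setT).
    exact: mu_axis2.
  apply/seteqP; split=> -[x y] /=; last by move=> [-> _]; rewrite /H /= oppr0.
  by rewrite /H /= oppr_ge0 => -[? ?]; split=> //; apply/eqP; rewrite eq_le; apply/andP.
- apply/seteqP; split=> // -[x y] _; rewrite /H /= oppr_ge0; apply/orP; exact: le_total.
- apply/seteqP; split=> -[x y]; rewrite /Q /sq_of /= !in_itv/= => -[/andP[? ?] ->];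
    by split=> //; apply/andP; split; lra.
rewrite (fold_half (S := V) Qsym_ref refK) //; first last.
- rewrite (_ : _ `&` _ = setT `*` [set 0]).
    exact: mu_axis1.
  apply/seteqP; split=> -[x y] /=; last by move=> [_ ->]; rewrite /V /= oppr0.
  by rewrite /V /= oppr_ge0 => -[? ?]; split=> //; apply/eqP; rewrite eq_le; apply/andP.
- apply/seteqP; split=> // -[x y] _; rewrite /V /= oppr_ge0; apply/orP; exact: le_total.
- apply/seteqP; split=> -[x y]; rewrite /H /Q /sq_of /= !in_itv/= =>
    -[[-> /andP[? ?]] ->];
    by do 2?split=> //; apply/andP; split; lra.
- exact: measurableI.
congr Rintegral; apply/seteqP; split=> -[x y]; rewrite /Q /Q1 /H /V /sq_of /= !in_itv/=.
  by move=> [[[/andP[? ?] /andP[? ?]] ?] ?]; split; apply/andP; split; lra.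
by move=> [/andP[? ?] /andP[? ?]]; do 3?split=> //; apply/andP; split; lra.
Qed.

End Folding.

(** * Jacobians weighted by opposite quadrants *)
Section WeightedJacobian.
Context {R : realType}.
Local Notation P := (measurableTypeR R * measurableTypeR R)%type.
Local Notation mu := (leb2 : {measure set P -> \bar R}).
Implicit Types (p q : R * R -> R) (z : R * R).

Local Opaque pd.

Definition jac p q z : R := pd 0 p z * pd 1 q z - pd 1 p z * pd 0 q z.

(** The Dirichlet energy density of the map (p, q), whose Jacobian is [jac p q]. *)
Definition dens p q z : R :=
  pd 0 p z ^+ 2 + pd 1 p z ^+ 2 + pd 0 q z ^+ 2 + pd 1 q z ^+ 2.

(** Here pij is the derivative of p in direction i at the j-th of the points z,
    sw z, ref z, sw (ref z), and likewise for q.  The two last terms on the left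
    are the Jacobians of [gap] and [odd_sw], which will integrate to zero.  With
    them the left side is a pairing of s, t, the gradients of the sums over the
    four reflected copies of p and q, with b, c, the gradients of the parts of q
    and p that are odd under sw.  The inequality is then
    r (x0 y1 - x1 y0) <= |x|^2 + 2 |y|^2 for r^2 = 8, followed by a sum of
    squares. *)
Lemma triangle_algebra (r p01 p11 q01 q11 p02 p12 q02 q12
    p03 p13 q03 q13 p04 p14 q04 q14 : R) : r ^+ 2 = 8 ->
  r * (p01 * q11 - p11 * q01 + (p02 * q12 - p12 * q02)
    - 4^-1 * ((p01 + p12 - (p03 + p14)) * (q11 - q02)
       - (p11 + p02 - (- p13 + - p04)) * (q01 - q12))
    + 4^-1 * ((q01 + q12 - (q03 + q14)) * (p11 - p02)
       - (q11 + q02 - (- q13 + - q04)) * (p01 - p12))) <=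
  p01 ^+ 2 + p11 ^+ 2 + q01 ^+ 2 + q11 ^+ 2
  + (p02 ^+ 2 + p12 ^+ 2 + q02 ^+ 2 + q12 ^+ 2)
  + (p03 ^+ 2 + p13 ^+ 2 + q03 ^+ 2 + q13 ^+ 2)
  + (p04 ^+ 2 + p14 ^+ 2 + q04 ^+ 2 + q14 ^+ 2).
Proof.
move=> r8.
pose s0 := p01 + p12 + p03 + p14; pose s1 := p11 + p02 - p13 - p04.
pose t0 := q01 + q12 + q03 + q14; pose t1 := q11 + q02 - q13 - q04.
pose b0 := q01 - q12; pose b1 := q11 - q02.
pose c0 := p01 - p12; pose c1 := p11 - p02.
set K := (X in r * X).
have -> : K = 4^-1 * ((s0 * b1 - s1 * b0) + (c0 * t1 - c1 * t0)).
  rewrite /K /s0 /s1 /t0 /t1 /b0 /b1 /c0 /c1; by field.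
have young (x0 x1 y0 y1 : R) : r * (x0 * y1 - x1 * y0) <= x0 ^+ 2 + x1 ^+ 2 +
  2 * (y0 ^+ 2 + y1 ^+ 2).
  rewrite -subr_ge0.
  have -> : x0 ^+ 2 + x1 ^+ 2 + 2 * (y0 ^+ 2 + y1 ^+ 2) - r * (x0 * y1 - x1 * y0) =
    (x0 - r / 2 * y1) ^+ 2 + (x1 + r / 2 * y0) ^+ 2 + (2 - r ^+ 2 / 4) * (y0 ^+ 2 +
      y1 ^+ 2).
    by field.
  rewrite r8; have -> : 2 - 8 / 4 = 0 :> R by field.
  by rewrite mul0r addr0 addr_ge0 ?sqr_ge0.
have h1 := young s0 s1 b0 b1; have h2 := young t0 t1 c0 c1.
apply: (@le_trans _ _ (4^-1 * (s0 ^+ 2 + s1 ^+ 2 + 2 * (b0 ^+ 2 + b1 ^+ 2)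
   + (t0 ^+ 2 + t1 ^+ 2 + 2 * (c0 ^+ 2 + c1 ^+ 2))))).
  rewrite mulrCA ler_wpM2l ?invr_ge0 ?ler0n// mulrDr lerD//.
  have -> : c0 * t1 - c1 * t0 = - (t0 * c1 - t1 * c0) by ring.
  have := young t0 t1 (- c0) (- c1); rewrite !sqrrN; apply: le_trans.
  by rewrite le_eqVlt; apply/orP; left; apply/eqP; ring.
rewrite -subr_ge0.
set L := (X in 0 <= X).
have -> : L = 4^-1 * (((p01 + p12) - (p03 + p14)) ^+ 2 + ((p11 + p02) + (p13 + p04)) ^+ 2
  + ((q01 + q12) - (q03 + q14)) ^+ 2 + ((q11 + q02) + (q13 + q04)) ^+ 2
  + 2 * ((p03 - p14) ^+ 2 + (p13 - p04) ^+ 2 + (q03 - q14) ^+ 2 + (q13 - q04) ^+ 2)).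
  rewrite /L /s0 /s1 /t0 /t1 /b0 /b1 /c0 /c1; by field.
rewrite mulr_ge0 ?invr_ge0 ?ler0n//.
rewrite addr_ge0 ?mulr_ge0 ?ler0n//; by do ?[exact: sqr_ge0|apply: addr_ge0].
Qed.

(** The even part p + p o sw minus its reflection across the first axis: subtracting
    half of it from the even part symmetrizes the latter. *)
Definition gap p z : R := p z + p (sw z) - (p (ref z) + p (sw (ref z))).
Definition odd_sw q z : R := q z - q (sw z).

Lemma Ck_gap n p : Ck n p -> Ck n (gap p).
Proof.
move=> Cp; have C2 := Ck_sw Cp; have C3 := Ck_ref Cp; have C4 := Ck_ref C2.
exact: CkB (CkD Cp C2) (CkD C3 C4).
Qed.

Lemma Ck_odd_sw n p : Ck n p -> Ck n (odd_sw p).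
Proof. by move=> Cp; exact: CkB Cp (Ck_sw Cp). Qed.

Lemma Ck_pdD n f g (j : 'I_2) z : @Ck R n.+1 f -> Ck n.+1 g ->
  pd j (fun z => f z + g z) z = pd j f z + pd j g z.
Proof.
move=> Cf Cg; rewrite (pdD (fun z => @Ck_derivable _ _ _ j z Cf) (fun z =>
  @Ck_derivable _ _ _ j z Cg)).
by [].
Qed.

Lemma pd0_gap p z : Ck 1 p -> pd 0 (gap p) z =
  pd 0 p z + pd 1 p (sw z) - (pd 0 p (ref z) + pd 1 p (sw (ref z))).
Proof.
move=> Cp; have C2 := Ck_sw Cp; have C3 := Ck_ref Cp; have C4 := Ck_ref C2.
have -> : gap p = (fun z => (fun z => p z + (p \o sw) z) z -
   (fun z => (p \o ref) z + ((p \o sw) \o ref) z) z) by [].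
rewrite (pdB _ (CkD Cp C2) (CkD C3 C4)) (Ck_pdD _ _ Cp C2) (Ck_pdD _ _ C3 C4).
by rewrite (pd_sw0 _ Cp) (pd_ref0 _ Cp) (pd_ref0 _ C2) (pd_sw0 _ Cp).
Qed.

Lemma pd1_gap p z : Ck 1 p -> pd 1 (gap p) z =
  pd 1 p z + pd 0 p (sw z) - (- pd 1 p (ref z) + - pd 0 p (sw (ref z))).
Proof.
move=> Cp; have C2 := Ck_sw Cp; have C3 := Ck_ref Cp; have C4 := Ck_ref C2.
have -> : gap p = (fun z => (fun z => p z + (p \o sw) z) z -
   (fun z => (p \o ref) z + ((p \o sw) \o ref) z) z) by [].
rewrite (pdB _ (CkD Cp C2) (CkD C3 C4)) (Ck_pdD _ _ Cp C2) (Ck_pdD _ _ C3 C4).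
by rewrite (pd_sw1 _ Cp) (pd_ref1 _ Cp) (pd_ref1 _ C2) (pd_sw1 _ Cp).
Qed.

Lemma pd0_odd_sw q z : Ck 1 q -> pd 0 (odd_sw q) z = pd 0 q z - pd 1 q (sw z).
Proof.
move=> Cq; have -> : odd_sw q = (fun z => q z - (q \o sw) z) by [].
by rewrite (pdB _ Cq (Ck_sw Cq)) (pd_sw0 _ Cq).
Qed.

Lemma pd1_odd_sw q z : Ck 1 q -> pd 1 (odd_sw q) z = pd 1 q z - pd 0 q (sw z).
Proof.
move=> Cq; have -> : odd_sw q = (fun z => q z - (q \o sw) z) by [].
by rewrite (pdB _ Cq (Ck_sw Cq)) (pd_sw1 _ Cq).
Qed.

Definition vanishing p : Prop := forall z, ~ interior Q z -> p z = 0.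

(** [gap p] is zero on y = 0 by antisymmetry and on x = 1 because p vanishes on the
    boundary of the square; [odd_sw q] is zero on the diagonal. *)
Lemma null_gap p q : Ck 1 p -> Ck 2 q -> vanishing p ->
  \int[mu]_(z in triangle) jac (gap p) (odd_sw q) z = 0.
Proof.
move=> Cp Cq vp; apply: triangle_null_lagrangian.
- exact: Ck_gap.
- exact: Ck_odd_sw.
- by move=> x; rewrite /gap /sw /ref /= oppr0 subrr.
- move=> y; have v z : z.1 = 1 \/ z.1 = -1 \/ z.2 = 1 \/ z.2 = -1 -> p z = 0.
    move=> Hz; apply: vp; rewrite interior_Q => -[]; case: z Hz => z1 z2 /=.
    by rewrite !in_itv/= => Hz /andP[? ?] /andP[? ?]; case: Hz => [|[|[|]]] E; lra.
  by rewrite /gap !v /= ?addr0 ?subr0; do ?[by left|by right; left|by right; right; left].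
- move=> x; rewrite (pd0_odd_sw _ (CkS Cq)) (pd1_odd_sw _ (CkS Cq)) /sw /=.
  by rewrite subrKA subrr.
Qed.

Lemma continuous_jac p q : Ck 1 p -> Ck 1 q -> continuous (jac p q).
Proof.
move=> Cp Cq.
have H : Ck 0 (fun z => pd 0 p z * pd 1 q z - pd 1 p z * pd 0 q z).
  exact: CkB (CkM (Ck_pd 0 Cp) (Ck_pd 1 Cq)) (CkM (Ck_pd 1 Cp) (Ck_pd 0 Cq)).
exact: H.
Qed.

Lemma continuous_dens p q : Ck 1 p -> Ck 1 q -> continuous (dens p q).
Proof.
move=> Cp Cq.
have S f : Ck 0 f -> Ck 0 (fun z => f z ^+ 2) by move=> Cf; exact: (CkM Cf Cf).
have H : Ck 0 (fun z => pd 0 p z ^+ 2 + pd 1 p z ^+ 2 + pd 0 q z ^+ 2 + pd 1 q z ^+ 2).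
  exact: CkD (CkD (CkD (S _ (Ck_pd 0 Cp)) (S _ (Ck_pd 1 Cp))) (S _ (Ck_pd 0 Cq)))
    (S _ (Ck_pd 1 Cq)).
exact: H.
Qed.

(** The two null Jacobians may be added to the left integrand, after which the
    inequality holds pointwise by [triangle_algebra]. *)
Lemma triangle_jac_le p q (r : R) : 0 <= r -> r ^+ 2 = 8 -> Ck 2 p -> Ck 2 q ->
  vanishing p -> vanishing q ->
  r * \int[mu]_(z in triangle) (jac p q z + jac p q (sw z)) <=
  \int[mu]_(z in triangle) (dens p q z + dens p q (sw z) +
     dens p q (ref z) + dens p q (sw (ref z))).
Proof.
move=> r0 r8 Cp Cq vp vq.
have mT : measurable (triangle : set P) := measurable_triangle.
have itg (f : R * R -> R) : continuous f -> mu.-integrable triangle (EFin \o f).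
  by move=> cf; exact: (continuous_integrable mT (@triangle_Q R) cf).
have [Cp1 Cq1] := (CkS Cp, CkS Cq).
have cJ := continuous_jac Cp1 Cq1; have cE := continuous_dens Cp1 Cq1.
pose N1 := jac (gap p) (odd_sw q).
pose N2 := jac (gap q) (odd_sw p).
have cN1 : continuous N1 := continuous_jac (Ck_gap Cp1) (Ck_odd_sw Cq1).
have cN2 : continuous N2 := continuous_jac (Ck_gap Cq1) (Ck_odd_sw Cp1).
have cJs : continuous (fun z => jac p q (sw z)).
  by move=> z; apply: (@continuous_comp _ _ _ sw (jac p q));
    [exact: continuous_sw|exact: cJ].
have ccomp (f : R * R -> R) (T : R * R -> R * R) : continuous T -> continuous f ->
  continuous (fun z => f (T z)).
  by move=> cT cf z; apply: (@continuous_comp _ _ _ T f); [exact: cT|exact: cf].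
have cJJ : continuous (fun z => jac p q z + jac p q (sw z)).
  by move=> z; apply: cvgD; [exact: cJ|exact: cJs].
pose K z := jac p q z + jac p q (sw z) - 4^-1 * N1 z + 4^-1 * N2 z.
have cZ (f : R * R -> R) : continuous f -> continuous (fun z => 4^-1 * f z).
  by move=> cf z; apply: cvgM; [exact: cvg_cst|exact: cf].
have cJN : continuous (fun z => jac p q z + jac p q (sw z) - 4^-1 * N1 z).
  by move=> z; apply: cvgB; [exact: cJJ|exact: cZ].
have cK : continuous K.
  by move=> z; apply: cvgD; [exact: cJN|exact: cZ].
have -> : \int[mu]_(z in triangle) (jac p q z + jac p q (sw z)) =
    \int[mu]_(z in triangle) K z.
  rewrite [RHS]RintegralD ?[X in X + _]RintegralB //; try by apply: itg => //; exact: cZ.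
  rewrite !RintegralZl //; try exact: itg.
  by rewrite (null_gap Cp1 Cq vp) (null_gap Cq1 Cp vq) !mulr0 subr0 addr0.
rewrite -RintegralZl //; last exact: itg.
apply: le_Rintegral => //.
- by apply: itg => z; apply: cvgM; [exact: cvg_cst|exact: cK].
- have cs : continuous (@sw R) := @continuous_sw R;
    have cr : continuous (@ref R) := @continuous_ref R.
  have csr : continuous (fun z => sw (ref z)).
    by move=> z; apply: (@continuous_comp _ _ _ ref sw); [exact: cr|exact: cs].
  have c2 := ccomp (dens p q) sw cs cE.
  have c3 := ccomp (dens p q) ref cr cE.
  have c4 := ccomp (dens p q) (fun z => sw (ref z)) csr cE.
  apply: itg.
  exact: (@CkD R 0 _ _ (@CkD R 0 _ _ (@CkD R 0 (dens p q) _ cE c2) c3) c4).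
move=> z _; rewrite /K /N1 /N2 /jac /dens !(pd0_gap _ Cp1) !(pd1_gap _ Cp1)
  !(pd0_gap _ Cq1) !(pd1_gap _ Cq1) !(pd0_odd_sw _ Cp1) !(pd1_odd_sw _ Cp1)
  !(pd0_odd_sw _ Cq1) !(pd1_odd_sw _ Cq1).
exact: triangle_algebra.
Qed.

Lemma Ck_rfx n p : Ck n p -> Ck n (p \o rfx).
Proof. by move=> Cp; exact: (Ck_sw (Ck_ref (Ck_sw Cp))). Qed.

Lemma Ck_opp2 n p : Ck n p -> Ck n (p \o opp2).
Proof. by move=> Cp; exact: (Ck_ref (Ck_rfx Cp)). Qed.

Lemma pd0_opp2 p z : Ck 1 p -> pd 0 (p \o opp2) z = - pd 0 p (opp2 z).
Proof.
move=> Cp; have C2 := Ck_sw Cp; have C3 := Ck_ref C2; have C4 := Ck_sw C3.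
have -> : p \o opp2 = (((p \o sw) \o ref) \o sw) \o ref by [].
by rewrite (pd_ref0 _ C4) (pd_sw0 _ C3) (pd_ref1 _ C2) (pd_sw1 _ Cp).
Qed.

Lemma pd1_opp2 p z : Ck 1 p -> pd 1 (p \o opp2) z = - pd 1 p (opp2 z).
Proof.
move=> Cp; have C2 := Ck_sw Cp; have C3 := Ck_ref C2; have C4 := Ck_sw C3.
have -> : p \o opp2 = (((p \o sw) \o ref) \o sw) \o ref by [].
by rewrite (pd_ref1 _ C4) (pd_sw1 _ C3) (pd_ref0 _ C2) (pd_sw0 _ Cp).
Qed.

Lemma vanishing_opp2 p : vanishing p -> vanishing (p \o opp2).
Proof.
move=> vp z Hz; apply: vp; move: Hz; rewrite interior_Q; case: z => x y /= Hz [h1 h2].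
apply: Hz; move: h1 h2; rewrite /= !in_itv/= => /andP[? ?] /andP[? ?].
by split; apply/andP; split; lra.
Qed.

Lemma jac_opp2 p q z : Ck 1 p -> Ck 1 q ->
  jac (p \o opp2) (q \o opp2) z = jac p q (opp2 z).
Proof. by move=> Cp Cq; rewrite /jac (pd0_opp2 _ Cp) (pd0_opp2 _ Cq) (pd1_opp2 _ Cp)
  (pd1_opp2 _ Cq) !mulrNN. Qed.

Lemma dens_opp2 p q z : Ck 1 p -> Ck 1 q ->
  dens (p \o opp2) (q \o opp2) z = dens p q (opp2 z).
Proof. by move=> Cp Cq; rewrite /dens (pd0_opp2 _ Cp) (pd0_opp2 _ Cq) (pd1_opp2 _ Cp)
  (pd1_opp2 _ Cq) !sqrrN. Qed.

Lemma jacC p q z : jac q p z = - jac p q z.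
Proof. by rewrite /jac opprB mulrC [in X in _ - X]mulrC. Qed.

Lemma densC p q z : dens q p z = dens p q z.
Proof.
rewrite /dens; move: (pd 0 p z) (pd 1 p z) (pd 0 q z) (pd 1 q z) => a b c d.
by clear; ring.
Qed.

Lemma continuous_Qsym (f : R * R -> R) T : Qsym T -> continuous f -> continuous (f \o T).
Proof.
move=> [cT _ _ _] cf z.
by apply: (@continuous_comp _ _ _ T f); [exact: cT|exact: cf].
Qed.

(** The eight images of the triangle tile the square.  Four of them are governed by
    [triangle_jac_le] for (p, q) and the other four, reached through -id, by the
    same lemma for (q, p): exchanging the components changes the sign of the
    Jacobian, which is the sign wanted on Q3. *)
Lemma quadrant_jac_le p q (r : R) : 0 <= r -> r ^+ 2 = 8 -> Ck 2 p -> Ck 2 q ->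
  vanishing p -> vanishing q ->
  r * (\int[mu]_(z in Q1) jac p q z - \int[mu]_(z in Q3) jac p q z) <=
  \int[mu]_(z in Q) dens p q z.
Proof.
move=> r0 r8 Cp Cq vp vq.
have mT : measurable (triangle : set P) := measurable_triangle.
have [Cp1 Cq1] := (CkS Cp, CkS Cq).
have cJ := continuous_jac Cp1 Cq1; have cE := continuous_dens Cp1 Cq1.
have cJo := continuous_Qsym Qsym_opp2 cJ.
have cEo (T : R * R -> R * R) : Qsym T -> continuous (fun z => dens p q (T z)).
  by move=> sT; exact: continuous_Qsym sT cE.
have Q3E : \int[mu]_(z in Q3) jac p q z = \int[mu]_(z in Q1) jac p q (opp2 z).
  rewrite (Rintegral_Qsym Qsym_opp2 _ _ cJ); last 2 first.
  - exact: measurable_sq.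
  - by move=> [x y] [/=]; rewrite !in_itv/= => /andP[? ?] /andP[? ?]; split;
      rewrite /= in_itv/=; apply/andP; split; lra.
  congr (Rintegral _ _ _); apply/seteqP; split=> -[x y];
    rewrite /Q1 /Q3 /sq_of /opp2 /= !in_itv/= => -[/andP[? ?] /andP[? ?]];
    by split; apply/andP; split; lra.
have T1 := triangle_jac_le r0 r8 Cp Cq vp vq.
have T2 := triangle_jac_le r0 r8 (Ck_opp2 Cq) (Ck_opp2 Cp) (vanishing_opp2 vq)
  (vanishing_opp2 vp).
rewrite Q3E (fold_quadrant cJ) (fold_quadrant cJo).
have itg (f : R * R -> R) : continuous f -> mu.-integrable triangle (EFin \o f).
  by move=> cf; exact: (continuous_integrable mT (@triangle_Q R) cf).
have cD (f g : R * R -> R) : continuous f -> continuous g -> continuous (fun z =>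
  f z + g z).
  by move=> cf cg; exact: (@CkD R 0 f g cf cg).
have cE1 : continuous (fun z => dens p q z + dens p q (rfx z)).
  exact: (cD _ _ cE (cEo _ Qsym_rfx)).
have cE2 : continuous (fun z => dens p q (ref z) + dens p q (opp2 z)).
  exact: (cD _ _ (cEo _ Qsym_ref) (cEo _ Qsym_opp2)).
rewrite (fold_square cE) (fold_quadrant (cD _ _ cE1 cE2)).
set J1 := (X in r * (X - _)); set J3 := (X in r * (_ - X)).
have {}T2 : r * - J3 <= \int[mu]_(z in triangle)
  (dens p q (opp2 z) + dens p q (opp2 (sw z)) +
     dens p q (opp2 (ref z)) + dens p q (opp2 (sw (ref z)))).
  have -> : - J3 = \int[mu]_(z in triangle) (jac (q \o opp2) (p \o opp2) z +
      jac (q \o opp2) (p \o opp2) (sw z)).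
    have cJos : continuous (fun z => jac p q (opp2 z) + jac p q (opp2 (sw z))).
      exact: (cD _ _ cJo (continuous_Qsym Qsym_sw cJo)).
    rewrite -mulN1r -(RintegralZl (-1) mT (itg _ cJos)).
    apply: eq_Rintegral => z _; rewrite mulN1r opprD.
    by rewrite !(jac_opp2 _ Cq1 Cp1) !(jacC p q).
  apply: le_trans T2 _; rewrite le_eqVlt; apply/orP; left; apply/eqP.
  by apply: eq_Rintegral => z _; rewrite !(dens_opp2 _ Cq1 Cp1) !(densC p q).
rewrite mulrDr; apply: le_trans (lerD T1 T2) _.
have c1 : continuous (fun z => dens p q z + dens p q (sw z) +
     dens p q (ref z) + dens p q (sw (ref z))).
  exact: (cD _ _ (cD _ _ (cD _ _ cE (cEo _ Qsym_sw)) (cEo _ Qsym_ref))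
    (cEo _ (Qsym_comp Qsym_sw Qsym_ref))).
have c2 : continuous (fun z => dens p q (opp2 z) + dens p q (opp2 (sw z)) +
     dens p q (opp2 (ref z)) + dens p q (opp2 (sw (ref z)))).
  exact: (cD _ _ (cD _ _ (cD _ _ (cEo _ Qsym_opp2) (cEo _ (Qsym_comp Qsym_opp2 Qsym_sw)))
    (cEo _ (Qsym_comp Qsym_opp2 Qsym_ref)))
    (cEo _ (Qsym_comp Qsym_opp2 (Qsym_comp Qsym_sw Qsym_ref)))).
rewrite -(RintegralD mT (itg _ c1) (itg _ c2)).
rewrite le_eqVlt; apply/orP; left; apply/eqP.
apply: eq_Rintegral => -[x y] _.
rewrite /sw /ref /rfx /opp2 /= !opprK.
move: (dens p q) => e; clear.
move: (e _) (e (y, x)) (e (x, - y)) (e (- y, x)) (e (- x, - y)) (e (- y, - x)) (e (- x,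
  y)) (e (y, - x)).
by move=> *; ring.
Qed.

End WeightedJacobian.

(** * Hadamard's inequality in the mean *)
Section MeanHadamard.
Context {R : realType}.
Local Notation P := (measurableTypeR R * measurableTypeR R)%type.
Local Notation mu := (leb2 : {measure set P -> \bar R}).
Implicit Types (p q : R * R -> R) (z : R * R).

Local Opaque pd.

Lemma f_coef_measurable (s t : R) : measurable_fun (Q : set P) (f_coef s t).
Proof.
have mk (k a b c d : R) : measurable_fun (Q : set P) (fun z =>
  k * \1_(sq_of a b c d) z : R).
  apply: measurable_funM; first exact: measurable_cst.
  by apply: measurable_indic; exact: measurable_sq.
apply: measurable_funD (mk _ _ _ _ _).
apply: measurable_funD (mk _ _ _ _ _).
exact: measurable_funB (mk _ _ _ _ _) (mk _ _ _ _ _).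
Qed.

Lemma f_coef_bounded (s t : R) z :
  `|f_coef s t z| <= `|s| + `|t + s| + `|t - s| + `|s|.
Proof.
have H (k : R) (A : set (R * R)) : `|k * \1_A z| <= `|k|.
  have /andP[i0 i1] := indic01 A z.
  by rewrite normrM (ger0_norm i0) ler_piMr.
rewrite /f_coef; apply: le_trans (ler_normD _ _) _; apply: lerD => //.
apply: le_trans (ler_normD _ _) _; apply: lerD => //.
by apply: le_trans (ler_normB _ _) _; apply: lerD.
Qed.

(** The indicators are those of closed quadrants, which overlap on the axes; the
    bound survives there because neighbouring quadrants carry opposite signs. *)
Lemma checkerboard z : Q z ->
  `|\1_Q2 z - \1_Q1 z - \1_Q3 z + \1_Q4 z : R| <= 1.
Proof.
case: z => x y [/=]; rewrite !in_itv/= => /andP[x1 x2] /andP[y1 y2].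
have I (a b c d : R) : \1_(sq_of a b c d) (x, y) =
    ((a <= x <= b) && (c <= y <= d))%:R :> R.
  by rewrite indicE in_setX !mem_setE !in_itv.
rewrite /Q1 /Q2 /Q3 /Q4 !I x1 x2 y1 y2 !andbT /=.
have [x0|x0|x0] := ltgtP x 0; have [y0|y0|y0] := ltgtP y 0;
  by rewrite /= ?lexx ler_norml; apply/andP; split; lra.
Qed.

Lemma jac_dens p q z : `|jac p q z| <= dens p q z / 2.
Proof.
rewrite /jac /dens; move: (pd 0 p z) (pd 1 p z) (pd 0 q z) (pd 1 q z) => a b c d.
rewrite ler_norml; apply/andP; split.
  by have := sqr_ge0 (a + d); have := sqr_ge0 (b - c); rewrite !expr2; lra.
by have := sqr_ge0 (a - d); have := sqr_ge0 (b + c); rewrite !expr2; lra.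
Qed.

(** The coefficient of sigma in f is the checkerboard, and the Jacobian is at most
    half the energy density. *)
Lemma hadamard_pointwise (s t : R) p q z : Q z ->
  (1 - `|s| / 2) * dens p q z +
    (- t * (\1_Q1 z * jac p q z) + t * (\1_Q3 z * jac p q z)) <=
  dens p q z + f_coef s t z * jac p q z.
Proof.
move=> Qz; have := jac_dens p q z; rewrite /f_coef.
have := checkerboard Qz.
move: (dens p q z) (jac p q z) (\1_Q1 z : R) (\1_Q2 z : R) (\1_Q3 z : R) (\1_Q4 z : R).
clear => e j x1 x2 x3 x4 c1 je; rewrite -subr_ge0.
set k := x2 - x1 - x3 + x4 in c1.
have -> : e + (s * x2 - (t + s) * x1 + (t - s) * x3 + s * x4) * j
   - ((1 - `|s| / 2) * e + (- t * (x1 * j) + t * (x3 * j))) =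
    `|s| * (e / 2) + s * (k * j) by rewrite /k; ring.
have H := ler_norm (- (s * (k * j))); rewrite normrN 2!normrM in H.
have : `|s| * (`|k| * `|j|) <= `|s| * (e / 2).
  by rewrite ler_wpM2l// -[leRHS]mul1r ler_pM.
by lra.
Qed.

Lemma test_fun_vanishing p : test_fun p -> vanishing p.
Proof.
move=> [_ _ sp] z nz; have [//|pz] := eqVneq (p z) 0; exfalso.
by apply: nz; apply: sp; exact: subset_closure.
Qed.

Lemma Q1_sub_Q : Q1 `<=` (Q : set (R * R)).
Proof.
by move=> [x y] [/=]; rewrite !in_itv/= => /andP[? ?] /andP[? ?]; split;
  rewrite /= in_itv/=; apply/andP; split; lra.
Qed.

Lemma Q3_sub_Q : Q3 `<=` (Q : set (R * R)).
Proof.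
by move=> [x y] [/=]; rewrite !in_itv/= => /andP[? ?] /andP[? ?]; split;
  rewrite /= in_itv/=; apply/andP; split; lra.
Qed.

(** [hadamard_pointwise] leaves (1 - |s| / 2) E - t (D1 - D3), with E the energy and
    D1, D3 the integrals of the Jacobian over Q1 and Q3.  Since
    |D1 - D3| <= E / sqrt 8, this is at least (1 - y) E. *)
Lemma hadamard_mean (s t : R) p q : y_fun s t < 1 -> test_fun p -> test_fun q ->
  0 <= \int[mu]_(z in Q) (dens p q z + f_coef s t z * jac p q z).
Proof.
move=> y1 tp tq.
have [vp vq] := (test_fun_vanishing tp, test_fun_vanishing tq).
have [sp _ _] := tp; have [sq _ _] := tq.
have Cp : Ck 2 p := sp 2%N; have Cq : Ck 2 q := sq 2%N; clear sp sq tp tq.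
have [Cp1 Cq1] := (CkS Cp, CkS Cq).
have cJ := continuous_jac Cp1 Cq1; have cE := continuous_dens Cp1 Cq1.
have mQ : measurable (Q : set P) := measurable_Q.
have iE := continuous_integrable mQ (fun z h => h) cE.
have iJ := continuous_integrable mQ (fun z h => h) cJ.
pose r : R := Num.sqrt 8.
have r0 : 0 < r by rewrite sqrtr_gt0.
have r8 : r ^+ 2 = 8 by rewrite sqr_sqrtr.
have k0 : 0 <= 1 - `|s| / 2 - `|t| / r.
  by move: y1; rewrite /y_fun -/r; move: (`|t| / r) => k; clear; lra.
have H1 := quadrant_jac_le (ltW r0) r8 Cp Cq vp vq.
(* Exchanging the components gives the bound from the other side. *)
have H2 := quadrant_jac_le (ltW r0) r8 Cq Cp vq vp.
have mS a b c d : measurable (sq_of a b c d : set P) := measurable_sq a b c d.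
have [Q1Q Q3Q] := (@Q1_sub_Q, @Q3_sub_Q).
set E := \int[mu]_(z in Q) dens p q z in H1 *.
have EE : \int[mu]_(z in Q) dens q p z = E.
  by apply: eq_Rintegral => z _; rewrite densC.
set D1 := \int[mu]_(z in Q1) jac p q z in H1.
set D3 := \int[mu]_(z in Q3) jac p q z in H1.
have neg (A : set P) : measurable A -> A `<=` Q ->
    \int[mu]_(z in A) jac q p z = - \int[mu]_(z in A) jac p q z.
  move=> mA AQ; rewrite -mulN1r -(RintegralZl _ mA (continuous_integrable mA AQ cJ)).
  by apply: eq_Rintegral => z _; rewrite mulN1r jacC.
rewrite EE (neg _ (mS _ _ _ _) Q1Q) (neg _ (mS _ _ _ _) Q3Q) in H2.
have i1 := itg_indic (mS 0 1 0 1) iJ; have i3 := itg_indic (mS (-1) 0 (-1) 0) iJ.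
have iD := itgZ (1 - `|s| / 2) iE.
have iA := itgZ (- t) i1; have iB := itgZ t i3.
have iAB := itgD iA iB; have iLow := itgD iD iAB.
have iHigh := itgD iE (itg_bounded_mul (@f_coef_measurable s t)
  (fun z _ => f_coef_bounded s t z) iJ).
apply: le_trans (le_Rintegral mQ iLow iHigh (@hadamard_pointwise s t p q)).
rewrite (RintegralD mQ iD iAB) (RintegralD mQ iA iB) (RintegralZl _ mQ iE).
rewrite (RintegralZl _ mQ i1) (RintegralZl _ mQ i3).
rewrite (Rintegral_indic _ Q1Q) (Rintegral_indic _ Q3Q) -/E -/D1 -/D3.
have E0 : 0 <= E.
  apply: Rintegral_ge0 => z _; rewrite /dens.
  by move: (pd 0 p z) (pd 1 p z) (pd 0 q z) (pd 1 q z) => a b c d;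
    rewrite !addr_ge0 ?sqr_ge0.
have HD : `|D1 - D3| <= E / r.
  rewrite (ler_pdivlMr _ _ r0) mulrC -[r in r * _](gtr0_norm r0) -normrM ler_norml.
  apply/andP; split; last exact: H1.
  by rewrite lerNl -mulrN opprB addrC; apply: le_trans H2; rewrite opprK.
have HT : `|t * (D1 - D3)| <= `|t| / r * E.
  by rewrite normrM -mulrA [r^-1 * E]mulrC ler_wpM2l.
have := ler_norm (t * (D1 - D3)); have := mulr_ge0 k0 E0.
move: HT; move: (`|_ * (D1 - _)|) => k; move: (`|t| / r) (`|s| / 2) => k1 k2; clear; nra.
Qed.

End MeanHadamard.

(** * A Poincare inequality near the vertical sides *)
Section Strip.
Context {R : realType}.
Local Notation P := (measurableTypeR R * measurableTypeR R)%type.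
Local Notation mu := (leb2 : {measure set P -> \bar R}).
Implicit Types (g w : R * R -> R) (z : R * R).

Local Opaque pd.

Lemma rect_sub_Q (a b c d : R) : -1 <= a -> b <= 1 -> -1 <= c -> d <= 1 ->
  sq_of a b c d `<=` Q.
Proof.
move=> *; move=> [x y] [/=]; rewrite !in_itv/= => /andP[? ?] /andP[? ?].
by split; rewrite /= in_itv/=; apply/andP; split; lra.
Qed.

Lemma rect_pd0 (a b : R) g : Ck 1 g -> -1 <= a -> a <= b -> b <= 1 ->
  \int[mu]_(z in sq_of a b (-1) 1) pd 0 g z =
  \int[leb]_(y in `[-1, 1]) (g (b, y) - g (a, y)).
Proof.
move=> C1 a1 ab b1; have cf := Ck_pd 0 C1.
rewrite [RHS]Rintegral_mkcond.
apply: Rfubini2; first exact: measurable_sq.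
  apply: (continuous_integrable _ _ cf); first exact: measurable_sq.
  exact: rect_sub_Q.
move=> y; rewrite patchE; case: ifPn => [|] yI.
  move: yI; rewrite inE /= => yI.
  have -> : [set x | sq_of a b (-1) 1 (x, y)] = `[a, b]%classic.
    by apply/seteqP; split=> x /=; [case|].
  apply: (@FTC _ (fun x => g (x, y)) (fun x => pd 0 g (x, y)) _ _ ab).
    by move=> x; exact: is_derive_slice0 (@Ck_derivable _ _ _ 0 (x, y) C1).
  exact: continuous_slice0.
have -> : [set x | sq_of a b (-1) 1 (x, y)] = set0.
  by apply/seteqP; split=> // x [/= _ yy]; move: yI; rewrite notin_setE.
by rewrite integral_set0.
Qed.

Lemma continuous_itv_integrable (f : R -> R) (a b : R) : continuous f ->
  leb.-integrable `[a, b] (EFin \o f).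
Proof.
move=> cf; apply: continuous_compact_integrable; first exact: segment_compact.
exact: continuous_subspaceT.
Qed.

(** Integrate d/dx ((x - c) g^2) = g^2 + 2 (x - c) g d_x g over the strip and absorb
    the cross term.  Taking c to be the abscissa of one edge removes that edge
    from the boundary terms. *)
Lemma strip_poincare_aux (a b c : R) g : Ck 1 g ->
  -1 <= a -> a <= c -> c <= b -> b <= 1 ->
  \int[mu]_(z in sq_of a b (-1) 1) g z ^+ 2 <=
  2 * (\int[leb]_(y in `[-1, 1]) ((b - c) * g (b, y) ^+ 2 - (a - c) * g (a, y) ^+ 2)) +
  4 * (b - a) ^+ 2 * \int[mu]_(z in sq_of a b (-1) 1) pd 0 g z ^+ 2.
Proof.
move=> C1 a1 ac cb b1.
have ab : a <= b := le_trans ac cb.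
have mS : measurable (sq_of a b (-1) 1 : set P) := measurable_sq _ _ _ _.
have SQ := rect_sub_Q a1 b1 (lexx (-1)) (lexx 1).
have itg (f : R * R -> R) : continuous f -> mu.-integrable (sq_of a b (-1) 1) (EFin \o f).
  by move=> cf; exact: (continuous_integrable mS SQ cf).
pose G z := (z.1 - c) * g z ^+ 2.
have Caff : Ck 1 ((fun x : R => 1 * x + (- c)) \o fst : R * R -> R).
  by apply: Ck_fst; exact: Ck1_affine.
have Cg2 : Ck 1 (fun z => g z ^+ 2) := CkM C1 C1.
have EG : G = (fun z => ((fun x : R => 1 * x + (- c)) \o fst) z * g z ^+ 2).
  by apply/funext => z; rewrite /G /= mul1r.
have CG : Ck 1 G by rewrite EG; exact: CkM Caff Cg2.
have pG z : pd 0 G z = g z ^+ 2 + (z.1 - c) * (2 * (g z * pd 0 g z)).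
  rewrite EG (pdM (fun x => @Ck_derivable _ _ _ 0 x Caff) (fun x =>
    @Ck_derivable _ _ _ 0 x Cg2)).
  have -> : pd 0 ((fun x : R => 1 * x + (- c)) \o fst) z = 1.
    rewrite pd0_fst /= derive1E.
    have H := is_deriveD (is_deriveM (is_derive_cst (1:R) z.1 1)
      (is_derive_id z.1 1)) (is_derive_cst (- c) z.1 1).
    by have [_ ->] := H; rewrite /GRing.scale/= mulr1 mulr0 !addr0.
  have -> : pd 0 (fun z => g z ^+ 2) z = 2 * (g z * pd 0 g z).
    have := pdM (fun x => @Ck_derivable _ _ _ 0 x C1) (fun x =>
      @Ck_derivable _ _ _ 0 x C1).
    by move=> /(congr1 (fun f => f z)) ->; rewrite mulr2n mulrDl !mul1r.
  by rewrite /= mul1r mulr1 addrC.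
have cg2 : continuous (fun z => g z ^+ 2) := Ck_continuous Cg2.
have cp2 : continuous (fun z => pd 0 g z ^+ 2).
  have H : Ck 0 (fun z => pd 0 g z * pd 0 g z) := CkM (Ck_pd 0 C1) (Ck_pd 0 C1).
  exact: H.
have cG : continuous (pd 0 G) := Ck_continuous (Ck_pd 0 CG).
have E := rect_pd0 CG a1 ab b1.
have -> : \int[leb]_(y in `[-1, 1]) ((b - c) * g (b, y) ^+ 2 - (a - c) * g (a, y) ^+ 2) =
    \int[mu]_(z in sq_of a b (-1) 1) pd 0 G z by rewrite E.
have i1 := itg _ cg2; have i2 := itg _ cp2; have i3 := itg _ cG.
clear E CG cG EG Cg2 Caff cp2 cg2 itg.
rewrite -(RintegralZl 2 mS i3) -(RintegralZl (4 * (b - a) ^+ 2) mS i2).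
have iZ (k : R) (f : R * R -> R) : mu.-integrable (sq_of a b (-1) 1) (EFin \o f) ->
    mu.-integrable (sq_of a b (-1) 1) (EFin \o (fun z => k * f z)).
  by move=> fi; apply: eq_integrable (integrableZl mS k fi).
rewrite -(RintegralD mS (iZ _ _ i3) (iZ _ _ i2)).
apply: (le_Rintegral mS i1).
  by apply: eq_integrable (integrableD mS (iZ _ _ i3) (iZ _ _ i2)).
move=> z [/= zx _]; rewrite pG; move: zx; rewrite in_itv/= => /andP[za zb].
have : (z.1 - c) ^+ 2 <= (b - a) ^+ 2.
  rewrite -(real_normK (num_real (z.1 - c))) lerXn2r ?nnegrE ?subr_ge0//.
  by rewrite ler_norml; apply/andP; split; lra.
move: (z.1 - c) (b - a) (g z) (pd 0 g z) => x h u v; clear => xh.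
have v2 := sqr_ge0 v.
have H1 := sqr_ge0 (u + 2 * (x * v)).
have : x ^+ 2 * v ^+ 2 <= h ^+ 2 * v ^+ 2 by rewrite ler_wpM2r.
rewrite -subr_ge0 => H2; rewrite -subr_ge0.
have -> : 2 * (u ^+ 2 + x * (2 * (u * v))) + 4 * h ^+ 2 * v ^+ 2 - u ^+ 2 =
  (u + 2 * (x * v)) ^+ 2 + 4 * (h ^+ 2 * v ^+ 2 - x ^+ 2 * v ^+ 2) by ring.
by apply: addr_ge0; [exact: sqr_ge0|apply: mulr_ge0 H2; exact: ler0n].
Qed.

Definition xstrip (l : R) : set (R * R) :=
  sq_of (1 - 2 * l) 1 (-1) 1 `|` sq_of (-1) (-1 + 2 * l) (-1) 1.

Lemma xstrip_sub_Q l : 0 < l -> l < 2^-1 -> xstrip l `<=` Q.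
Proof. by move=> l0 l1; rewrite /xstrip subUset; split; apply: rect_sub_Q; lra. Qed.

Lemma measurable_xstrip l : measurable (xstrip l : set P).
Proof. by apply: measurableU; exact: measurable_sq. Qed.

Lemma Rintegral_xstrip l (f : R * R -> R) : 0 < l -> l < 2^-1 -> continuous f ->
  \int[mu]_(z in xstrip l) f z =
  \int[mu]_(z in sq_of (1 - 2 * l) 1 (-1) 1) f z +
  \int[mu]_(z in sq_of (-1) (-1 + 2 * l) (-1) 1) f z.
Proof.
move=> l0 l1 cf; apply: Rintegral_setU.
- exact: measurable_sq.
- exact: measurable_sq.
- apply: continuous_integrable cf; first exact: measurable_xstrip.
  exact: xstrip_sub_Q.
- apply/disj_set2P/seteqP; split=> // -[x y] [[/= h1 _] [/= h2 _]].
  by move: h1 h2; rewrite !in_itv/= => /andP[? ?] /andP[? ?]; lra.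
Qed.

(** In each strip c is the inner edge, so that only the boundary values of g on the
    sides of the square remain. *)
Lemma xstrip_poincare l g : Ck 1 g -> 0 < l -> l < 2^-1 ->
  \int[mu]_(z in xstrip l) g z ^+ 2 <=
  4 * l * \int[leb]_(y in `[-1, 1]) (g (1, y) ^+ 2 + g (-1, y) ^+ 2) +
  16 * l ^+ 2 * \int[mu]_(z in xstrip l) pd 0 g z ^+ 2.
Proof.
move=> C1 l0 l1.
have cg2 : continuous (fun z => g z ^+ 2) := Ck_continuous (CkM C1 C1).
have cp2 : continuous (fun z => pd 0 g z ^+ 2).
  have H : Ck 0 (fun z => pd 0 g z * pd 0 g z) := CkM (Ck_pd 0 C1) (Ck_pd 0 C1).
  exact: H.
rewrite (Rintegral_xstrip l0 l1 cg2) (Rintegral_xstrip l0 l1 cp2).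
have h1 : -1 <= 1 - 2 * l by clear -l1; lra.
have h2 : 1 - 2 * l <= 1 by clear -l0; lra.
have h3 : -1 <= -1 + 2 * l by clear -l0; lra.
have h4 : -1 + 2 * l <= 1 by clear -l1; lra.
have H1 := strip_poincare_aux C1 h1 (lexx _) h2 (lexx 1).
have H2 := strip_poincare_aux C1 (lexx (-1)) h3 (lexx _) h4.
have cs (t : R) : continuous (fun y => g (t, y) ^+ 2).
  by have H := @continuous_slice1 R (fun z => g z ^+ 2) t cg2 ; move=> y; exact: (H y).
have is1 := continuous_itv_integrable (-1) 1 (cs 1).
have is2 := continuous_itv_integrable (-1) 1 (cs (-1)).
have mI : measurable (`[-1, 1]%classic : set
  (measurableTypeR R)) by exact: measurable_itv.
have E1 : \int[leb]_(y in `[-1, 1]) ((1 - (1 - 2 * l)) * g (1, y) ^+ 2 -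
     (1 - 2 * l - (1 - 2 * l)) * g (1 - 2 * l, y) ^+ 2) =
   2 * l * \int[leb]_(y in `[-1, 1]) g (1, y) ^+ 2.
  rewrite -(RintegralZl (2 * l) mI is1).
  apply: eq_Rintegral => y _; move: (g _) (g _) => u v; clear; ring.
have E2 : \int[leb]_(y in `[-1, 1]) ((-1 + 2 * l - (-1 + 2 * l)) * g (-1 + 2 * l,
  y) ^+ 2 -
     (-1 - (-1 + 2 * l)) * g (-1, y) ^+ 2) =
   2 * l * \int[leb]_(y in `[-1, 1]) g (-1, y) ^+ 2.
  rewrite -(RintegralZl (2 * l) mI is2).
  apply: eq_Rintegral => y _; move: (g _) (g _) => u v; clear; ring.
rewrite E1 in H1; rewrite E2 in H2.
rewrite (RintegralD mI is1 is2).
move: H1 H2.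
move: (\int[mu]_(z in _) g z ^+ 2) (\int[mu]_(z in _) g z ^+ 2).
move: (\int[mu]_(z in _) pd 0 g z ^+ 2) (\int[mu]_(z in _) pd 0 g z ^+ 2).
move: (\int[leb]_(y in _) g (1, y) ^+ 2) (\int[leb]_(y in _) g (-1, y) ^+ 2).
clear => b1 b2 e1 e2 s1 s2.
have -> : 4 * (1 - (1 - 2 * l)) ^+ 2 = 16 * l ^+ 2 by ring.
have -> : 4 * (-1 + 2 * l - -1) ^+ 2 = 16 * l ^+ 2 by ring.
by move: (l ^+ 2) => m; lra.
Qed.

End Strip.

(** * Density of test functions among functions of zero trace *)
Section Density.
Context {R : realType}.
Local Notation P := (measurableTypeR R * measurableTypeR R)%type.
Local Notation mu := (leb2 : {measure set P -> \bar R}).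
Implicit Types (g w d : R * R -> R) (z : R * R) (j : 'I_2).

Local Opaque pd.

Let mQ : measurable (Q : set P) := measurable_Q.

Definition strip j (l : R) : set (R * R) :=
  if j == 0 then xstrip l else sw @^-1` xstrip l.

Lemma measurable_strip j l : measurable (strip j l : set P).
Proof.
rewrite /strip; case: ifP => _; first exact: measurable_xstrip.
have [_ msw _ _] := @Qsym_sw R.
by rewrite -[X in measurable X]setTI; apply: msw => //; exact: measurable_xstrip.
Qed.

Lemma strip_sub_Q j l : 0 < l -> l < 2^-1 -> strip j l `<=` Q.
Proof.
move=> l0 l1; have H := xstrip_sub_Q l0 l1.
rewrite /strip; case: ifP => _ //.
by have [_ _ _ qsw] := @Qsym_sw R; move=> z /H /qsw.
Qed.

Lemma bnd_sqnormE g : bnd_sqnorm g =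
  (\int[leb]_(s in `[(-1)%R, 1%R]) (g (s, 1%R) ^+ 2)%:E +
   \int[leb]_(s in `[(-1)%R, 1%R]) (g (s, (-1)%R) ^+ 2)%:E +
   \int[leb]_(s in `[(-1)%R, 1%R]) (g (1%R, s) ^+ 2)%:E +
   \int[leb]_(s in `[(-1)%R, 1%R]) (g ((-1)%R, s) ^+ 2)%:E)%E.
Proof. by rewrite /bnd_sqnorm !big_ord_recr big_ord0 /= add0e. Qed.

(** The case j = 1 is the case j = 0 for the function with exchanged coordinates. *)
Lemma strip_poincare j l g (B : R) : Ck 1 g -> 0 < l -> l < 2^-1 ->
  (bnd_sqnorm g <= B%:E)%E ->
  \int[mu]_(z in strip j l) g z ^+ 2 <=
  4 * l * B + 16 * l ^+ 2 * \int[mu]_(z in strip j l) pd j g z ^+ 2.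
Proof.
move=> C1 l0 l1; rewrite bnd_sqnormE => HB.
have ar1 (a b c d : R) : 0 <= a -> 0 <= b -> a + b + c + d <= B -> c + d <= B.
  by clear; lra.
have ar2 (a b c d : R) : 0 <= c -> 0 <= d -> a + b + c + d <= B -> a + b <= B.
  by clear; lra.
have cg2 : continuous (fun z => g z ^+ 2) := Ck_continuous (CkM C1 C1).
have c1 (t : R) : continuous (fun y => g (t, y) ^+ 2).
  by have H := @continuous_slice1 R (fun z => g z ^+ 2) t cg2; move=> y; exact: (H y).
have c0 (t : R) : continuous (fun y => g (y, t) ^+ 2).
  by have H := @continuous_slice0 R (fun z => g z ^+ 2) t cg2; move=> y; exact: (H y).
have i1 t := continuous_itv_integrable (-1) 1 (c1 t).
have i0 t := continuous_itv_integrable (-1) 1 (c0 t).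
have mI : measurable (`[-1, 1]%classic : set
  (measurableTypeR R)) by exact: measurable_itv.
have fin (f : R -> R) : leb.-integrable `[-1, 1] (EFin \o f) ->
    (\int[leb]_(y in `[(-1)%R, 1%R]) (f y)%:E = (\int[leb]_(y in `[-1, 1]) f y)%:E)%E.
  by move=> fi; rewrite fineK//; exact: integrable_fin_num.
rewrite (fin _ (i0 1)) (fin _ (i0 (-1))) (fin _ (i1 1)) (fin _ (i1 (-1))) in HB.
rewrite -!EFinD lee_fin in HB.
have p0 (f : R -> R) : 0 <= \int[leb]_(y in `[-1, 1]) f y ^+ 2.
  by apply: Rintegral_ge0 => y _; exact: sqr_ge0.
have l40 : 0 <= 4 * l by apply: mulr_ge0 (ltW l0); exact: ler0n.
have q1 := p0 (fun y => g (y, 1)); have q2 := p0 (fun y => g (y, -1)).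
have q3 := p0 (fun y => g (1, y)); have q4 := p0 (fun y => g (-1, y)).
move: j; apply: dirP; rewrite /strip /=.
  apply: le_trans (xstrip_poincare C1 l0 l1) _; rewrite lerD2r; apply: (ler_wpM2l l40).
  rewrite (RintegralD mI (i1 1) (i1 (-1))); exact: (ar1 _ _ _ _ q1 q2 HB).
have mst : measurable (sw @^-1` xstrip l : set P) := measurable_strip 1 l.
have st : sw @^-1` xstrip l `<=` Q := @strip_sub_Q 1 l l0 l1.
have E : sw @^-1` (sw @^-1` xstrip l) = xstrip l.
  by apply/seteqP; split=> z /=; rewrite swK.
have cp2 : continuous (fun z => pd 1 g z ^+ 2).
  have H : Ck 0 (fun z => pd 1 g z * pd 1 g z) := CkM (Ck_pd 1 C1) (Ck_pd 1 C1).
  exact: H.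
rewrite (Rintegral_Qsym Qsym_sw mst st cg2) (Rintegral_Qsym Qsym_sw mst st cp2) E.
apply: le_trans (xstrip_poincare (Ck_sw C1) l0 l1) _.
apply: lerD.
  apply: (ler_wpM2l l40).
  have -> : \int[leb]_(y in `[-1, 1]) ((g \o sw) (1, y) ^+ 2 + (g \o sw) (-1, y) ^+ 2) =
    \int[leb]_(y in `[-1, 1]) (g (y, 1) ^+ 2 + g (y, -1) ^+ 2) by [].
  rewrite (RintegralD mI (i0 1) (i0 (-1))); exact: (ar2 _ _ _ _ q3 q4 HB).
rewrite le_eqVlt; apply/orP; left; apply/eqP; congr (_ * _).
Qed.

Definition cutoff (l : R) : R * R -> R := plateau2 (-1) 1 (-1) 1 l.

Lemma cutoff01 l z : 0 <= cutoff l z <= 1.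
Proof.
rewrite /cutoff /plateau2; apply/andP; split.
  by apply: mulr_ge0; exact: plateau_ge0.
by apply: mulr_ile1; by [exact: plateau_ge0|exact: plateau_le1].
Qed.

Lemma plateau_mid (l x : R) : 0 < l -> -1 <= x <= 1 ->
  ~ (1 - 2 * l <= x <= 1) -> ~ (-1 <= x <= -1 + 2 * l) ->
  -1 + 2 * l < x < 1 - 2 * l.
Proof.
move=> l0 /andP[x1 x2] /negP h1 /negP h2; move: h1 h2.
by rewrite x1 x2 andbT /= -!ltNge => -> ->.
Qed.

(** The cutoff is a product, so its derivative in direction j lives only on the
    strips along the two sides normal to j, where [strip_poincare] uses the
    derivative in the same direction. *)
Lemma cutoff_pd_bound : exists2 C : R, 0 <= C & forall j l z, 0 < l -> Q z ->
  `|pd j (cutoff l) z| <= C / l * \1_(strip j l) z.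
Proof.
have [C C0 HC] := @plateau_derive_bounded R.
exists C => // j l z l0 Qz.
have key (x y : R) : -1 <= x <= 1 -> ~ (1 - 2 * l <= x <= 1) ->
  ~ (-1 <= x <= -1 + 2 * l) ->
    derive1 (plateau (-1) 1 l) x = 0.
  by move=> ? ? ?; apply: plateau_derive_eq0 => //; exact: plateau_mid.
have Cl : 0 <= C / l by rewrite divr_ge0// ltW.
have pl x : `|plateau (-1) 1 l x| <= 1.
  by rewrite (ger0_norm (plateau_ge0 _ _ _ _)); exact: plateau_le1.
have sp : smooth1 (plateau (-1) 1 l) := smooth1_plateau (-1) 1 l.
move: z Qz => -[x y] [/= Qx Qy]; rewrite in_itv/= in Qx; rewrite in_itv/= in Qy.
move: j; apply: dirP.
  have -> : pd 0 (cutoff l) (x, y) = derive1 (plateau (-1) 1 l) x * plateau (-1) 1 l y.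
    exact: (pd0_prod (x, y) sp sp).
  rewrite indicE; case: (boolP ((x, y) \in _)) => [_|].
    by rewrite mulr1 normrM -[leRHS]mulr1; apply: ler_pM => //; exact: HC.
  rewrite notin_setE /strip /= /xstrip /= /sq_of => nin;
    rewrite key ?mul0r ?normr0 ?mulr0//.
    by move=> h; apply: nin; left; split; rewrite /= in_itv.
  by move=> h; apply: nin; right; split; rewrite /= in_itv.
have -> : pd 1 (cutoff l) (x, y) = plateau (-1) 1 l x * derive1 (plateau (-1) 1 l) y.
  exact: (pd1_prod (x, y) sp sp).
rewrite indicE; case: (boolP ((x, y) \in _)) => [_|].
  by rewrite mulr1 normrM mulrC -[leRHS]mulr1; apply: ler_pM => //; exact: HC.
rewrite notin_setE /strip /= /xstrip /= /sq_of => nin;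
  rewrite key ?mul0r ?normr0 ?mulr0 ?normr0//.
  by move=> h; apply: nin; left; split; rewrite /= in_itv.
by move=> h; apply: nin; right; split; rewrite /= in_itv.
Qed.

Definition collar (l : R) : set (R * R) := strip 0 l `|` strip 1 l.

Lemma cutoff_eq1 l z : 0 < l -> Q z -> ~ collar l z -> cutoff l z = 1.
Proof.
move=> l0; case: z => x y [/= Qx Qy]; rewrite in_itv/= in Qx; rewrite in_itv/= in Qy.
rewrite /collar /strip /= /xstrip /= /sq_of => nin.
have mid (t : R) : -1 + 2 * l < t < 1 - 2 * l -> plateau (-1) 1 l t = 1.
  by move=> /andP[/ltW h1 /ltW h2]; apply: plateau_eq1 => //; rewrite h1.
rewrite /cutoff /plateau2 /= !mid ?mulr1//; apply: plateau_mid => // h; apply: nin;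
  by [right; left; split; rewrite /= in_itv|right; right; split; rewrite /= in_itv
     |left; left; split; rewrite /= in_itv|left; right; split; rewrite /= in_itv].
Qed.

Lemma sqr_sum3 (a b c : R) : (a + b + c) ^+ 2 <= 3 * (a ^+ 2 + b ^+ 2 + c ^+ 2).
Proof.
rewrite -subr_ge0.
have -> : 3 * (a ^+ 2 + b ^+ 2 + c ^+ 2) - (a + b + c) ^+ 2 =
  (a - b) ^+ 2 + (b - c) ^+ 2 + (a - c) ^+ 2 by ring.
by rewrite !addr_ge0 ?sqr_ge0.
Qed.

(** The error splits as eta (D - dd) + (eta - 1) dd + w pe: the error of the
    approximation, the part of dd lost near the boundary, and the derivative pe of
    the cutoff eta; i1 and i2 are the indicators of the sets on which pe and
    eta - 1 may be nonzero. *)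
Lemma cutoff_pointwise (eta w D dd pe M i1 i2 : R) :
  0 <= eta <= 1 -> `|pe| <= M * i1 -> (i1 = 0 \/ i1 = 1) ->
  (i2 = 0 -> eta = 1) -> (i2 = 0 \/ i2 = 1) ->
  (eta * D + w * pe - dd) ^+ 2 <=
  3 * (D - dd) ^+ 2 + 3 * (i2 * dd ^+ 2) + 3 * M ^+ 2 * (i1 * w ^+ 2).
Proof.
move=> /andP[e0 e1] peM i1E i2E i2V.
have -> : eta * D + w * pe - dd = eta * (D - dd) + (eta - 1) * dd + w * pe by ring.
apply: le_trans (sqr_sum3 _ _ _) _.
rewrite [leLHS]mulrDr [X in X + _ <= _]mulrDr; apply: lerD; first apply: lerD.
- rewrite ler_wpM2l ?ler0n// exprMn ler_piMl ?sqr_ge0// expr_le1//.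
- rewrite ler_wpM2l ?ler0n// exprMn.
  case: i2V => [i20|->]; first by rewrite i2E// subrr expr0n mul0r i20 mul0r.
  by rewrite ler_wpM2r ?sqr_ge0// -real_normK ?num_real// expr_le1// ler_norml;
    apply/andP; split; lra.
- rewrite -[3 * M ^+ 2 * _]mulrA ler_wpM2l ?ler0n// exprMn mulrA [w ^+ 2 * _]mulrC
    ler_wpM2r ?sqr_ge0//.
  case: i1E peM => ->; rewrite ?mulr0 ?mulr1 => peM.
    by move: peM; rewrite normr_le0 => /eqP ->; rewrite expr0n.
  by rewrite -real_normK ?num_real// lerXn2r ?nnegrE// (le_trans _ peM).
Qed.

(** The factor 1/l^2 from the derivative of the cutoff is compensated by the l^2 in
    [strip_poincare]; only the boundary values B keep a factor 1/l. *)
Lemma cutoff_estimate (C : R) j l w d (B : R) : 0 <= C ->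
  (forall z, Q z -> `|pd j (cutoff l) z| <= C / l * \1_(strip j l) z) ->
  Ck 1 w -> L2 d -> 0 < l -> l < 2^-1 -> (bnd_sqnorm w <= B%:E)%E ->
  \int[mu]_(z in Q) (pd j (fun z => cutoff l z * w z) z - d z) ^+ 2 <=
  (3 + 96 * C ^+ 2) * (\int[mu]_(z in Q) (pd j w z - d z) ^+ 2 +
     \int[mu]_(z in Q) (\1_(collar l) z * d z ^+ 2)) + 12 * C ^+ 2 / l * B.
Proof.
move=> C0 HC Cw Ld l0 l1 HB.
have Le : L2 (fun z => pd j w z - d z).
  by apply: L2B Ld; apply: L2_continuous; exact: (Ck_continuous (Ck_pd j Cw)).
have mS : measurable (strip j l : set P) := measurable_strip j l.
have mK : measurable (collar l : set P) := measurableU _ _ (measurable_strip 0 l)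
  (measurable_strip 1 l).
have SQ : strip j l `<=` Q := @strip_sub_Q j l l0 l1.
have SK : strip j l `<=` collar l
  by move: j {HC Le mS SQ}; apply: dirP => z; [left|right].
have cw2 : continuous (fun z => w z ^+ 2) := Ck_continuous (CkM Cw Cw).
have cp2 : continuous (fun z => pd j w z ^+ 2).
  have H : Ck 0 (fun z => pd j w z * pd j w z) := CkM (Ck_pd j Cw) (Ck_pd j Cw).
  exact: H.
have ie := L2_itg_sqr Le; have id := itg_indic mK (L2_itg_sqr Ld).
have iw := itg_indic mS (continuous_integrable mQ (fun z h => h) cw2).
have ip := itg_indic mS (continuous_integrable mQ (fun z h => h) cp2).
set a := \int[mu]_(z in Q) (pd j w z - d z) ^+ 2.
set b := \int[mu]_(z in Q) (\1_(collar l) z * d z ^+ 2).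
have E1 := strip_poincare j Cw l0 l1 HB.
rewrite -(Rintegral_indic (fun z => w z ^+ 2) SQ) -(Rintegral_indic (fun z =>
  pd j w z ^+ 2) SQ) in E1.
have ie2 := itgZ 2 ie; have id2 := itgZ 2 id.
have E2 : \int[mu]_(z in Q) (\1_(strip j l) z * pd j w z ^+ 2) <= 2 * a + 2 * b.
  rewrite -(RintegralZl 2 mQ ie) -(RintegralZl 2 mQ id) -(RintegralD mQ ie2 id2).
  apply: (le_Rintegral mQ ip (itgD ie2 id2)) => z _.
  rewrite indicE; case: (boolP (z \in _)) => [/set_mem/SK zK|_].
    rewrite indicE mem_set// !mul1r; move: (pd j w z) (d z) => x y; clear.
    rewrite -subr_ge0 (_ : _ - _ = (x - 2 * y) ^+ 2) ?sqr_ge0//; ring.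
  have /andP[k0 _] := indic01 (collar l) z.
  rewrite mul0r; apply: addr_ge0; apply: mulr_ge0; rewrite ?ler0n//; first exact: sqr_ge0.
  by apply: mulr_ge0 => //; exact: sqr_ge0.
have pdE : pd j (fun z => cutoff l z * w z) = (fun z =>
  cutoff l z * pd j w z + w z * pd j (cutoff l) z).
  apply: pdM => z; first exact: (@Ck_derivable _ _ _ j z (smooth_plateau2 (-1) 1
    (-1) 1 l 1)).
  exact: (@Ck_derivable _ _ _ j z Cw).
have Lp : L2 (fun z => cutoff l z * pd j w z + w z * pd j (cutoff l) z - d z).
  apply: L2B Ld; rewrite -pdE; apply: L2_continuous.
  apply: (@Ck_continuous _ 0); apply: Ck_pd; apply: CkM Cw.
  exact: smooth_plateau2.
have iL := itgZ 3 ie; have iM := itgZ 3 id; have iN := itgZ (3 * (C / l) ^+ 2) iw.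
rewrite pdE; apply: le_trans (le_Rintegral mQ (L2_itg_sqr Lp) (itgD (itgD iL iM) iN) _) _.
  move=> z Qz; apply: cutoff_pointwise.
  - exact: cutoff01.
  - exact: HC.
  - by rewrite indicE; case: (_ \in _); [right|left].
  - rewrite indicE; case: (boolP (z \in _)) => [_ /eqP|zK _]; first by rewrite oner_eq0.
    by apply: cutoff_eq1 => //; move: zK; rewrite notin_setE.
  - by rewrite indicE; case: (_ \in _); [right|left].
rewrite (RintegralD mQ (itgD iL iM) iN) (RintegralD mQ iL iM).
rewrite (RintegralZl 3 mQ ie) (RintegralZl 3 mQ id) (RintegralZl _ mQ iw) -/a -/b.
move: E1 E2.
move: (\int[mu]_(z in Q) (_ * w z ^+ 2)) (\int[mu]_(z in Q) (_ * pd j w z ^+ 2)) => W V.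
clearbody a b; clear -l0 C0.
move=> E1 E2.
have l2 : 0 <= 16 * l ^+ 2 by rewrite mulr_ge0 ?sqr_ge0 ?ler0n.
have E3 : W <= 4 * l * B + 16 * l ^+ 2 * (2 * a + 2 * b).
  by apply: le_trans E1 _; rewrite lerD2l ler_wpM2l.
have E4 : 3 * (C / l) ^+ 2 * W <= 3 * (C / l) ^+ 2 * (4 * l * B +
  16 * l ^+ 2 * (2 * a + 2 * b)).
  by rewrite ler_wpM2l// mulr_ge0 ?sqr_ge0 ?ler0n.
apply: (@le_trans _ _ (3 * a + 3 * b + 3 * (C / l) ^+ 2 * (4 * l * B +
  16 * l ^+ 2 * (2 * a + 2 * b)))).
  by rewrite lerD2l.
rewrite le_eqVlt; apply/orP; left; apply/eqP.
by field; rewrite gt_eqF.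
Qed.

(** The collars shrink to the boundary, a null set.  Widths start at 1/3 because the
    two strips of a collar are disjoint only for l < 1/2. *)
Lemma collar_vanishes d : L2 d ->
  \int[mu]_(z in Q) (\1_(collar ((n.+3)%:R^-1)) z * d z ^+ 2) @[n --> \oo] --> (0 : R).
Proof.
move=> Ld; have id := L2_itg_sqr Ld.
pose l (n : nat) : R := (n.+3)%:R^-1.
have mK n : measurable (collar (l n) : set P) :=
  measurableU _ _ (measurable_strip 0 (l n)) (measurable_strip 1 (l n)).
have [] := @dominated_convergence _ _ _ mu Q mQ
  (fun n z => (\1_(collar (l n)) z * d z ^+ 2)%:E) (fun=> 0%E) (fun z => (d z ^+ 2)%:E).
- by move=> n; exact: measurable_int (itg_indic (mK n) id).
- exact: measurable_cst.
- have H : {ae mu, forall z, Q z -> interior Q z}.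
    by apply: negligibleS negligible_boundary_Q => z /= /not_implyP.
  apply: aeS H => z Hz /Hz; rewrite interior_Q; case: z {Hz} => x y [/=].
  rewrite !in_itv/= => /andP[x1 x2] /andP[y1 y2].
  apply: cvg_near_cst.
  have m0 : 0 < Num.min (Num.min (1 - x) (x + 1)) (Num.min (1 - y) (y + 1)) / 2.
    by rewrite divr_gt0// !lt_min; do ?[apply/andP; split]; lra.
  near=> n; rewrite indicE memNset ?mul0r//.
  have : l n < Num.min (Num.min (1 - x) (x + 1)) (Num.min (1 - y) (y + 1)) / 2.
    apply: (@le_lt_trans _ _ (n.+1%:R^-1)).
      by rewrite /l lef_pV2 ?posrE// ler_nat ltnS leqW.
    near: n; exact: near_infty_natSinv_lt (PosNum m0).
  rewrite ltr_pdivlMr// !lt_min => /andP[/andP[h1 h2] /andP[h3 h4]].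
  by rewrite /collar /strip /xstrip /= /sq_of /= !in_itv/= =>
    -[[]|[]] [/andP[? ?] /andP[? ?]]; lra.
- exact: id.
- apply: aeW => z n _; rewrite lee_fin normrM.
  have /andP[k0 k1] := indic01 (collar (l n)) z.
  by rewrite (ger0_norm k0) (ger0_norm (sqr_ge0 _)) ler_piMl ?sqr_ge0.
move=> _ _; rewrite integral0 => H.
exact: (@fine_cvg _ _ _ _ _ (0 : R) H).
Unshelve. all: by end_near. Qed.

Lemma sqr_int_cvg0 (h : (R * R -> R)^nat) : (forall n,
  mu.-integrable Q (EFin \o (h n))) ->
  (fun n => \int[mu]_(z in Q) (h n z)%:E)%E @ \oo --> 0%E ->
  forall e, 0 < e -> \forall n \near \oo, \int[mu]_(z in Q) h n z < e.
Proof.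
move=> hi H e e0.
have E : (fun n => \int[mu]_(z in Q) h n z) @ \oo --> (0 : R).
  exact: (@fine_cvg _ _ _ _ _ (0 : R) H).
move/cvgrPdist_lt : E => /(_ _ e0); apply: filterS => n /=.
by rewrite sub0r normrN; apply: le_lt_trans; exact: ler_norm.
Qed.

(** The width l is fixed first, so that the derivatives of w have little mass in the
    collar; the smooth approximation is chosen afterwards, with boundary values so
    small that they absorb the factor 1/l of [cutoff_estimate]. *)
Lemma trace_zero_density w : H1 w -> is_trace w (cst 0) -> forall e : R, 0 < e ->
  exists2 psi, test_fun psi &
    forall j, \int[mu]_(z in Q) (pd j psi z - wpd j w z) ^+ 2 <= e.
Proof.
move=> Hw [_ [wn [swn [_ Hg] Hb]]] e e0.
have [C C0 HC] := cutoff_pd_bound.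
have Ld j : L2 (wpd j w) by have [] := wpdP j Hw.
pose K := 3 + 96 * C ^+ 2.
have K0 : 0 < K by rewrite ltr_pwDl// mulr_ge0 ?sqr_ge0.
have e3 : 0 < e / 3 by rewrite divr_gt0.
have eK : 0 < e / 3 / K by rewrite divr_gt0.
have [n [Hn0 Hn1]] : exists n,
    \int[mu]_(z in Q) (\1_(collar ((n.+3)%:R^-1)) z * wpd 0 w z ^+ 2) < e / 3 / K /\
    \int[mu]_(z in Q) (\1_(collar ((n.+3)%:R^-1)) z * wpd 1 w z ^+ 2) < e / 3 / K.
  have lim j : \forall n \near \oo,
      \int[mu]_(z in Q) (\1_(collar ((n.+3)%:R^-1)) z * wpd j w z ^+ 2) < e / 3 / K.
    have E := collar_vanishes (Ld j).
    move/cvgrPdist_lt : E => /(_ _ eK); apply: filterS => n /=.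
    by rewrite sub0r normrN; apply: le_lt_trans; exact: ler_norm.
  have [N _ HN] := filterI (lim 0) (lim 1).
  by exists N; exact: (HN N (leqnn N)).
pose l : R := (n.+3)%:R^-1.
have l0 : 0 < l by rewrite invr_gt0.
have l1 : l < 2^-1 by rewrite ltf_pV2 ?posrE// ltr_nat.
pose M := 12 * C ^+ 2 / l + 1.
have M0 : 0 < M by rewrite ltr_wpDl// divr_ge0 ?(ltW l0)// mulr_ge0 ?sqr_ge0.
have eM : 0 < e / 3 / M by rewrite divr_gt0.
have Le m j : L2 (fun z => pd j (wn m) z - wpd j w z).
  by apply: L2B (Ld j); apply: smooth_L2_pd; exact: swn.
have near_g j := sqr_int_cvg0 (fun m => L2_itg_sqr (Le m j)) (Hg j) eK.
have near_b : \forall m \near \oo, (bnd_sqnorm (wn m) <= (e / 3 / M)%:E)%E.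
  have /fine_cvgP[fn E] := Hb.
  move/cvgrPdist_lt : E => /(_ _ eM); apply: filterS2 fn => m fn /=;
    rewrite sub0r normrN => H.
  have E : bnd_sqnorm (wn m) = bnd_sqnorm (fun x => wn m x - cst 0 x).
    by congr bnd_sqnorm; apply/funext => x; rewrite subr0.
  rewrite E -(fineK fn) lee_fin; apply: ltW; apply: le_lt_trans H; exact: ler_norm.
have [m _ Hm] := filterI (filterI (near_g 0) (near_g 1)) near_b.
have [[g0 g1] bb] := Hm m (leqnn m).
exists (fun z => cutoff l z * wn m z).
  by apply: test_fun_plateau2 => //; exact: swn.
have fin j (a b : R) : a = \int[mu]_(z in Q) (pd j (wn m) z - wpd j w z) ^+ 2 ->
    b = \int[mu]_(z in Q) (\1_(collar l) z * wpd j w z ^+ 2) ->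
    a < e / 3 / K -> b < e / 3 / K ->
    \int[mu]_(z in Q) (pd j (fun z => cutoff l z * wn m z) z - wpd j w z) ^+ 2 <= e.
  move=> aE bE; rewrite !ltr_pdivlMr// => ha hb.
  apply: le_trans (cutoff_estimate C0 (fun z =>
    @HC j l z l0) (swn m 1%N) (Ld j) l0 l1 bb) _.
  rewrite -aE -bE.
  have : 12 * C ^+ 2 / l * (e / 3 / M) <= e / 3.
    rewrite mulrA ler_pdivrMr// mulrC ler_wpM2l ?(ltW e3)//.
    by rewrite /M lerDl.
  have -> : (3 + 96 * C ^+ 2) * (a + b) = a * K + b * K by rewrite [LHS]mulrC mulrDl.
  move: ha hb; move: (a * K) (b * K) (_ * (e / 3 / M)) => s t u; clear; lra.
by apply: dirP; [exact: (fin 0 _ _ erefl erefl g0 Hn0)|exact: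
  (fin 1 _ _ erefl erefl g1 Hn1)].
Qed.

End Density.

(** * The excess of energy *)
Section Excess.
Context {R : realType}.
Local Notation P := (measurableTypeR R * measurableTypeR R)%type.
Local Notation mu := (leb2 : {measure set P -> \bar R}).
Implicit Types (z : R * R).

Local Opaque pd.

Let mQ : measurable (Q : set P) := measurable_Q.

Lemma mdotE (A B : 'M[R]_2) : mdot A B =
  A 0 0 * B 0 0 + A 0 1 * B 0 1 + A 1 0 * B 1 0 + A 1 1 * B 1 1.
Proof.
rewrite /mdot /mxtrace !big_ord_recl big_ord0 addr0 !mxE !big_ord_recl !big_ord0 !mxE
  !addr0.
have -> : lift ord0 ord0 = 1 :> 'I_2 by exact: val_inj.
by rewrite -!/0; ring.
Qed.

Lemma normsqE (A : 'M[R]_2) : normsq A =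
  A 0 0 ^+ 2 + A 0 1 ^+ 2 + A 1 0 ^+ 2 + A 1 1 ^+ 2.
Proof. by rewrite /normsq mdotE !expr2. Qed.

Lemma cofdotE (A B : 'M[R]_2) : mdot (cof A) B =
  A 1 1 * B 0 0 - A 1 0 * B 0 1 - A 0 1 * B 1 0 + A 0 0 * B 1 1.
Proof. by rewrite mdotE /cof !mxE /= !mulNr. Qed.

Lemma det2E (A : 'M[R]_2) : \det A = A 0 0 * A 1 1 - A 0 1 * A 1 0.
Proof.
rewrite (expand_det_row _ 0) !big_ord_recl big_ord0 /cofactor !det_mx11 !mxE addr0 /=.
have -> : lift ord0 ord0 = 1 :> 'I_2 by exact: val_inj.
have -> : lift 1 0 = 0 :> 'I_2 by exact: val_inj.
by rewrite !addn0 addn1 expr0 expr1 !mul1r mulN1r mulrN.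
Qed.

(** With a, b, c, d and x, y, z, t the entries of A and N, this is
    |A + N|^2 - |A|^2 + f (det (A + N) - det A), arranged as the integrand of the
    weak equation followed by that of the quadratic form |N|^2 + f det N. *)
Definition excess (f a b c d x y z t : R) : R :=
  (2 * (a * x + b * y + c * z + d * t) + f * (d * x - c * y - b * z + a * t))
  + ((x ^+ 2 + y ^+ 2 + z ^+ 2 + t ^+ 2) + f * (x * t - y * z)).

(** Young's inequality with weight de, in a form that can be summed over all
    products of entries occurring in [excess]. *)
Lemma young (K de f x y : R) : `|f| <= K -> 0 < de ->
  - (K * (de * x ^+ 2 + y ^+ 2 / de)) <= 2 * (f * (x * y)).
Proof.
move=> fK d0.
have H : `|2 * (x * y)| <= de * x ^+ 2 + y ^+ 2 / de.
  have dn : de != 0 by rewrite gt_eqF.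
  rewrite ler_norml; apply/andP; split; rewrite -subr_ge0 ?opprK.
    have -> : 2 * (x * y) + (de * x ^+ 2 + y ^+ 2 / de) = (de * x + y) ^+ 2 / de by field.
    by rewrite divr_ge0 ?sqr_ge0 ?ltW.
  have -> : de * x ^+ 2 + y ^+ 2 / de - 2 * (x * y) = (de * x - y) ^+ 2 / de by field.
  by rewrite divr_ge0 ?sqr_ge0 ?ltW.
have : `|f * (2 * (x * y))| <= K * (de * x ^+ 2 + y ^+ 2 / de).
  by rewrite normrM ler_pM.
by rewrite mulrCA ler_norml => /andP[].
Qed.

(** The excess is quadratic in N = (x, y, z, t), so changing N to N' costs a small
    multiple of |A|^2 + |N|^2 and a large multiple of |N' - N|^2. *)
Lemma excess_perturb (K de f a b c d x y z t x' y' z' t' : R) : `|f| <= K -> 0 < de ->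
  excess f a b c d x' y' z' t' - (1 + K) *
    (de * (a ^+ 2 + b ^+ 2 + c ^+ 2 + d ^+ 2 + (x ^+ 2 + y ^+ 2 + z ^+ 2 + t ^+ 2)) +
     (2 / de + 1) * ((x' - x) ^+ 2 + (y' - y) ^+ 2 + (z' - z) ^+ 2 + (t' - t) ^+ 2)) <=
  excess f a b c d x y z t.
Proof.
move=> fK d0.
set e1 := x' - x; set e2 := y' - y; set e3 := z' - z; set e4 := t' - t.
have n1 : `|1 : R| <= 1 by rewrite normr1.
have fK' : `|- f| <= K by rewrite normrN.
have n1' : `|-1 : R| <= 1 by rewrite normrN normr1.
have K0 : 0 <= K by apply: le_trans fK.
have k1 := young a e1 n1' d0; have k2 := young b e2 n1' d0.
have k3 := young c e3 n1' d0; have k4 := young d e4 n1' d0.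
have l1 := young x e1 n1' d0; have l2 := young y e2 n1' d0.
have l3 := young z e3 n1' d0; have l4 := young t e4 n1' d0.
have m1 := young d e1 fK' d0; have m2 := young c e2 fK d0.
have m3 := young b e3 fK d0; have m4 := young a e4 fK' d0.
have o1 := young t e1 fK' d0; have o2 := young z e2 fK d0.
have o3 := young y e3 fK d0; have o4 := young x e4 fK' d0.
have q1 := young e1 e4 fK' ltr01; have q2 := young e2 e3 fK ltr01.
have -> : x' = x + e1 by rewrite /e1 addrC subrK.
have -> : y' = y + e2 by rewrite /e2 addrC subrK.
have -> : z' = z + e3 by rewrite /e3 addrC subrK.
have -> : t' = t + e4 by rewrite /e4 addrC subrK.
clearbody e1 e2 e3 e4.
rewrite /excess.
rewrite ?divr1 in q1 q2.
have kA : 0 <= K * (de * (a ^+ 2 + b ^+ 2 + c ^+ 2 + d ^+ 2 + (x ^+ 2 + y ^+ 2 +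
  z ^+ 2 + t ^+ 2))).
  by apply: mulr_ge0 => //; apply: mulr_ge0;
    [exact: ltW|do ?[exact: sqr_ge0|apply: addr_ge0]].
have kE : 0 <= K * (e1 ^+ 2 + e2 ^+ 2 + e3 ^+ 2 + e4 ^+ 2).
  by apply: mulr_ge0 => //; do ?[exact: sqr_ge0|apply: addr_ge0].
have kEd : 0 <= K * ((e1 ^+ 2 + e2 ^+ 2 + e3 ^+ 2 + e4 ^+ 2) / de).
  apply: mulr_ge0 => //; apply: divr_ge0; last exact: ltW.
  by do ?[exact: sqr_ge0|apply: addr_ge0].
move: k1 k2 k3 k4 l1 l2 l3 l4 m1 m2 m3 m4 o1 o2 o3 o4 q1 q2 kA kE kEd.
move: (de^-1) => w; clear; lra.
Qed.

Lemma sum4_sqr_ge0 (x y z t : R) : 0 <= x ^+ 2 + y ^+ 2 + z ^+ 2 + t ^+ 2.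
Proof. by rewrite !addr_ge0 ?sqr_ge0. Qed.

Lemma sum4_le (x y z t b : R) : x <= b -> y <= b -> z <= b -> t <= b ->
  x + y + z + t <= 4 * b.
Proof. by lra. Qed.

Lemma itg_excess (f a b c d x y z t : R * R -> R) (K : R) :
  measurable_fun (Q : set P) f -> (forall w, Q w -> `|f w| <= K) ->
  L2 a -> L2 b -> L2 c -> L2 d -> L2 x -> L2 y -> L2 z -> L2 t ->
  mu.-integrable Q (EFin \o
    (fun w => excess (f w) (a w) (b w) (c w) (d w) (x w) (y w) (z w) (t w))).
Proof.
move=> mf fK La Lb Lc Ld Lx Ly Lz Lt; rewrite /excess.
have iM := @L2_itgM R.
apply: itgD; apply: itgD.
- apply: itgZ; apply: itgD (iM _ _ Ld Lt); apply: itgD (iM _ _ Lc Lz).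
  exact: itgD (iM _ _ La Lx) (iM _ _ Lb Ly).
- apply: (itg_bounded_mul mf fK); apply: itgD (iM _ _ La Lt); apply: itgB (iM _ _ Lb Lz).
  exact: itgB (iM _ _ Ld Lx) (iM _ _ Lc Ly).
- apply: itgD (L2_itg_sqr Lt); apply: itgD (L2_itg_sqr Lz).
  exact: itgD (L2_itg_sqr Lx) (L2_itg_sqr Ly).
- by apply: (itg_bounded_mul mf fK); exact: itgB (iM _ _ Lx Lt) (iM _ _ Ly Lz).
Qed.

(** For test maps the first half of the excess integrates to zero by the weak
    equation, and the second is nonnegative by [hadamard_mean].  Functions of zero
    trace follow by density. *)
Lemma Rintegral_excess_ge0 (s t : R) (u : R * R -> 'cV[R]_2) (w0 w1 : R * R -> R) :
  y_fun s t < 1 -> H1v u -> weak_solution (f_coef s t) u ->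
  H1 w0 -> H1 w1 -> is_trace w0 (cst 0) -> is_trace w1 (cst 0) ->
  0 <= \int[mu]_(z in Q) excess (f_coef s t z)
    (grad u z 0 0) (grad u z 0 1) (grad u z 1 0) (grad u z 1 1)
    (wpd 0 w0 z) (wpd 1 w0 z) (wpd 0 w1 z) (wpd 1 w1 z).
Proof.
move=> y1 Hu sol Hw0 Hw1 T0 T1.
pose K := `|s| + `|t + s| + `|t - s| + `|s|.
have mf := @f_coef_measurable R s t.
have fK z : Q z -> `|f_coef s t z| <= K by move=> _; exact: f_coef_bounded.
have K0 : 0 <= K by rewrite /K !addr_ge0.
have Lw (w : R * R -> R) (Hw : H1 w) (j : 'I_2) : L2 (wpd j w) by have [] := wpdP j Hw.
have Lg (i j : 'I_2) : L2 (fun z => grad u z i j).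
  have -> : (fun z => grad u z i j) = wpd j (cpt u i) by apply/funext => z; rewrite mxE.
  exact: Lw (Hu i) j.
set I := (X in 0 <= X).
pose A z := grad u z 0 0 ^+ 2 + grad u z 0 1 ^+ 2 + grad u z 1 0 ^+ 2 + grad u z 1 1 ^+ 2
  + (wpd 0 w0 z ^+ 2 + wpd 1 w0 z ^+ 2 + wpd 0 w1 z ^+ 2 + wpd 1 w1 z ^+ 2).
have iA : mu.-integrable Q (EFin \o A).
  have S := @L2_itg_sqr R.
  have i1 := itgD (itgD (itgD (S _ (Lg 0 0)) (S _ (Lg 0 1))) (S _ (Lg 1 0)))
    (S _ (Lg 1 1)).
  have i2 := itgD (itgD (itgD (S _ (Lw _ Hw0 0)) (S _ (Lw _ Hw0 1)))
    (S _ (Lw _ Hw1 0))) (S _ (Lw _ Hw1 1)).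
  exact: (itgD i1 i2).
have A0 : 0 <= \int[mu]_(z in Q) A z.
  by apply: Rintegral_ge0 => z _;
    exact: (addr_ge0 (sum4_sqr_ge0 _ _ _ _) (sum4_sqr_ge0 _ _ _ _)).
set a := \int[mu]_(z in Q) A z in A0.
have iI := itg_excess mf fK (Lg 0 0) (Lg 0 1) (Lg 1 0) (Lg 1 1)
  (Lw _ Hw0 0) (Lw _ Hw0 1) (Lw _ Hw1 0) (Lw _ Hw1 1).
(* Squared errors below e^2 for the gradients and weight e make both error
   terms of [excess_perturb] of order e. *)
have key (e : R) : 0 < e -> e <= 1 -> - ((1 + K) * (a + 12) * e) <= I.
  move=> e0 e1.
  have e20 : 0 < e ^+ 2 by rewrite exprn_gt0.
  have [p tp Hp] := trace_zero_density Hw0 T0 e20.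
  have [q tq Hq] := trace_zero_density Hw1 T1 e20.
  have [sp _ _] := tp; have [sq _ _] := tq.
  have Lp (j : 'I_2) : L2 (pd j p) := smooth_L2_pd j sp.
  have Lq (j : 'I_2) : L2 (pd j q) := smooth_L2_pd j sq.
  pose E z := (pd 0 p z - wpd 0 w0 z) ^+ 2 + (pd 1 p z - wpd 1 w0 z) ^+ 2
    + (pd 0 q z - wpd 0 w1 z) ^+ 2 + (pd 1 q z - wpd 1 w1 z) ^+ 2.
  have D (f g : R * R -> R) : L2 f -> L2 g -> mu.-integrable Q (EFin \o (fun z =>
    (f z - g z) ^+ 2)).
    by move=> Lf Lg'; exact: (L2_itg_sqr (L2B Lf Lg')).
  have iE1 := itgD (D _ _ (Lp 0) (Lw _ Hw0 0)) (D _ _ (Lp 1) (Lw _ Hw0 1)).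
  have iE2 := itgD iE1 (D _ _ (Lq 0) (Lw _ Hw1 0)).
  have iE : mu.-integrable Q (EFin \o E) := itgD iE2 (D _ _ (Lq 1) (Lw _ Hw1 1)).
  have EI : \int[mu]_(z in Q) E z <= 4 * e ^+ 2.
    rewrite /E (RintegralD mQ iE2 (D _ _ (Lq 1) (Lw _ Hw1 1))).
    rewrite (RintegralD mQ iE1 (D _ _ (Lq 0) (Lw _ Hw1 0))).
    rewrite (RintegralD mQ (D _ _ (Lp 0) (Lw _ Hw0 0)) (D _ _ (Lp 1) (Lw _ Hw0 1))).
    exact: (sum4_le (Hp 0) (Hp 1) (Hq 0) (Hq 1)).
  have iP := itg_excess mf fK (Lg 0 0) (Lg 0 1) (Lg 1 0) (Lg 1 1) (Lp 0) (Lp 1) (Lq 0)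
    (Lq 1).
  have P0 : 0 <= \int[mu]_(z in Q) excess (f_coef s t z)
      (grad u z 0 0) (grad u z 0 1) (grad u z 1 0) (grad u z 1 1)
      (pd 0 p z) (pd 1 p z) (pd 0 q z) (pd 1 q z).
    pose phi z : 'cV[R]_2 := \col_i (if i == 0 then p z else q z).
    have cp0 : cpt phi 0 = p by apply/funext => z; rewrite /cpt mxE.
    have cp1 : cpt phi 1 = q by apply/funext => z; rewrite /cpt mxE.
    have tphi : test_funv phi by apply: dirP; rewrite ?cp0 ?cp1.
    have iM := @L2_itgM R.
    have iS1 : mu.-integrable Q (EFin \o (fun z =>
      2 * (grad u z 0 0 * pd 0 p z + grad u z 0 1 * pd 1 p z
       + grad u z 1 0 * pd 0 q z + grad u z 1 1 * pd 1 q z))).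
      apply: itgZ.
      exact: itgD (itgD (itgD (iM _ _ (Lg 0 0) (Lp 0)) (iM _ _ (Lg 0 1) (Lp 1)))
        (iM _ _ (Lg 1 0) (Lq 0))) (iM _ _ (Lg 1 1) (Lq 1)).
    have iS2 : mu.-integrable Q (EFin \o (fun z => f_coef s t z *
       (grad u z 1 1 * pd 0 p z - grad u z 1 0 * pd 1 p z
       - grad u z 0 1 * pd 0 q z + grad u z 0 0 * pd 1 q z))).
      apply: (itg_bounded_mul mf fK).
      exact: itgD (itgB (itgB (iM _ _ (Lg 1 1) (Lp 0)) (iM _ _ (Lg 1 0) (Lp 1)))
        (iM _ _ (Lg 0 1) (Lq 0))) (iM _ _ (Lg 0 0) (Lq 1)).
    have iH1 : mu.-integrable Q (EFin \o (fun z =>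
      pd 0 p z ^+ 2 + pd 1 p z ^+ 2 + pd 0 q z ^+ 2 + pd 1 q z ^+ 2)).
      exact: itgD (itgD (itgD (L2_itg_sqr (Lp 0)) (L2_itg_sqr (Lp 1)))
        (L2_itg_sqr (Lq 0))) (L2_itg_sqr (Lq 1)).
    have iH2 : mu.-integrable Q (EFin \o (fun z =>
      f_coef s t z * (pd 0 p z * pd 1 q z - pd 1 p z * pd 0 q z))).
      by apply: (itg_bounded_mul mf fK);
        exact: itgB (iM _ _ (Lp 0) (Lq 1)) (iM _ _ (Lp 1) (Lq 0)).
    rewrite /excess (RintegralD mQ (itgD iS1 iS2) (itgD iH1 iH2)).
    apply: addr_ge0; last exact: hadamard_mean y1 tp tq.
    rewrite le_eqVlt; apply/orP; left; apply/eqP; rewrite -[LHS](sol phi tphi).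
    apply: eq_Rintegral => z _; rewrite mdotE cofdotE.
    have gE (i j : 'I_2) : cgrad phi z i j = pd j (cpt phi i) z by rewrite mxE.
    by rewrite !gE cp0 cp1.
  have iR := itgZ (1 + K) (itgD (itgZ e iA) (itgZ (2 / e + 1) iE)).
  have := le_Rintegral mQ (itgB iP iR) iI (fun z Qz =>
    excess_perturb (grad u z 0 0) (grad u z 0 1) (grad u z 1 0) (grad u z 1 1)
      (wpd 0 w0 z) (wpd 1 w0 z) (wpd 0 w1 z) (wpd 1 w1 z)
      (pd 0 p z) (pd 1 p z) (pd 0 q z) (pd 1 q z) (fK z Qz) e0).
  rewrite (RintegralB mQ iP iR) (RintegralZl _ mQ (itgD (itgZ e iA)
    (itgZ (2 / e + 1) iE))).
  rewrite (RintegralD mQ (itgZ e iA) (itgZ (2 / e + 1) iE)).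
  rewrite (RintegralZl _ mQ iA) (RintegralZl _ mQ iE) -/I -/a => HH.
  move: P0 HH EI; move: (\int[mu]_(z in Q) excess _ _ _ _ _ _ _ _ _)
    (\int[mu]_(z in Q) E z) => X Y.
  clearbody I a K; clear -e0 e1 K0 A0 => X0 HH YE.
  have H : (2 / e + 1) * Y <= (2 / e + 1) * (4 * e ^+ 2).
    by rewrite ler_wpM2l// addr_ge0// divr_ge0// ltW.
  have H2 : (2 / e + 1) * (4 * e ^+ 2) <= 12 * e.
    have -> : (2 / e + 1) * (4 * e ^+ 2) = 8 * e + 4 * (e * e) by field; rewrite gt_eqF.
    have : e * e <= e * 1 by rewrite ler_wpM2l// ltW.
    by clear; lra.
  have H3 : (1 + K) * (e * a + (2 / e + 1) * Y) <= (1 + K) * (e * a + 12 * e).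
    by rewrite ler_wpM2l ?addr_ge0// lerD2l (le_trans H).
  have -> : (1 + K) * (a + 12) * e = (1 + K) * (e * a + 12 * e) by ring.
  move: H3 HH X0; move: ((1 + K) * _) ((1 + K) * _) => k1 k2; clear; lra.
rewrite leNgt; apply/negP => I0.
pose L := (1 + K) * (a + 12).
have L0 : 0 < L by apply: mulr_gt0; [exact: ltr_pwDl|apply: ltr_wpDl A0 _; exact: ltr0n].
(* For negative I, the bound key at this e reads I / 2 <= I. *)
pose e := Num.min 1 (- I / (2 * L)).
have L20 : 0 < 2 * L by apply: mulr_gt0 L0; exact: ltr0n.
have e0 : 0 < e by rewrite lt_min ltr01; apply: divr_gt0 L20; rewrite oppr_gt0.
have e1 : e <= 1 by rewrite ge_min lexx.
have := key e e0 e1; rewrite -/L.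
have : L * e <= - I / 2.
  have : e <= - I / (2 * L) by rewrite ge_min lexx orbT.
  rewrite (ler_pdivlMr _ _ L20) => H; rewrite (ler_pdivlMr _ _ (ltr0n _ 2)).
  by apply: le_trans H; rewrite mulrC mulrA mulrC.
move: I0; move: (L * e) => k; clearbody I; clear; lra.
Qed.

Lemma is_weak_pd_zero (j : 'I_2) : is_weak_pd j (fun=> 0 : R) (fun=> 0).
Proof.
split; first by apply: L2_continuous => z; exact: cvg_cst.
move=> phi _; under eq_Rintegral do rewrite mul0r.
by under [in RHS]eq_Rintegral do rewrite mul0r; rewrite Rintegral_cst// mul0r oppr0.
Qed.

Lemma is_trace_zero : is_trace (fun=> 0 : R) (cst 0).
Proof.
have b0 : bnd_sqnorm (cst (0 : R)) = 0%E.
  by rewrite bnd_sqnormE /= expr0n /= !integral0 !adde0.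
have H0 : H1 (fun=> 0 : R).
  split; first by apply: L2_continuous => z; exact: cvg_cst.
  by move=> j; exists (fun=> 0); exact: is_weak_pd_zero.
split; first by split; [move=> k; exact: measurable_cst|rewrite b0].
exists (fun _ => fun=> 0); split.
- by move=> _ n; exact: Ck_cst.
- split=> [|j].
    apply: cvg_near_cst; apply: nearW => n.
    by under eq_integral do rewrite subrr expr0n; rewrite integral0.
  apply: cvg_near_cst; apply: nearW => n.
  have ae := weak_pd_unique (wpdP j H0) (is_weak_pd_zero j).
  apply: etrans (integral0 mu Q); apply: ae_eq_integral => //.
    have [[mw _] _] := wpdP j H0.
    apply/measurable_EFinP; apply: measurable_funX; rewrite pd_cst.
    by apply: measurable_funB.
  by apply: aeS ae => z Hz Qz; rewrite pd_cst (Hz Qz) subrr expr0n.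
- apply: cvg_near_cst; apply: nearW => n.
  by rewrite -[RHS]b0; congr bnd_sqnorm; apply/funext => z; rewrite subrr.
Qed.

Lemma dirichlet_finite (v : R * R -> 'cV[R]_2) : H1v v ->
  mu.-integrable Q (EFin \o (fun z => normsq (grad v z))).
Proof.
move=> Hv.
have Lg (i j : 'I_2) : L2 (fun z => grad v z i j).
  have -> : (fun z => grad v z i j) = wpd j (cpt v i) by apply/funext => z; rewrite mxE.
  by have [] := wpdP j (Hv i).
have -> : (fun z => normsq (grad v z)) = (fun z => grad v z 0 0 ^+ 2 + grad v z 0 1 ^+ 2
  + grad v z 1 0 ^+ 2 + grad v z 1 1 ^+ 2) by apply/funext => z; rewrite normsqE.
have S := @L2_itg_sqr R.
exact: itgD (itgD (itgD (S _ (Lg 0 0)) (S _ (Lg 0 1))) (S _ (Lg 1 0))) (S _ (Lg 1 1)).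
Qed.

(** The hypothesis is the determinant constraint; it is what leaves f free. *)
Lemma excess_expand (f a b c d x y z t : R) :
  (a + x) * (d + t) - (b + y) * (c + z) = a * d - b * c ->
  (a + x) ^+ 2 + (b + y) ^+ 2 + (c + z) ^+ 2 + (d + t) ^+ 2 =
  a ^+ 2 + b ^+ 2 + c ^+ 2 + d ^+ 2 + excess f a b c d x y z t.
Proof.
move=> H; rewrite /excess.
have -> : (x * t - y * z) = - (d * x - c * y - b * z + a * t).
  by move/eqP: H; rewrite -subr_eq0 => /eqP H; apply/eqP; rewrite -subr_eq0 -H;
    apply/eqP; ring.
by ring.
Qed.

End Excess.

Theorem proposition3p13 (R : realType) (eps : R) (s : R -> R)
    (hs : branch_fun eps s)
    (sigma tau : R) (hB : branch eps s (sigma, tau))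
    (u : R * R -> 'cV[R]_2)
    (hu : H1v u)
    (hsol : weak_solution (f_coef sigma tau) u)
    (hS : in_family_S sigma tau u) :
  let g := fun x : R * R => \det (grad u x) in
  global_minimizer dirichlet (A_set u g) u.
Proof.
move=> g.
have y1 : y_fun sigma tau < 1.
  by case: hB => t tI [-> ->]; case: hs => _ _ _ _; exact.
split.
  split; last by apply: aeW.
  split=> // i.
  have -> : cpt (fun x => u x - u x) i = (fun=> 0 : R).
    by apply/funext => x; rewrite /cpt subrr mxE.
  exact: is_trace_zero.
move=> v [[Hv tr] detv].
pose mu : {measure set (measurableTypeR R * measurableTypeR R) -> \bar R} := leb2.
have mQ : measurable (Q : set (measurableTypeR R * measurableTypeR R)) := measurable_Q.
pose w i x := cpt v i x - cpt u i x.
have wE i : cpt (fun x => v x - u x) i = w i.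
  by apply/funext => x; rewrite /cpt /w /cpt !mxE.
have Hw i : H1 (w i) := H1B (Hv i) (hu i).
have Tw i : is_trace (w i) (cst 0) by rewrite -wE.
have ge0 := Rintegral_excess_ge0 y1 hu hsol (Hw 0) (Hw 1) (Tw 0) (Tw 1).
pose F z := excess (f_coef sigma tau z)
    (grad u z 0 0) (grad u z 0 1) (grad u z 1 0) (grad u z 1 1)
    (wpd 0 (w 0) z) (wpd 1 (w 0) z) (wpd 0 (w 1) z) (wpd 1 (w 1) z).
have Lw i j : L2 (wpd j (w i)) by have [] := wpdP j (Hw i).
have Lg (i j : 'I_2) : L2 (fun z => grad u z i j).
  have -> : (fun z => grad u z i j) = wpd j (cpt u i) by apply/funext => z; rewrite mxE.
  by have [] := wpdP j (hu i).
have iF : mu.-integrable Q (EFin \o F).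
  exact: (itg_excess (@f_coef_measurable R sigma tau) (fun z _ =>
    f_coef_bounded sigma tau z)
    (Lg 0 0) (Lg 0 1) (Lg 1 0) (Lg 1 1) (Lw 0 0) (Lw 0 1) (Lw 1 0) (Lw 1 1)).
have iu := dirichlet_finite hu; have iv := dirichlet_finite Hv.
have E : dirichlet v = (\int[mu]_(z in Q) (normsq (grad u z) + F z)%:E)%E.
  apply: ae_eq_integral => //.
  - exact: measurable_int iv.
  - exact: measurable_int (itgD iu iF).
  have B i j := wpdB j (Hv i) (hu i).
  have := aeI (aeI (aeI (B 0 0) (B 0 1)) (aeI (B 1 0) (B 1 1))) detv.
  apply: aeS => z [[[b00 b01] [b10 b11]] dz] Qz; congr EFin.
  have vE (i j : 'I_2) : wpd j (w i) z = wpd j (cpt v i) z - wpd j (cpt u i) z ->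
      grad v z i j = grad u z i j + wpd j (w i) z.
    by move=> H; rewrite !mxE H addrC subrK.
  have e00 := vE _ _ (b00 Qz); have e01 := vE _ _ (b01 Qz).
  have e10 := vE _ _ (b10 Qz); have e11 := vE _ _ (b11 Qz).
  have := dz Qz; rewrite /g !det2E !normsqE e00 e01 e10 e11.
  exact: excess_expand.
rewrite E; have -> : dirichlet u = (\int[mu]_(z in Q) normsq (grad u z))%:E.
  exact: itg_EFin_integral.
rewrite (itg_EFin_integral (itgD iu iF)) lee_fin (RintegralD mQ iu iF) lerDl.
exact: ge0.
Qed.
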